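(* Let $d\ge2$ be an integer, $1<b<\frac{d+1}{d-1}$ and $\lambda\in\operatorname{Arc}[\lambda_0,\lambda_2)$. Then the rational semigroup $\widehat H=\langle\widehat f_1,\dots,\widehat f_d\rangle$ is hyperbolic.
   Context: $\mathbb S^1$ is the unit circle. For $\alpha,\beta\in\mathbb S^1$, $\operatorname{Arc}[\alpha,\beta]$ is the closed circular arc from $\alpha$ to $\beta$ traversed counterclockwise, with analogous notation for open and half-open arcs. For $1\le k\le d$ let $f_k(z)=f_{k,\lambda}(z)=\lambda\left(\frac{z+b}{bz+1}\right)^k$. Put $\widehat f_d=f_d$ and $\widehat f_k=f_1\circ f_k$ for $1\le k\le d-1$; $\widehat H$ is the semigroup under composition generated by $\widehat f_1,\dots,\widehat f_d$. The Fatou set $F_G$ of a semigroup $G$ of rational maps is the set of points of $\widehat{\mathbb C}$ having a neighborhood on which $G$ is a normal family. The postcritical set of $G$ is $P_G=\overline{\bigcup_{g\in G}\{\text{critical values of }g\}}$, and $G$ is called hyperbolic if $P_G\subset F_G$. $\lambda_0=e^{i\theta_0}\in\mathbb S^1$ is the parameter with the smallest positive angle $\theta_0$ for which $f_{d,\lambda_0}(\lambda_0)=1$; $\lambda_1\in\mathbb S^1$ is the unique parameter with $0<\arg\lambda_1<\pi$ for which $f_{d,\lambda_1}$ has a parabolic fixed point; one has $0<\arg\lambda_0<\arg\lambda_1<\pi$. For $\lambda\in\operatorname{Arc}(\overline{\lambda_1},\lambda_1)$ the map $f_{d,\lambda}$ has a unique attracting fixed point, which lies on $\mathbb S^1$;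 $I_\lambda$ denotes the connected component of (Fatou set of $f_{d,\lambda}$)$\,\cap\,\mathbb S^1$ containing it. $\lambda_2\in\operatorname{Arc}(\lambda_0,\lambda_1]$ is the parameter of maximal argument such that for every $\lambda\in\operatorname{Arc}[\lambda_0,\lambda_2)$ and every $k\in\{1,\dots,d-1\}$ the closure of $f_{1,\lambda}\circ f_{k,\lambda}(I_\lambda)$ is contained in $I_\lambda$ (such a parameter exists). *)

(* Defs.v *)
From HB Require Import structures.
From mathcomp Require Import all_boot all_order all_algebra.
From mathcomp Require Import all_classical all_reals all_analysis.
From mathcomp Require Export complex.

Set Implicit Arguments.
Unset Strict Implicit.
Unset Printing Implicit Defensive.

Import Order.TTheory GRing.Theory Num.Theory.
Import numFieldTopology.Exports numFieldNormedType.Exports.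

Local Open Scope classical_set_scope.
Local Open Scope ring_scope.
Local Open Scope complex_scope.

(** * The Riemann sphere *)

Definition stereo (R : realType) (z : option R[i]) : R * R * R :=
  if z is Some (x +i* y) then
    let n := x ^+ 2 + y ^+ 2 in
    (2 * x / (n + 1), 2 * y / (n + 1), (n - 1) / (n + 1))
  else (0, 0, 1).

(* [None] is the point at infinity.  The topology and the uniform structure
   are those of the unit sphere of R^3, pulled back by stereographic
   projection, so uniform convergence is uniform convergence for the chordal
   (equivalently, the spherical) metric. *)
Definition sphere (R : realType) : Type := initial_topology (@stereo R).

Section Sphere.
Context {R : realType}.
Implicit Types (p z : sphere R) (g : sphere R -> sphere R).

(* The chart around [p]: the identity if [p] is finite, w |-> 1 / w if [p] is
   infinity.  [to_chart None] relies on 0^-1 = 0 only at the point [Some 0],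
   and [to_chart (Some _)] is irrelevant at [None]: both lie away from [p]. *)
Definition to_chart p z : R[i] :=
  match p, z with
  | Some _, Some w => w
  | None, Some w => w^-1
  | _, None => 0
  end.

Definition of_chart p (w : R[i]) : sphere R :=
  if p is Some _ then Some w else if w == 0 then None else Some w^-1.

(* Complex derivative of [g] at [p], read in the charts around [p] and [g p];
   at a fixed point of [g] this is the multiplier. *)
Definition sphere_deriv g p : R[i] :=
  derive1 (to_chart (g p) \o g \o of_chart p : R[i] -> R[i]^o) (to_chart p p).

Definition critical_point g p := sphere_deriv g p = 0.

Definition critical_values g : set (sphere R) := g @` critical_point g.

Definition attracting_fixed_point g p :=
  g p = p /\ `|sphere_deriv g p| < 1.

Definition parabolic_fixed_point g p :=
  g p = p /\ exists2 n : nat, (0 < n)%N & sphere_deriv g p ^+ n = 1.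

(** * Semigroups of self-maps of the sphere *)

Inductive generated_semigroup (S : set (sphere R -> sphere R)) :
    set (sphere R -> sphere R) :=
| generated_gen g : S g -> generated_semigroup S g
| generated_comp g h : generated_semigroup S g -> generated_semigroup S h ->
    generated_semigroup S (g \o h).

(* Every sequence in [G] has a subsequence converging locally uniformly on
   [U] (to some map into the sphere, possibly the constant infinity). *)
Definition normal_on (U : set (sphere R)) (G : set (sphere R -> sphere R)) :=
  forall u : nat -> sphere R -> sphere R, (forall n, G (u n)) ->
  exists phi : nat -> nat, (forall n, (phi n < phi n.+1)%N) /\
  exists h : sphere R -> sphere R,
    forall K : set (sphere R), compact K -> K `<=` U ->
      {uniform K, (u \o phi) n @[n --> \oo] --> h}.

Definition Fatou (G : set (sphere R -> sphere R)) : set (sphere R) :=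
  [set z | exists U, [/\ open U, U z & normal_on U G]].

Definition postcritical (G : set (sphere R -> sphere R)) : set (sphere R) :=
  closure (\bigcup_(g in G) critical_values g).

Definition hyperbolic_semigroup (G : set (sphere R -> sphere R)) :=
  postcritical G `<=` Fatou G.

(** * The unit circle *)

Definition expi (t : R) : R[i] := cos t +i* sin t.

(* Principal argument, in ]-pi, pi], of a point of the unit circle. *)
Definition circle_arg (z : R[i]) : R :=
  if 0 <= complex.Im z then acos (complex.Re z) else - acos (complex.Re z).

(* Arc[a, b], the closed arc run counterclockwise; it is {a} when a = b. *)
Definition arc_cc (a b : R[i]) : set R[i] :=
  [set z | exists s t u : R,
    [/\ a = expi s, b = expi t, z = expi u, s <= u <= t & t < s + 2 * pi]].

Definition arc_co (a b : R[i]) : set R[i] := arc_cc a b `\ b.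

Definition arc_oc (a b : R[i]) : set R[i] := arc_cc a b `\ a.

Definition sphere_circle : set (sphere R) :=
  [set z | exists2 w : R[i], `|w| = 1 & z = Some w].

(** * The family *)

(* f_{k,lam}(z) = lam ((z + b) / (b z + 1)) ^ k on the sphere (for k >= 1,
   b > 1), with its pole at -1/b and its value lam / b ^ k at infinity. *)
Definition fpow (b : R) (k : nat) (lam : R[i]) (z : sphere R) : sphere R :=
  if z is Some w then
    if b%:C * w + 1 == 0 then None
    else Some (lam * ((w + b%:C) / (b%:C * w + 1)) ^+ k)
  else Some (lam * (b%:C)^-1 ^+ k).

Definition fhat (d : nat) (b : R) (lam : R[i]) (k : nat) :
    sphere R -> sphere R :=
  if k == d then fpow b d lam else fpow b 1 lam \o fpow b k lam.

Definition Hhat (d : nat) (b : R) (lam : R[i]) :=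
  generated_semigroup
    [set g | exists2 k : nat, (1 <= k <= d)%N & g = fhat d b lam k].

(* I_lam: the component of (Fatou set of f_{d,lam}) /\ S^1 containing the
   attracting fixed point of f_{d,lam}.  The union runs over that single
   point in the range of parameters where [attr_arc] is used. *)
Definition attr_arc (d : nat) (b : R) (lam : R[i]) : set (sphere R) :=
  \bigcup_(p in attracting_fixed_point (fpow b d lam))
    connected_component
      (Fatou (generated_semigroup [set fpow b d lam]) `&` sphere_circle) p.

Definition is_lambda0 (d : nat) (b : R) (lam0 : R[i]) :=
  exists2 theta0 : R, lam0 = expi theta0 &
  [/\ 0 < theta0,
      fpow b d (expi theta0) (Some (expi theta0)) = Some 1
    & forall theta : R, 0 < theta ->
        fpow b d (expi theta) (Some (expi theta)) = Some 1 ->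
        theta0 <= theta].

Definition is_lambda1 (d : nat) (b : R) (lam1 : R[i]) :=
  [/\ `|lam1| = 1, 0 < circle_arg lam1 < pi
    & exists p, parabolic_fixed_point (fpow b d lam1) p].

Definition lambda2_admissible (d : nat) (b : R) (lam0 lam1 mu : R[i]) :=
  arc_oc lam0 lam1 mu /\
  forall lam, arc_co lam0 mu lam ->
  forall k : nat, (1 <= k <= d.-1)%N ->
    closure ((fpow b 1 lam \o fpow b k lam) @` attr_arc d b lam)
      `<=` attr_arc d b lam.

Definition is_lambda2 (d : nat) (b : R) (lam0 lam1 lam2 : R[i]) :=
  lambda2_admissible d b lam0 lam1 lam2 /\
  forall mu, lambda2_admissible d b lam0 lam1 mu ->
    circle_arg mu <= circle_arg lam2.

End Sphere.

(* Main.v *)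
(* With [lam = expi (2 v)], the map [f_k] sends the point of the circle with
   half-angle [s] to the one with half-angle [v - k h(s)], where
   [h(s) = atan (kap * tan s)], [kap = (b - 1) / (b + 1) < 1 / d].  The conditions
   on the parameter give [v <= d h(v)] and [v < V], where [2 V] is the argument
   of lambda_1; they make I_lam an arc [x < s < y] in the upper half of the
   circle, whose endpoints are exchanged by [f_d].

   By an explicit form of Schwarz's lemma the generators do not increase the
   hyperbolic distance on either side of the unit circle, and [f_d] does not
   increase it on the cap, i.e. the disc orthogonal to the circle along I_lam;
   the maps [f_1 f_k], [k < d], send this cap into a smaller one.  Hence every
   generator maps into itself a large hyperbolic disc B of the cap around the
   attracting fixed point.  The points off the circle that lie within a given
   hyperbolic distance (in their own side) of B then form an invariant set,
   which for a large distance contains the critical values of the generators.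
   So the postcritical set is in the closure of this set, which meets the circle
   inside B, thus in the cap.  By the same contractions the semigroup is
   equicontinuous off the circle and on the cap. *)

Require Import Defs.
From HB Require Import structures.
From mathcomp Require Import all_boot all_order all_algebra.
From mathcomp Require Import all_classical all_reals all_analysis.
From mathcomp Require Import ring lra.
Import Order.TTheory GRing.Theory Num.Theory.
Import numFieldTopology.Exports numFieldNormedType.Exports.
Set Implicit Arguments.
Unset Strict Implicit.
Unset Printing Implicit Defensive.
Local Open Scope classical_set_scope.
Local Open Scope ring_scope.
Local Open Scope complex_scope.

(** * Equicontinuity and normality *)

Section Sphere.
Variable R : realType.
Implicit Types (z w : sphere R).

(** Schwarz's lemma is proved here by algebra. A spherical disc is where a Hermitian form in
    homogeneous coordinates is positive; [lZ] and [lcap] are normalized to determinant -1, and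
    contraction compares the determinant [hdet] of two vectors with the values of the forms. Moebius
    maps give equality. For powers, [hdet] of a coordinatewise product obeys a Leibniz rule, and
    induction on the exponent leaves one inequality between forms: an identity for the sides of the
    circle, a sum of squares for caps.

    The obstacle is that the critical values 0 and infinity lie outside the cap, where no strict
    contraction is available, while the metrics of both sides blow up at the circle. Written as
    [chord2 xi eta <= C' * (sZ xi * sZ eta)], bounded distance makes this blow-up useful: as [xi]
    tends to the circle, [eta] merges with it, so the limit stays in the closed disc B.

    The condition v <= d h(v) coming from lambda_0 says that the second iterate of the half-angle
    map does not move 0 forward. This keeps the left endpoint of the arc nonnegative, hence all
    half-angles in play where the tangent is increasing. *)

Lemma stereo_onto (x y t : R) : x ^+ 2 + y ^+ 2 + t ^+ 2 = 1 ->
  exists z : sphere R, stereo z = (x, y, t).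
Proof.
move=> e; have [t1|t1] := eqVneq t 1.
  exists None; rewrite t1 /=.
  have xy : x ^+ 2 + y ^+ 2 == 0 by apply/eqP; move: e; rewrite t1; lra.
  move: xy; rewrite paddr_eq0 ?sqr_ge0// !sqrf_eq0.
  by case/andP => /eqP -> /eqP ->.
have t1' : 1 - t != 0 by rewrite subr_eq0 eq_sym.
exists (Some ((x / (1 - t)) +i* (y / (1 - t)))) => /=.
have -> : (x / (1 - t)) ^+ 2 + (y / (1 - t)) ^+ 2 = (1 + t) / (1 - t).
  have -> : (x / (1 - t)) ^+ 2 + (y / (1 - t)) ^+ 2 =
            (x ^+ 2 + y ^+ 2) / (1 - t) ^+ 2 by field.
  have -> : x ^+ 2 + y ^+ 2 = (1 - t) * (1 + t) by lra.
  by field.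
have n1 : (1 + t) / (1 - t) + 1 = 2 / (1 - t) by field.
have n2 : (1 + t) / (1 - t) - 1 = 2 * t / (1 - t) by field.
by rewrite n1 n2; congr (_, _, _); field.
Qed.

Lemma stereo_inj : injective (@stereo R).
Proof.
move=> [[x y]|] [[x' y']|] //=.
- pose n := x ^+ 2 + y ^+ 2 + 1; pose n' := x' ^+ 2 + y' ^+ 2 + 1.
  have n0 : n != 0 by rewrite gt_eqF// ltr_wpDl// addr_ge0 ?sqr_ge0.
  have n'0 : n' != 0 by rewrite gt_eqF// ltr_wpDl// addr_ge0 ?sqr_ge0.
  rewrite -/n -/n' => -[ex ey et].
  have en : n = n'.
    have e1 : (n - 2) / n = (n' - 2) / n'.
      have -> : n - 2 = x ^+ 2 + y ^+ 2 - 1 by rewrite /n; ring.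
      by rewrite et; congr (_ / _); rewrite /n'; ring.
    have h (m : R) : m != 0 -> (m - 2) / m = 1 - 2 / m by move=> m0; field.
    move: e1; rewrite !h// => /addrI/oppr_inj/(mulfI _) e1.
    by apply: invr_inj; apply: e1; rewrite pnatr_eq0.
  move: ex ey; rewrite en => ex ey.
  have i0 : n'^-1 != 0 by rewrite invr_eq0.
  move: ex ey => /(mulIf i0) ex /(mulIf i0) ey.
  by congr (Some (_ +i* _)); lra.
- have : x ^+ 2 + y ^+ 2 + 1 != 0.
    by rewrite gt_eqF// ltr_wpDl// addr_ge0 ?sqr_ge0.
  move=> n0 [_ _ e]; have : x ^+ 2 + y ^+ 2 - 1 = x ^+ 2 + y ^+ 2 + 1.
    by apply: (mulIf (_ : (x ^+ 2 + y ^+ 2 + 1)^-1 != 0)); rewrite ?invr_eq0// divff.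
  by move=> ?; exfalso; lra.
- have : x' ^+ 2 + y' ^+ 2 + 1 != 0.
    by rewrite gt_eqF// ltr_wpDl// addr_ge0 ?sqr_ge0.
  move=> n0 [_ _ e]; have : x' ^+ 2 + y' ^+ 2 - 1 = x' ^+ 2 + y' ^+ 2 + 1.
    by apply: (mulIf (_ : (x' ^+ 2 + y' ^+ 2 + 1)^-1 != 0)); rewrite ?invr_eq0// divff.
  by move=> ?; exfalso; lra.
Qed.

Lemma stereo_norm z :
  (stereo z).1.1 ^+ 2 + (stereo z).1.2 ^+ 2 + (stereo z).2 ^+ 2 = 1.
Proof.
case: z => [[x y]|] /=; last by rewrite expr0n expr1n !add0r.
have : x ^+ 2 + y ^+ 2 + 1 != 0.
  by rewrite gt_eqF// ltr_wpDl// addr_ge0 ?sqr_ge0.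
move=> ?; by field.
Qed.

Lemma stereo_continuous : continuous (@stereo R : sphere R -> R * R * R).
Proof. exact: initial_continuous. Qed.

(** The topology being initial for [stereo], the inverse [s] is continuous on the unit sphere as
    soon as [stereo \o s] is, and there this composite is the identity. *)
Lemma sphere_compact : compact [set: sphere R].
Proof.
pose S : set (R * R * R) :=
  [set p | p.1.1 ^+ 2 + p.1.2 ^+ 2 + p.2 ^+ 2 = 1].
have cS : compact S.
  apply: (@subclosed_compact _ S (`[-1, 1] `*` `[-1, 1] `*` `[-1, 1])).
  - have -> : S = (fun p : R * R * R => p.1.1 ^+ 2 + p.1.2 ^+ 2 + p.2 ^+ 2) @^-1`
        [set 1] by [].
    apply: closed_comp; last exact: closed_eq.
    have c2 (f : R * R * R -> R) : continuous f -> continuous (fun p => f p ^+ 2).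
      by move=> cf p; apply: (@continuous_comp _ _ _ f (fun x => x ^+ 2)); [exact: cf|exact: exprn_continuous].
    have c11 : continuous (fun p : R * R * R => p.1.1).
      by move=> p; apply: (@continuous_comp _ _ _ fst fst); exact: cvg_fst.
    have c12 : continuous (fun p : R * R * R => p.1.2).
      by move=> p; apply: (@continuous_comp _ _ _ fst snd); [exact: cvg_fst|exact: cvg_snd].
    have c22 : continuous (fun p : R * R * R => p.2) by move=> p; exact: cvg_snd.
    by move=> p _; do ?apply: cvgD; exact: c2.
  - by apply: compact_setX; [apply: compact_setX|]; exact: segment_compact.
  - move=> [[x y] t]; rewrite /S /= => e.
    have := sqr_ge0 x; have := sqr_ge0 y; have := sqr_ge0 t => t2 y2 x2.
    have h (u : R) : u ^+ 2 <= 1 -> u \in `[-1, 1].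
      by move=> u1; rewrite in_itv /= -ler_norml -sqrtr_sqr -sqrtr1 ler_sqrt.
    by split; [split|]; apply: h; lra.
pose s (p : R * R * R) : sphere R := get [set z : sphere R | stereo z = p].
have sK p : S p -> stereo (s p) = p.
  move=> Sp; rewrite /s; case: (stereo_onto Sp) => z zp.
  apply: (@getPex _ [set z : sphere R | stereo z = p]); exists z; rewrite /= zp.
  by move: {Sp zp} p => [[]].
have sE z : s (stereo z) = z.
  rewrite /s; have : stereo (get [set w : sphere R | stereo w = stereo z]) = stereo z.
    by apply: (@getPex _ [set w : sphere R | stereo w = stereo z]); exists z.
  by move/stereo_inj.
have -> : [set: sphere R] = s @` S.
  by apply/seteqP; split => // z _; exists (stereo z); [exact: stereo_norm|].
apply: continuous_compact => //.
apply: continuous_comp_initial.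
apply: (@subspace_eq_continuous _ S _ (fun p : subspace S => p : R * R * R)
  (fun p : subspace S => stereo (s p))); last first.
  by apply: (@continuous_subspaceT _ _ S id) => p; exact: cvg_id.
by move=> p /set_mem /sK.
Qed.

Lemma sphere_finite_net (e : R) : 0 < e ->
  exists F : seq (sphere R), forall z, exists2 w, w \in F & ball z e w.
Proof.
move=> e0; have := sphere_compact; rewrite compact_cover => /(_ _ [set: sphere R]
  (fun w => (ball w e)°)) [].
- by move=> w _; exact: open_interior.
- move=> z _; exists z => //; exact: nbhsx_ballx.
- move=> D _ DT; exists (finmap.enum_fset D) => z.
  have [w /= wD wz] := DT z I; exists w => //.
  by apply: ball_sym; exact: interior_subset.
Qed.

Lemma natSinv_lt (e : R) : 0 < e -> exists n : nat, n.+1%:R^-1 < e.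
Proof.
move=> e0; have [n _ /(_ n (leqnn n)) nP] := near_infty_natSinv_lt (PosNum e0).
by exists n.
Qed.

Lemma seq_bounded_choice (T : eqType) (s : seq T) (P : T -> nat -> Prop) :
  (forall x, x \in s -> exists j, P x j) ->
  exists N, forall x, x \in s -> exists2 j, (j <= N)%N & P x j.
Proof.
elim: s => [|y s IHs] Ps; first by exists 0%N.
have [|N NP] := IHs; first by move=> x xs; apply: Ps; rewrite inE xs orbT.
have [j Pj] := Ps y (mem_head _ _).
exists (maxn j N) => x; rewrite inE => /orP[/eqP ->|/NP[i iN Pi]].
  by exists j => //; exact: leq_maxl.
by exists i => //; rewrite (leq_trans iN)// leq_maxr.
Qed.

(* Ascoli's argument: Tychonoff provides a pointwise cluster point of the
   sequence, and finite nets let a subsequence approach it on a dense set. *)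
Lemma equicontinuous_normal (U : set (sphere R)) (G : set (sphere R -> sphere R)) :
  open U ->
  (forall z, U z -> forall e : R, 0 < e ->
     \forall w \near z, forall g, G g -> ball (g z) e (g w)) ->
  normal_on U G.
Proof.
move=> oU eqc u uG.
have cT := @tychonoff (sphere R) (fun=> sphere R) (fun=> setT) (fun=> sphere_compact).
have [] := cT ((u : nat -> prod_topology (fun _ : sphere R => sphere R)) @ \oo) _.
  exact: filterE.
move=> h [_ hu].
have FF : Filter (nbhs (h : prod_topology (fun _ : sphere R => sphere R))).
  exact: (@nbhs_filter (prod_topology (fun _ : sphere R => sphere R)) h).
have near1 (q : sphere R) (e : R) : 0 < e ->
    nbhs (h : prod_topology (fun _ : sphere R => sphere R))
      [set f | ball (h q) e (f q)].
  move=> e0; have := @proj_continuous (sphere R) (fun _ => sphere R) q h.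
  by move=> /(_ (ball (h q) e)); apply; exact: nbhsx_ballx.
pose F n := projT1 (cid (@sphere_finite_net n.+1%:R^-1 (ltac:(by rewrite invr_gt0)))).
have FP n z : exists2 w, w \in F n & ball z n.+1%:R^-1 w.
  by rewrite /F; case: cid => /= ? /(_ z).
have nears (e : R) (s : seq (sphere R)) : 0 < e ->
    nbhs (h : prod_topology (fun _ : sphere R => sphere R))
      [set f | forall q, q \in s -> ball (h q) e (f q)].
  move=> e0; elim: s => [|q s IHs].
    by apply: (@filterS _ _ _ setT); [move=> f _ q; rewrite in_nil|exact: filterT].
  apply: filterS (filterI (near1 q e e0) IHs) => f [fq fs] q'.
  by rewrite inE => /orP[/eqP -> //|]; exact: fs.
(* The n-th chosen term is close to [h] on all nets up to the n-th, so each fixed net is controlled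
   by all later terms. *)
have pick n N : {m | (N < m)%N /\ forall j, (j <= n)%N -> forall q, q \in F j ->
    ball (h q) n.+1%:R^-1 (u m q)}.
  apply: cid.
  have n0 : 0 < n.+1%:R^-1 :> R by rewrite invr_gt0.
  have uN : (u @ \oo) [set f | exists2 m, (N < m)%N & f = u m].
    by exists N.+1 => // m /= Nm; exists m.
  have [f [[m Nm ->] um]] :=
    hu _ _ uN (nears _ (flatten [seq F j | j <- iota 0 n.+1]) n0).
  exists m; split => // j jn q qF; apply: um; apply/flattenP; exists (F j) => //.
  by apply/mapP; exists j => //; rewrite mem_iota.
pose phi := fix phi n := if n is m.+1 then projT1 (pick m.+1 (phi m))
                         else projT1 (pick 0%N 0%N).
have phiS n : (phi n < phi n.+1)%N.
  by rewrite /=; case: (pick _ _) => m [].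
have phiP n j q : (j <= n)%N -> q \in F j -> ball (h q) n.+1%:R^-1 (u (phi n) q).
  case: n => [|n] jn qF.
    have [_ H] := projT2 (pick 0%N 0%N). exact (H j jn q qF).
  have [_ H] := projT2 (pick n.+1 (phi n)). exact (H j jn q qF).
exists phi; split => //; exists h => K cK KU.
(* The pointwise cluster point [h] inherits the modulus of equicontinuity: some [u m] is close to it
   at [z] and at [w] simultaneously. *)
have heqc z : U z -> forall e : R, 0 < e -> \forall w \near z, ball (h z) e (h w).
  move=> Uz e e0; have e3 : 0 < e / 3 by rewrite divr_gt0.
  apply: filterS (eqc z Uz _ e3) => w gw.
  have [f [[m _ ->] [hz hw]]] : exists f : sphere R -> sphere R,
      (exists2 m, True & f = u m) /\ ball (h z) (e / 3) (f z) /\ ball (h w) (e / 3) (f w).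
    have uN : (u @ \oo) [set f | exists2 m, True & f = u m].
      by exists 0%N => // m _; exists m.
    by have [f [? [? ?]]] := hu _ _ uN (filterI (near1 z _ e3) (near1 w _ e3)); exists f.
  have -> : e = e / 3 + e / 3 + e / 3 by field.
  apply: (@ball_triangle _ _ (u m w)); last exact: ball_sym.
  exact: ball_triangle hz (gw _ (uG m)).
move=> P /uniform_nbhs [E [entE EP]].
move: entE; rewrite -entourage_ballE => -[e /= e0 eE].
have e5 : 0 < e / 5 by rewrite divr_gt0.
move: cK; rewrite compact_cover => /(_ _ U (fun z => U `&` [set w | (forall g, G g -> ball (g z) (e / 5) (g w)) /\ ball (h z) (e / 5) (h w)]°)) [].
- by move=> z _; apply: openI => //; exact: open_interior.
- move=> z Kz; exists z; first exact: KU.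
  split; first exact: KU.
  by apply: filterI; [apply: eqc|apply: heqc] => //; exact: KU.
- move=> D DU KD.
  have netD z : z \in finmap.enum_fset D -> exists j, exists2 q, q \in F j &
      (forall g, G g -> ball (g z) (e / 5) (g q)) /\ ball (h z) (e / 5) (h q).
    move=> zD; have Uz : U z by move: (DU _ zD); rewrite inE.
    have /nbhs_ballP[r /= r0 rP] : nbhs z [set w | (forall g, G g -> ball (g z) (e / 5) (g w)) /\
        ball (h z) (e / 5) (h w)].
      exact: filterI (eqc z Uz _ e5) (heqc z Uz _ e5).
    have [n nr] := natSinv_lt r0.
    have [q qF zq] := FP n z.
    exists n, q => //; apply: rP; apply: le_ball zq; exact: ltW.
  have [N NP] := seq_bounded_choice netD.
  have [n0 n0e] := natSinv_lt e5.
  exists (maxn N n0) => // n /=; rewrite geq_max => /andP[Nn n0n].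
  apply: EP => y Ky; apply: eE => /=.
  have [z zD [Uy zy]] := KD y Ky.
  have {zy} [zy hzy] := interior_subset zy.
  have [j jN [q qF [gq hq]]] := NP z zD.
  have un : ball (h q) (e / 5) (u (phi n) q).
    have jn : (j <= n)%N by exact: leq_trans jN Nn.
    apply: le_ball (phiP n j q jn qF); apply: ltW; apply: le_lt_trans n0e.
    by rewrite lef_pV2 ?posrE// ler_nat ltnS.
  have -> : e = e / 5 + e / 5 + e / 5 + e / 5 + e / 5 by field.
  apply: ball_triangle (zy _ (uG _)).
  apply: ball_triangle (ball_sym (gq _ (uG _))).
  apply: ball_triangle un.
  apply: ball_triangle hq.
  exact: ball_sym.
Qed.

End Sphere.

(** * Hyperbolic contractions of spherical discs *)

Section Geometry.
Variable R : realType.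
Implicit Types (x y : R[i]) (z w : sphere R).

Definition sqn (x : R[i]) : R := complex.Re x ^+ 2 + complex.Im x ^+ 2.

Lemma ReD x y : complex.Re (x + y) = complex.Re x + complex.Re y.
Proof. by case: x y => [? ?] []. Qed.
Lemma ImD x y : complex.Im (x + y) = complex.Im x + complex.Im y.
Proof. by case: x y => [? ?] []. Qed.
Lemma ReN x : complex.Re (- x) = - complex.Re x. Proof. by case: x. Qed.
Lemma ImN x : complex.Im (- x) = - complex.Im x. Proof. by case: x. Qed.
Lemma ReM x y :
  complex.Re (x * y) = complex.Re x * complex.Re y - complex.Im x * complex.Im y.
Proof. by case: x y => [? ?] []. Qed.
Lemma ImM x y :
  complex.Im (x * y) = complex.Re x * complex.Im y + complex.Im x * complex.Re y.
Proof. by case: x y => [? ?] []. Qed.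
Lemma ReJ x : complex.Re (x ^*) = complex.Re x. Proof. by case: x. Qed.
Lemma ImJ x : complex.Im (x ^*) = - complex.Im x. Proof. by case: x. Qed.
Lemma ReC (a : R) : complex.Re a%:C = a. Proof. by []. Qed.
Lemma ImC (a : R) : complex.Im a%:C = 0. Proof. by []. Qed.
Lemma Re1 : complex.Re (1 : R[i]) = 1. Proof. by []. Qed.
Lemma Im1 : complex.Im (1 : R[i]) = 0. Proof. by []. Qed.
Lemma Re0 : complex.Re (0 : R[i]) = 0. Proof. by []. Qed.
Lemma Im0 : complex.Im (0 : R[i]) = 0. Proof. by []. Qed.

Definition reim := (ReD, ImD, ReN, ImN, ReM, ImM, ReJ, ImJ, ReC, ImC, Re1, Im1, Re0, Im0).

Lemma sqn_ge0 x : 0 <= sqn x.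
Proof. by rewrite addr_ge0 ?sqr_ge0. Qed.

Lemma sqn_eq0 x : (sqn x == 0) = (x == 0).
Proof.
case: x => a b; rewrite /sqn /= paddr_eq0 ?sqr_ge0// !sqrf_eq0.
by rewrite eq_complex.
Qed.

Lemma sqn0 : sqn 0 = 0.
Proof. by apply/eqP; rewrite sqn_eq0. Qed.

Lemma sqn_gt0 x : (0 < sqn x) = (x != 0).
Proof. by rewrite lt_def sqn_ge0 andbT sqn_eq0. Qed.

Lemma sqnM x y : sqn (x * y) = sqn x * sqn y.
Proof. by rewrite /sqn !reim; ring. Qed.

Lemma sqn1 : sqn 1 = 1.
Proof. by rewrite /sqn !reim expr1n expr0n addr0. Qed.

Lemma sqnX x k : sqn (x ^+ k) = sqn x ^+ k.
Proof. by elim: k => [|k IHk]; rewrite ?expr0 ?sqn1// !exprS sqnM IHk. Qed.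

Lemma sqn_norm x : (`|x| == 1) = (sqn x == 1).
Proof.
rewrite normc_def -[1 in LHS]/((1 : R)%:C) (inj_eq (@complexI _)) /sqn.
by rewrite -{1}sqrtr1 eqr_sqrt// addr_ge0 ?sqr_ge0.
Qed.

(* Homogeneous coordinates; [hpt 0 0] is a junk value. *)
Definition hpt (x y : R[i]) : sphere R := if y == 0 then None else Some (x / y).
Definition hx z : R[i] := if z is Some w then w else 1.
Definition hy z : R[i] := if z is Some w then 1 else 0.
Definition hN x y : R := sqn x + sqn y.

Lemma hN_gt0 x y : (x, y) != (0, 0) -> 0 < hN x y.
Proof.
rewrite xpair_eqE negb_and /hN => /orP[x0|y0].
  by rewrite ltr_wpDr ?sqn_ge0// sqn_gt0.
by rewrite ltr_wpDl ?sqn_ge0// sqn_gt0.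
Qed.

Lemma hptK z : hpt (hx z) (hy z) = z.
Proof.
by case: z => [w|]; rewrite /hpt /= ?eqxx// oner_eq0 divr1.
Qed.

Lemma hxy_neq0 z : (hx z, hy z) != (0, 0).
Proof. by case: z => [w|]; rewrite xpair_eqE /= oner_eq0 ?andbF. Qed.

Definition sX z : R := (stereo z).1.1.
Definition sY z : R := (stereo z).1.2.
Definition sZ z : R := (stereo z).2.

Lemma stereo_hpt x y : (x, y) != (0, 0) ->
  stereo (hpt x y) = (2 * complex.Re (x * y^*) / hN x y,
    2 * complex.Im (x * y^*) / hN x y, (sqn x - sqn y) / hN x y).
Proof.
move=> xy0; have N0 := hN_gt0 xy0; rewrite /hpt.
have [y0|y0] := eqVneq y 0.
  move: N0; rewrite y0 /hN sqn0 addr0 => N0.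
  by rewrite !reim !(mulr0, mul0r, oppr0, subr0, addr0) divff// gt_eqF.
have sy0 : sqn y != 0 by rewrite sqn_eq0.
case exy : (x / y) => [u v] /=.
have xE : x = (u +i* v) * y by rewrite -exy divfK.
have -> : u ^+ 2 + v ^+ 2 = sqn x / sqn y by rewrite xE sqnM mulfK.
have N0' : hN x y != 0 by rewrite gt_eqF.
have -> : complex.Re (x * y^*) = u * sqn y by rewrite xE /sqn !reim /=; ring.
have -> : complex.Im (x * y^*) = v * sqn y by rewrite xE /sqn !reim /=; ring.
have n1 : sqn x / sqn y + 1 = hN x y / sqn y by rewrite /hN; field.
rewrite n1; congr (_, _, _); rewrite /hN in N0' *; field; by rewrite sy0 N0'.
Qed.

Definition chord2 z w : R :=
  (sX z - sX w) ^+ 2 + (sY z - sY w) ^+ 2 + (sZ z - sZ w) ^+ 2.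

Lemma chord2_hpt x y x' y' : (x, y) != (0, 0) -> (x', y') != (0, 0) ->
  chord2 (hpt x y) (hpt x' y') = 4 * sqn (x * y' - x' * y) / (hN x y * hN x' y').
Proof.
move=> n0 n0'; rewrite /chord2 /sX /sY /sZ !stereo_hpt//=.
have := gt_eqF (hN_gt0 n0) => /negbT N0.
have := gt_eqF (hN_gt0 n0') => /negbT N0'.
case: x y x' y' {n0 n0'} N0 N0' => [a b] [c d] [a' b'] [c' d'].
rewrite /hN /sqn !reim /= => N0 N0'; field; by rewrite N0 N0'.
Qed.


(* When [0 < L] and [0 < L'] define round discs, [L] and [L'] being affine in the
   coordinates [stereo], [chord2 z w / (L z * L w)] is an increasing function of
   the hyperbolic distance of [z] and [w]. *)
Definition contracts (L L' : sphere R -> R) (g : sphere R -> sphere R) :=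
  forall z w, 0 < L z -> 0 < L w -> 0 < L' (g z) /\
    chord2 (g z) (g w) * (L z * L w) <= chord2 z w * (L' (g z) * L' (g w)).

Lemma contracts_comp L L' L'' f g :
  contracts L L' f -> contracts L' L'' g -> contracts L L'' (g \o f).
Proof.
move=> cf cg z w z0 w0; have [fz0 cfzw] := cf _ _ z0 w0.
have [fw0 _] := cf _ _ w0 z0; have [gz0 cgzw] := cg _ _ fz0 fw0.
have [gw0 _] := cg _ _ fw0 fz0; split => //=.
have p : 0 < L' (f z) * L' (f w) by rewrite mulr_gt0.
have q : 0 < L z * L w by rewrite mulr_gt0.
have r : 0 < L'' (g (f z)) * L'' (g (f w)) by rewrite mulr_gt0.
rewrite -(ler_pM2r p); apply: (@le_trans _ _
  (chord2 (f z) (f w) * (L'' (g (f z)) * L'' (g (f w))) * (L z * L w))).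
  by rewrite mulrAC ler_pM2r.
by rewrite mulrAC (mulrAC (chord2 z w)) ler_pM2r.
Qed.

Implicit Types (u v : R[i] * R[i]) (l m : R[i] * R[i] -> R).

Definition hdet u v : R[i] := u.1 * v.2 - v.1 * u.2.
Definition hn v : R := hN v.1 v.2.
Definition hsph v : sphere R := hpt v.1 v.2.
Definition hvec z : R[i] * R[i] := (hx z, hy z).

(** Lift of [contracts] to homogeneous coordinates: squared chords become squared determinants, and
    the norms [hn] cancel from the two sides. *)
Definition hcontracts l m (F : R[i] * R[i] -> R[i] * R[i]) :=
  forall u v, u != (0, 0) -> v != (0, 0) -> 0 < l u -> 0 < l v ->
  [/\ F u != (0, 0), 0 < m (F u) &
    sqn (hdet (F u) (F v)) * (l u * l v) <= sqn (hdet u v) * (m (F u) * m (F v))].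

Lemma hcontracts_comp l m p F G :
  hcontracts l m F -> hcontracts m p G -> hcontracts l p (G \o F).
Proof.
move=> cf cg z w z1 w1 z0 w0; have [Fz1 fz0 cfzw] := cf _ _ z1 w1 z0 w0.
have [Fw1 fw0 _] := cf _ _ w1 z1 w0 z0.
have [Gz1 gz0 cgzw] := cg _ _ Fz1 Fw1 fz0 fw0.
have [_ gw0 _] := cg _ _ Fw1 Fz1 fw0 fz0; split => //=.
have p0 : 0 < m (F z) * m (F w) by rewrite mulr_gt0.
have q : 0 < l z * l w by rewrite mulr_gt0.
have r : 0 < p (G (F z)) * p (G (F w)) by rewrite mulr_gt0.
rewrite -(ler_pM2r p0); apply: (@le_trans _ _
  (sqn (hdet (F z) (F w)) * (p (G (F z)) * p (G (F w))) * (l z * l w))).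
  by rewrite mulrAC ler_pM2r.
by rewrite mulrAC (mulrAC (sqn (hdet z w))) ler_pM2r.
Qed.

(* [L] is the function on the sphere induced by the Hermitian form [l]. *)
Definition hform (L : sphere R -> R) l :=
  forall v, v != (0, 0) -> L (hsph v) = l v / hn v.

Lemma contracts_hcontracts L M l m F g : hform L l -> hform M m ->
  hcontracts l m F -> (forall z, g z = hsph (F (hvec z))) -> contracts L M g.
Proof.
move=> Ll Mm cF gF z w; rewrite !gF.
have z1 : hvec z != (0, 0) by exact: hxy_neq0.
have w1 : hvec w != (0, 0) by exact: hxy_neq0.
have zE : z = hsph (hvec z) by rewrite /hsph hptK.
have wE : w = hsph (hvec w) by rewrite /hsph hptK.
rewrite [in L z]zE [in L w]wE !Ll// => lz0 lw0.
have nz0 : 0 < hn (hvec z) by exact: hN_gt0.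
have nw0 : 0 < hn (hvec w) by exact: hN_gt0.
move: lz0 lw0; rewrite !pmulr_lgt0 ?invr_gt0// => lz0 lw0.
have [Fz1 mz0 cFzw] := cF _ _ z1 w1 lz0 lw0.
have [Fw1 mw0 _] := cF _ _ w1 z1 lw0 lz0.
have nFz0 : 0 < hn (F (hvec z)) by apply: hN_gt0; case: (F (hvec z)) Fz1.
have nFw0 : 0 < hn (F (hvec w)) by apply: hN_gt0; case: (F (hvec w)) Fw1.
rewrite !Mm//; split; first by rewrite mulr_gt0 ?invr_gt0.
rewrite [in chord2 z w]zE [in chord2 _ w]wE /hsph !chord2_hpt//;
  try by [case: (F (hvec z)) Fz1|case: (F (hvec w)) Fw1].
rewrite -/(hn _) -/(hn _) -/(hdet _ _).
set A := sqn _ in cFzw *; set B := sqn _ in cFzw *.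
rewrite -/(hn (F (hvec z))) -/(hn (F (hvec w))) -/(hn (hvec z)) -/(hn (hvec w)).
have -> : 4 * A / (hn (F (hvec z)) * hn (F (hvec w))) *
   (l (hvec z) / hn (hvec z) * (l (hvec w) / hn (hvec w))) =
   A * (l (hvec z) * l (hvec w)) * (4 / (hn (F (hvec z)) * hn (F (hvec w)) *
     (hn (hvec z) * hn (hvec w)))).
  by field; rewrite !gt_eqF.
have -> : 4 * sqn (hx z * hy w - hx w * hy z) / (hn (hvec z) * hn (hvec w)) *
   (m (F (hvec z)) / hn (F (hvec z)) * (m (F (hvec w)) / hn (F (hvec w)))) =
   B * (m (F (hvec z)) * m (F (hvec w))) * (4 / (hn (F (hvec z)) * hn (F (hvec w)) *
     (hn (hvec z) * hn (hvec w)))).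
  by rewrite /B /hdet /=; field; rewrite !gt_eqF.
by rewrite ler_pM2r// divr_gt0// !mulr_gt0.
Qed.


Definition hpow k v : R[i] * R[i] := (v.1 ^+ k, v.2 ^+ k).
Definition hmul u v : R[i] * R[i] := (u.1 * v.1, u.2 * v.2).

(** Cauchy-Schwarz bounds the cross term by 2 r sqrt(a1 b1 a2 b2), and the arithmetic-geometric mean
    inequality bounds this by r (a1 b2 + a2 b1). *)
Lemma sqn_dom_add (r a1 b1 a2 b2 : R) (x y : R[i]) : 0 <= r ->
  0 <= a1 -> 0 <= b1 -> 0 <= a2 -> 0 <= b2 ->
  sqn x <= r * (a1 * b1) -> sqn y <= r * (a2 * b2) ->
  sqn (x + y) <= r * ((a1 + a2) * (b1 + b2)).
Proof.
move=> r0 a10 b10 a20 b20 hx hy.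
pose t : R := complex.Re x * complex.Re y + complex.Im x * complex.Im y.
have -> : sqn (x + y) = sqn x + sqn y + 2 * t by rewrite /sqn /t !reim; ring.
have t2 : t ^+ 2 <= sqn x * sqn y.
  rewrite -subr_ge0 /sqn /t (_ : _ - _ = (complex.Re x * complex.Im y -
    complex.Im x * complex.Re y) ^+ 2) ?sqr_ge0//; ring.
have t2' : t ^+ 2 <= (r * (a1 * b1)) * (r * (a2 * b2)).
  by apply: le_trans t2 _; apply: ler_pM => //; exact: sqn_ge0.
pose v : R := r * (a1 * b2 + a2 * b1).
have v0 : 0 <= v by rewrite /v mulr_ge0// addr_ge0// mulr_ge0.
suff tv : 2 * t <= v.
  have -> : r * ((a1 + a2) * (b1 + b2)) =
    r * (a1 * b1) + r * (a2 * b2) + v by rewrite /v; ring.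
  by rewrite !lerD.
rewrite leNgt; apply/negP => vt.
have : v ^+ 2 < (2 * t) ^+ 2 by rewrite ltr_pXn2r// nnegrE (le_trans v0 (ltW vt)).
apply/negP; rewrite -leNgt; apply: (@le_trans _ _ (4 * ((r * (a1 * b1)) * (r * (a2 * b2))))).
  by rewrite exprMn (_ : 2 ^+ 2 = 4) ?ler_pM2l//; ring.
rewrite -subr_ge0 /v (_ : _ - _ = (r * (a1 * b2 - a2 * b1)) ^+ 2) ?sqr_ge0//; ring.
Qed.

(** A Leibniz rule for the determinant; the symmetric cofactors are permanents, bounded by
    [sqn_permanent]. *)
Lemma hdet_hmul u u' v v' : hdet (hmul u v) (hmul u' v') =
  2^-1 * (hdet u u' * (v.1 * v'.2 + v'.1 * v.2)) +
  2^-1 * (hdet v v' * (u.1 * u'.2 + u'.1 * u.2)).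
Proof.
by rewrite /hdet /hmul /=; field.
Qed.

Lemma sqn_permanent u v : sqn (u.1 * v.2 + v.1 * u.2) <= hn u * hn v.
Proof.
have := @sqn_dom_add 1 (sqn u.1) (sqn v.2) (sqn u.2) (sqn v.1) (u.1 * v.2) (v.1 * u.2).
rewrite !sqnM !mul1r [sqn v.1 * _]mulrC [sqn v.2 + _]addrC; apply => //; exact: sqn_ge0.
Qed.

Lemma hpow_neq0 k v : v != (0, 0) -> hpow k v != (0, 0).
Proof.
case: v => x y; rewrite !xpair_eqE /= !expf_eq0 !negb_and.
by case/orP => ->; rewrite ?orbT.
Qed.

Lemma hpow1 v : hpow 1 v = v.
Proof. by case: v => x y; rewrite /hpow !expr1. Qed.

Lemma hpowS k v : hpow k.+1 v = hmul v (hpow k v).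
Proof. by rewrite /hpow /hmul !exprS. Qed.

(** Induction through [hpowS]: the Leibniz rule splits the determinant into two terms, each bounded
    with the same ratio [r], and [sqn_dom_add] adds these bounds. The average in the hypothesis is
    exactly what this addition produces. *)
Lemma hpow_contracts (l : nat -> R[i] * R[i] -> R) K :
  (forall k v, (0 < k < K)%N -> v != (0, 0) -> 0 < l 1%N v -> 0 < l k (hpow k v) ->
    (l 1%N v * hn (hpow k v) + l k (hpow k v) * hn v) / 2 <= l k.+1 (hpow k.+1 v)) ->
  forall k, (0 < k <= K)%N -> hcontracts (l 1%N) (l k) (hpow k).
Proof.
move=> lS; elim=> // -[|k] IHk kK u v u0 v0 lu lv.
  by rewrite !hpow1; split.
have {}IHk := IHk (ltnW kK).
have kK' : (0 < k.+1 < K)%N by [].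
move: (k.+1) kK' IHk {kK} => {}k kK IHk.
have [uk0 luk d] := IHk _ _ u0 v0 lu lv; have [vk0 lvk _] := IHk _ _ v0 u0 lv lu.
have nu : 0 < hn u by apply: hN_gt0; case: (u) u0.
have nv : 0 < hn v by apply: hN_gt0; case: (v) v0.
have nuk : 0 < hn (hpow k u) by apply: hN_gt0; case: (hpow k u) uk0.
have nvk : 0 < hn (hpow k v) by apply: hN_gt0; case: (hpow k v) vk0.
have lSu := lS k u kK u0 lu luk; have lSv := lS k v kK v0 lv lvk.
have pu : 0 < (l 1%N u * hn (hpow k u) + l k (hpow k u) * hn u) / 2.
  by rewrite divr_gt0// addr_gt0// mulr_gt0.
have pv : 0 < (l 1%N v * hn (hpow k v) + l k (hpow k v) * hn v) / 2.
  by rewrite divr_gt0// addr_gt0// mulr_gt0.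
split; [exact: hpow_neq0|exact: lt_le_trans lSu|].
have ll : 0 < l 1%N u * l 1%N v by rewrite mulr_gt0.
pose r := sqn (hdet u v) / (l 1%N u * l 1%N v).
have r0 : 0 <= r by rewrite divr_ge0 ?sqn_ge0// ltW.
suff h : sqn (hdet (hpow k.+1 u) (hpow k.+1 v)) <=
    r * ((l 1%N u * hn (hpow k u) + l k (hpow k u) * hn u) / 2 *
         ((l 1%N v * hn (hpow k v) + l k (hpow k v) * hn v) / 2)).
  rewrite -ler_pdivlMr// mulrAC; apply: le_trans h _.
  by rewrite -/r ler_wpM2l// ler_pM// ltW.
have dk : sqn (hdet (hpow k u) (hpow k v)) <= r * (l k (hpow k u) * l k (hpow k v)).
  by rewrite /r mulrAC ler_pdivlMr.
have d1 : sqn (hdet u v) <= r * (l 1%N u * l 1%N v) by rewrite /r divfK// gt_eqF.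
have h2 : sqn (2^-1 : R[i]) = 4^-1.
  have -> : (2^-1 : R[i]) = (2^-1 : R)%:C by rewrite -[2 in LHS]/(2%:R) fmorphV rmorph_nat.
  by rewrite /sqn !reim; field.
have a0 : 0 <= 2^-1 :> R by rewrite invr_ge0.
have E t : (l 1%N t * hn (hpow k t) + l k (hpow k t) * hn t) / 2 =
    l 1%N t * hn (hpow k t) / 2 + l k (hpow k t) * hn t / 2 by rewrite mulrDl.
rewrite !hpowS hdet_hmul !E.
have P (x y : R) : 0 < x -> 0 < y -> 0 <= x * y / 2.
  by move=> x0 y0; rewrite divr_ge0// ltW// mulr_gt0.
apply: sqn_dom_add; rewrite ?P//.
- rewrite !sqnM h2; apply: (@le_trans _ _ (4^-1 * ((r * (l 1%N u * l 1%N v)) *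
    (hn (hpow k u) * hn (hpow k v))))).
    rewrite ler_pM2l ?invr_gt0//; apply: ler_pM => //; try exact: sqn_ge0.
    exact: sqn_permanent.
  by rewrite le_eqVlt; apply/orP; left; apply/eqP; field.
- rewrite !sqnM h2; apply: (@le_trans _ _ (4^-1 * ((r * (l k (hpow k u) * l k (hpow k v))) *
    (hn u * hn v)))).
    rewrite ler_pM2l ?invr_gt0//; apply: ler_pM => //; try exact: sqn_ge0.
    exact: sqn_permanent.
  by rewrite le_eqVlt; apply/orP; left; apply/eqP; field.
Qed.

Definition lZ v : R := sqn v.1 - sqn v.2.

Lemma hpow_contracts_lZ k : (0 < k)%N -> hcontracts lZ lZ (hpow k).
Proof.
move=> k0; apply: (@hpow_contracts (fun _ => lZ) k); last by rewrite k0 leqnn.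
move=> j v _ _ _ _; rewrite le_eqVlt; apply/orP; left; apply/eqP.
by rewrite hpowS /lZ /hmul /hn /hN /= !sqnM; field.
Qed.

Lemma hpow_contracts_lZN k : (0 < k)%N -> hcontracts (\- lZ) (\- lZ) (hpow k).
Proof.
move=> k0; apply: (@hpow_contracts (fun _ => \- lZ) k); last by rewrite k0 leqnn.
move=> j v _ _ _ _; rewrite le_eqVlt; apply/orP; left; apply/eqP.
by rewrite hpowS /lZ /hmul /hn /hN /= !sqnM; field.
Qed.

(* The cap over the arc of the unit circle with midpoint [expi g] and
   half-width [a] is [0 < lcap g a]. *)
Definition lcap (g a : R) v : R :=
  (2 * (cos g * complex.Re (v.1 * v.2^*) + sin g * complex.Im (v.1 * v.2^*)) -
    hn v * cos a) / sin a.

(** In the Cayley coordinate (v.1 - v.2) / (v.1 + v.2) the cap centred at 1 becomes the disc of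
    radius tan (a / 2) around 0. *)
Lemma lcap0E a v : 0 < a < pi ->
  lcap 0 a v = (tan (a / 2) * sqn (v.1 + v.2) - sqn (v.1 - v.2) / tan (a / 2)) / 2.
Proof.
case/andP => a0 api.
have s0 : 0 < sin (a / 2) by apply: sin_gt0_pi; apply/andP; lra.
have c0 : 0 < cos (a / 2) by apply: cos_gt0_pihalf; apply/andP; lra.
rewrite /lcap cos0 sin0 mul0r addr0 mul1r.
have aE : a = a / 2 *+ 2 by rewrite mulr2n; field.
have -> : cos a = cos (a / 2) ^+ 2 - sin (a / 2) ^+ 2.
  by rewrite {1}aE cos_mulr2n sin2cos2; ring.
have -> : sin a = 2 * cos (a / 2) * sin (a / 2) by rewrite {1}aE sin_mulr2n; ring.
have e1 := cos2Dsin2 (a / 2); rewrite /tan.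
move: (cos (a / 2)) (sin (a / 2)) s0 c0 e1 => c s s0 c0 e1.
have h : 2 * complex.Re (v.1 * v.2^*) = (c ^+ 2 + s ^+ 2) * (2 * complex.Re (v.1 * v.2^*)).
  by rewrite e1 mul1r.
rewrite h /hn /hN /sqn !reim; field; by rewrite !gt_eqF.
Qed.

(** With p = tan (a1 / 2) and q = tan (a2 / 2), the bound on a1 + a2 gives p q < 1, and the
    difference of the two sides is a combination of two squared moduli with positive
    coefficients. *)
Lemma lcap_hmul a1 a2 u v : 0 < a1 -> 0 < a2 -> a1 + a2 < pi ->
  (lcap 0 a1 u * hn v + lcap 0 a2 v * hn u) / 2 <= lcap 0 (a1 + a2) (hmul u v).
Proof.
move=> a10 a20 a12; rewrite !lcap0E; [|apply/andP; lra..].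
have s1 : 0 < sin (a1 / 2) by apply: sin_gt0_pi; apply/andP; lra.
have c1 : 0 < cos (a1 / 2) by apply: cos_gt0_pihalf; apply/andP; lra.
have s2 : 0 < sin (a2 / 2) by apply: sin_gt0_pi; apply/andP; lra.
have c2 : 0 < cos (a2 / 2) by apply: cos_gt0_pihalf; apply/andP; lra.
have x0 : 0 < tan (a1 / 2) by rewrite divr_gt0.
have y0 : 0 < tan (a2 / 2) by rewrite divr_gt0.
have q0 : 0 < 1 - tan (a1 / 2) * tan (a2 / 2).
  have c12 : 0 < cos (a1 / 2 + a2 / 2) by apply: cos_gt0_pihalf; apply/andP; lra.
  have -> : 1 - tan (a1 / 2) * tan (a2 / 2) = cos (a1 / 2 + a2 / 2) / (cos (a1 / 2) * cos (a2 / 2)).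
    by rewrite cosD /tan; field; rewrite !gt_eqF.
  by rewrite divr_gt0// mulr_gt0.
rewrite [(a1 + a2) / 2]mulrDl tanD ?gt_eqF//.
move: (tan (a1 / 2)) (tan (a2 / 2)) x0 y0 q0 => p q p0 q0 pq0.
have pq1 : 0 < p + q by rewrite addr_gt0.
rewrite -subr_ge0; set D := _ - _.
have -> : D = 8^-1 *
  ((p + q) / ((1 - p * q) * (p * q)) *
     sqn ((p * q)%:C * ((u.1 + u.2) * (v.1 + v.2)) + (u.1 - u.2) * (v.1 - v.2)) +
   (1 - p * q) / ((p + q) * (p * q)) *
     sqn (q%:C * ((u.1 - u.2) * (v.1 + v.2)) - p%:C * ((u.1 + u.2) * (v.1 - v.2)))).
  rewrite /D /hn /hN /hmul /sqn !reim /=; field; by rewrite !gt_eqF.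
rewrite mulr_ge0 ?invr_ge0// addr_ge0// mulr_ge0 ?sqn_ge0// divr_ge0 ?mulr_ge0// ltW//.
Qed.

End Geometry.

(** * The family as a composition of a Moebius map, a power and a rotation *)

Section Family.
Variable R : realType.
Implicit Types (x y lam : R[i]) (z w : sphere R) (u v : R[i] * R[i]).
Implicit Types (l m : R[i] * R[i] -> R) (b s t g a : R) (k : nat).

Lemma sqn_expi t : sqn (expi t) = 1.
Proof. exact: cos2Dsin2. Qed.

Lemma expiD s t : expi (s + t) = expi s * expi t.
Proof.
rewrite /expi cosD sinD; apply/eqP; rewrite eq_complex !reim /=; apply/andP.
by split; apply/eqP => //; ring.
Qed.

Lemma expi0 : expi (0 : R) = 1.
Proof. by rewrite /expi cos0 sin0. Qed.

Lemma expi_neq0 t : expi t != 0.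
Proof. by rewrite -sqn_eq0 sqn_expi oner_eq0. Qed.

Lemma expiMn t k : expi (t *+ k) = expi t ^+ k.
Proof. by elim: k => [|k IHk]; rewrite ?mulr0n ?expi0// mulrS exprS expiD IHk. Qed.

Definition capL g a z : R := (cos g * sX z + sin g * sY z - cos a) / sin a.

Lemma hform_sZ : hform (@sZ R) (@lZ R).
Proof. by move=> [x y] xy0; rewrite /hsph /sZ stereo_hpt. Qed.

Lemma hform_sZN : hform (\- @sZ R) (\- @lZ R).
Proof. by move=> [x y] xy0; rewrite /= hform_sZ// mulNr. Qed.

Lemma hform_capL g a : hform (capL g a) (lcap g a).
Proof.
move=> [x y] xy0; rewrite /hsph /capL /sX /sY stereo_hpt//= /lcap /hn /=.
have N0 := gt_eqF (hN_gt0 xy0); have [->|sa0] := eqVneq (sin a) 0.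
  by rewrite invr0 !mulr0 mul0r.
by field; rewrite N0.
Qed.

(** For forms of equal determinant, such as [lZ] and [lcap], a linear map carrying one disc onto the
    other scales the form by the modulus of its own determinant; this is why the same [c] appears in
    the last two hypotheses. *)
Lemma hcontracts_isometry l m (F : R[i] * R[i] -> R[i] * R[i]) (c : R) : 0 < c ->
  (forall v, v != (0, 0) -> F v != (0, 0)) ->
  (forall u v, sqn (hdet (F u) (F v)) = c ^+ 2 * sqn (hdet u v)) ->
  (forall v, m (F v) = c * l v) -> hcontracts l m F.
Proof.
move=> c0 F0 dF mF u v u0 v0 lu lv; split; [exact: F0|by rewrite mF mulr_gt0|].
rewrite dF !mF le_eqVlt; apply/orP; left; apply/eqP; ring.
Qed.

Definition hrot lam v : R[i] * R[i] := (lam * v.1, v.2).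
Definition hmob b v : R[i] * R[i] := (v.1 + b%:C * v.2, b%:C * v.1 + v.2).

Lemma hrot_neq0 lam v : lam != 0 -> v != (0, 0) -> hrot lam v != (0, 0).
Proof. by case: v => x y l0; rewrite !xpair_eqE mulf_eq0 (negPf l0). Qed.

Lemma sqn_hdet_hrot lam u v : sqn lam = 1 ->
  sqn (hdet (hrot lam u) (hrot lam v)) = 1 ^+ 2 * sqn (hdet u v).
Proof.
move=> l1; have -> : hdet (hrot lam u) (hrot lam v) = lam * hdet u v.
  by rewrite /hdet /=; ring.
by rewrite sqnM l1 expr1n.
Qed.

Lemma hrot_contracts_lZ lam : sqn lam = 1 -> hcontracts (@lZ R) (@lZ R) (hrot lam).
Proof.
move=> l1; have l0 : lam != 0 by rewrite -sqn_eq0 l1 oner_eq0.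
apply: (@hcontracts_isometry _ _ _ 1) => //.
- by move=> v; exact: hrot_neq0.
- by move=> u v; exact: sqn_hdet_hrot.
- by move=> v; rewrite /lZ /= sqnM l1 !mul1r.
Qed.

Lemma hrot_contracts_lZN lam : sqn lam = 1 ->
  hcontracts (\- @lZ R) (\- @lZ R) (hrot lam).
Proof.
move=> l1; have l0 : lam != 0 by rewrite -sqn_eq0 l1 oner_eq0.
apply: (@hcontracts_isometry _ _ _ 1) => //.
- by move=> v; exact: hrot_neq0.
- by move=> u v; exact: sqn_hdet_hrot.
- by move=> v; rewrite /lZ /= sqnM l1 !mul1r.
Qed.

Lemma hrot_contracts_lcap t g a :
  hcontracts (lcap g a) (lcap (g + t) a) (hrot (expi t)).
Proof.
apply: (@hcontracts_isometry _ _ _ 1) => //.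
- by move=> v; apply: hrot_neq0; exact: expi_neq0.
- by move=> u v; apply: sqn_hdet_hrot; exact: sqn_expi.
- move=> v; rewrite /lcap mul1r; congr ((2 * _ - _ * _) / _).
    rewrite cosD sinD !reim /=; have e := cos2Dsin2 t.
    by rewrite -[RHS]mul1r -e; ring.
  by rewrite /hn /hN /= sqnM sqn_expi mul1r.
Qed.

Lemma hdet_hmob b u v : hdet (hmob b u) (hmob b v) = (1 - b ^+ 2)%:C * hdet u v.
Proof. by rewrite /hdet /hmob /= rmorphB rmorph1 rmorphXn; ring. Qed.

Lemma hmob_neq0 b v : 1 < b -> v != (0, 0) -> hmob b v != (0, 0).
Proof.
case: v => x y b1; apply: contra; rewrite /hmob /= => /eqP[ex ey].
have c0 : (1 - b ^+ 2)%:C != 0 :> R[i].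
  by rewrite (inj_eq (@complexI _) _ 0) subr_eq0 eq_sym gt_eqF// exprn_egt1.
have hx : (1 - b ^+ 2)%:C * x = 0.
  rewrite rmorphB rmorph1 rmorphXn; have -> : (1 - b%:C ^+ 2) * x =
    (x + b%:C * y) - b%:C * (b%:C * x + y) by ring.
  by rewrite ex ey mulr0 subr0.
have hy : (1 - b ^+ 2)%:C * y = 0.
  rewrite rmorphB rmorph1 rmorphXn; have -> : (1 - b%:C ^+ 2) * y =
    (b%:C * x + y) - b%:C * (x + b%:C * y) by ring.
  by rewrite ex ey mulr0 subr0.
move/eqP: hx; move/eqP: hy; rewrite !mulf_eq0 !(negPf c0) /=.
by move=> /eqP -> /eqP ->.
Qed.

Lemma sqn_hdet_hmob b u v :
  sqn (hdet (hmob b u) (hmob b v)) = (b ^+ 2 - 1) ^+ 2 * sqn (hdet u v).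
Proof.
rewrite hdet_hmob sqnM; congr (_ * _); rewrite /sqn !reim; ring.
Qed.

Lemma sqr_gt1 b : 1 < b -> 0 < b ^+ 2 - 1.
Proof. by move=> b1; rewrite subr_gt0 exprn_egt1. Qed.

Lemma hmob_contracts_lZ b : 1 < b -> hcontracts (@lZ R) (\- @lZ R) (hmob b).
Proof.
move=> b1; apply: (@hcontracts_isometry _ _ _ (b ^+ 2 - 1)).
- exact: sqr_gt1.
- by move=> v; exact: hmob_neq0.
- exact: sqn_hdet_hmob.
- by move=> v; rewrite /lZ /sqn /= !reim; ring.
Qed.

Lemma hmob_contracts_lZN b : 1 < b -> hcontracts (\- @lZ R) (@lZ R) (hmob b).
Proof.
move=> b1; apply: (@hcontracts_isometry _ _ _ (b ^+ 2 - 1)).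
- exact: sqr_gt1.
- by move=> v; exact: hmob_neq0.
- exact: sqn_hdet_hmob.
- by move=> v; rewrite /lZ /sqn /= !reim; ring.
Qed.

Definition kap b : R := (b - 1) / (b + 1).

(* [expi (2 s)] is mapped to [expi (- 2 hlf b s)] by [z |-> (z + b) / (b z + 1)]. *)
Definition hlf b s : R := atan (kap b * tan s).

Lemma kap_gt0 b : 1 < b -> 0 < kap b.
Proof. by move=> b1; rewrite divr_gt0//; lra. Qed.

Lemma cos_hlf_gt0 b s : 0 < cos (hlf b s).
Proof. by rewrite cos_gt0_pihalf// atan_gtNpi2 atan_ltpi2. Qed.

Lemma sin_hlf b s : cos s != 0 ->
  sin (hlf b s) = kap b * (sin s / cos s) * cos (hlf b s).
Proof.
move=> c0; have := atanK (kap b * tan s); rewrite -/(hlf b s) {1}/tan => e.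
by rewrite -/(tan s) -e divfK// gt_eqF// cos_hlf_gt0.
Qed.

(** On half-angles [hmob] acts by s |-> - h(s), which reverses the circle: the arc from s to t
    becomes the arc from - h(t) to - h(s). *)
Lemma lcap_hmob b s t v : 1 < b -> 0 < cos s -> 0 < cos t -> sin (t - s) != 0 ->
  lcap (- (hlf b s + hlf b t)) (hlf b t - hlf b s) (hmob b v) =
  (b ^+ 2 - 1) * lcap (s + t) (t - s) v.
Proof.
move=> b1 cs0 ct0; rewrite /lcap cosN sinN !(cosB, sinB) !(cosD, sinD) => st0.
rewrite !sin_hlf ?gt_eqF//.
have := cos_hlf_gt0 b s; have := cos_hlf_gt0 b t.
move: (cos (hlf b s)) (cos (hlf b t)) => C C' C0 C'0.
rewrite /kap /hn /hN /sqn /hmob !reim /=.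
have b1' : 0 < b + 1 by lra.
have b2' : 0 < b - 1 by lra.
move: (cos s) (sin s) (cos t) (sin t) cs0 ct0 st0 => c e c' e' c0 c'0 st0.
field; rewrite st0 (gt_eqF b1') (gt_eqF c0) (gt_eqF c'0) /=.
rewrite [X in X != 0](_ : _ = (b - 1) * C * C' * (e' * c - c' * e)); last by ring.
by rewrite !mulf_neq0// gt_eqF.
Qed.

Lemma hmob_contracts_lcap b s t : 1 < b -> 0 < cos s -> 0 < cos t ->
  sin (t - s) != 0 ->
  hcontracts (lcap (s + t) (t - s))
    (lcap (- (hlf b s + hlf b t)) (hlf b t - hlf b s)) (hmob b).
Proof.
move=> b1 cs ct st0; apply: (@hcontracts_isometry _ _ _ (b ^+ 2 - 1)).
- exact: sqr_gt1.
- by move=> v; exact: hmob_neq0.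
- exact: sqn_hdet_hmob.
- by move=> v; exact: lcap_hmob.
Qed.

Lemma hpow_hrot k x v : hpow k (hrot x v) = hrot (x ^+ k) (hpow k v).
Proof. by rewrite /hpow /hrot /= exprMn. Qed.

(** Rotations before and after the power move the centre of the arc to 1, where [lcap_hmul]
    applies. *)
Lemma hpow_contracts_lcap g a k : (0 < k)%N -> 0 < a -> a *+ k < pi ->
  hcontracts (lcap g a) (lcap (g *+ k) (a *+ k)) (@hpow R k).
Proof.
move=> k0 a0 ak.
have hp : hcontracts (lcap 0 a) (lcap 0 (a *+ k)) (@hpow R k).
  apply: (@hpow_contracts R (fun j => lcap 0 (a *+ j)) k); last by rewrite k0 leqnn.
  move=> j v /andP[j0 jk] _ _ _; rewrite /= hpowS (mulr1n a) (mulrS a).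
  apply: lcap_hmul => //.
    by rewrite pmulrn_lgt0.
  by rewrite -mulrS (le_lt_trans _ ak)// ler_pMn2l.
have h1 := @hrot_contracts_lcap (- g) g a; rewrite subrr in h1.
have h2 := @hrot_contracts_lcap (g *+ k) 0 (a *+ k); rewrite add0r in h2.
have := hcontracts_comp (hcontracts_comp h1 hp) h2.
rewrite (_ : _ \o _ = @hpow R k)//; apply/funext => v /=.
rewrite hpow_hrot /hrot /= mulrA -expiMn -expiD mulNrn subrr expi0 mul1r.
by case: v.
Qed.

Definition hfpow b k lam v := hrot lam (hpow k (hmob b v)).

Lemma fpowE b k lam z : 1 < b -> (0 < k)%N ->
  fpow b k lam z = hsph (hfpow b k lam (hvec z)).
Proof.
move=> b1 k0; have b0 : b%:C != 0 :> R[i].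
  by rewrite (inj_eq (@complexI _) _ 0) gt_eqF// (lt_trans _ b1).
rewrite /hsph /hfpow /hrot /hpow /hmob /hvec /hpt; case: z => [w|] /=.
  rewrite !mulr1 expf_eq0 k0 /=; case: ifP => // _.
  by rewrite -mulrA expr_div_n.
by rewrite !(mulr0, addr0, mulr1, expr1n) exprVn expf_eq0 k0 (negPf b0).
Qed.

Lemma fpow_contracts_sZ b k lam : 1 < b -> (0 < k)%N -> sqn lam = 1 ->
  contracts (@sZ R) (\- @sZ R) (fpow b k lam).
Proof.
move=> b1 k0 l1; apply: (contracts_hcontracts hform_sZ hform_sZN).
  apply: (hcontracts_comp (hcontracts_comp (hmob_contracts_lZ b1)
    (@hpow_contracts_lZN _ k k0)) (hrot_contracts_lZN l1)).
by move=> z; exact: fpowE.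
Qed.

Lemma fpow_contracts_sZN b k lam : 1 < b -> (0 < k)%N -> sqn lam = 1 ->
  contracts (\- @sZ R) (@sZ R) (fpow b k lam).
Proof.
move=> b1 k0 l1; apply: (contracts_hcontracts hform_sZN hform_sZ).
  apply: (hcontracts_comp (hcontracts_comp (hmob_contracts_lZN b1)
    (@hpow_contracts_lZ _ k k0)) (hrot_contracts_lZ l1)).
by move=> z; exact: fpowE.
Qed.

(* [capI s t]: the cap over the open arc from [expi (2 s)] to [expi (2 t)]. *)
Definition capI s t := capL (s + t) (t - s).

(** The endpoints are exchanged because [hmob] reverses the circle; the bound by pi keeps the arc,
    multiplied by k, shorter than a full turn. *)
Lemma fpow_contracts_capI b k (r : R) s t : 1 < b -> (0 < k)%N ->
  - (pi / 2) < s -> s < t -> t < pi / 2 ->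
  (hlf b t - hlf b s) *+ k < pi ->
  contracts (capI s t) (capI (r - hlf b t *+ k) (r - hlf b s *+ k))
    (fpow b k (expi (2 * r))).
Proof.
move=> b1 k0 s0 st t0 hk.
have cs : 0 < cos s by apply: cos_gt0_pihalf; apply/andP; lra.
have ct : 0 < cos t by apply: cos_gt0_pihalf; apply/andP; lra.
have st0 : 0 < sin (t - s) by apply: sin_gt0_pi; apply/andP; lra.
have hst : 0 < hlf b t - hlf b s.
  rewrite subr_gt0 lt_atan// ltr_pM2l ?kap_gt0// ltr_tan ?in_itv/=//; apply/andP; lra.
apply: (contracts_hcontracts (@hform_capL _ _) (@hform_capL _ _)); last first.
  by move=> z; exact: fpowE.
have h1 := hmob_contracts_lcap b1 cs ct (lt0r_neq0 st0).
have h2 := hcontracts_comp h1 (@hpow_contracts_lcap (- (hlf b s + hlf b t)) _ k k0 hst hk).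
have h3 := hcontracts_comp h2 (@hrot_contracts_lcap (2 * r) _ _).
move: h3; congr hcontracts; congr lcap.
  by rewrite mulNrn mulrnDl; ring.
by rewrite mulrnBl; ring.
Qed.

End Family.

(** * Continuity and distances on the sphere *)

Section Topology.
Variable R : realType.
Implicit Types (z w : sphere R) (L : sphere R -> R).

Lemma comp_stereo_continuous (phi : R * R * R -> R) : continuous phi ->
  continuous (fun z : sphere R => phi (stereo z)).
Proof.
move=> cphi z; apply: (@continuous_comp _ _ _ (@stereo R : sphere R -> _) phi).
  exact: stereo_continuous.
exact: cphi.
Qed.

Lemma proj11_continuous : continuous (fun p : R * R * R => p.1.1).
Proof. by move=> p; apply: (@continuous_comp _ _ _ fst fst); exact: cvg_fst. Qed.

Lemma proj12_continuous : continuous (fun p : R * R * R => p.1.2).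
Proof.
by move=> p; apply: (@continuous_comp _ _ _ fst snd); [exact: cvg_fst|exact: cvg_snd].
Qed.

Lemma proj2_continuous : continuous (fun p : R * R * R => p.2).
Proof. by move=> p; exact: cvg_snd. Qed.

Lemma sZ_continuous : continuous (@sZ R).
Proof. exact: comp_stereo_continuous proj2_continuous. Qed.

Lemma capL_continuous (g a : R) : continuous (capL g a).
Proof.
apply: (@comp_stereo_continuous (fun p => (cos g * p.1.1 + sin g * p.1.2 - cos a) / sin a)).
move=> p; apply: cvgMr_tmp; apply: cvgB; last exact: cvg_cst.
by apply: cvgD; apply: cvgMl_tmp; [exact: proj11_continuous|exact: proj12_continuous].
Qed.

Lemma chord2_continuous z : continuous (chord2 z).
Proof.
have c2 (f : R * R * R -> R) (a : R) : continuous f ->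
    continuous (fun p => (a - f p) ^+ 2).
  move=> cf p; apply: (@continuous_comp _ _ _ (fun p => a - f p) (fun x => x ^+ 2)).
    by apply: cvgB; [exact: cvg_cst|exact: cf].
  exact: exprn_continuous.
apply: (@comp_stereo_continuous (fun p => (sX z - p.1.1) ^+ 2 + (sY z - p.1.2) ^+ 2 +
  (sZ z - p.2) ^+ 2)) => p; apply: cvgD; first apply: cvgD.
- exact: c2 proj11_continuous _.
- exact: c2 proj12_continuous _.
- exact: c2 proj2_continuous _.
Qed.

Lemma chord2_ge0 z w : 0 <= chord2 z w.
Proof. by rewrite /chord2 !addr_ge0 ?sqr_ge0. Qed.

Lemma chord2zz z : chord2 z z = 0.
Proof. by rewrite /chord2 !subrr expr0n !addr0. Qed.

Lemma chord2C z w : chord2 z w = chord2 w z.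
Proof. by rewrite /chord2; ring. Qed.

Lemma chord2_eq0 z w : chord2 z w = 0 -> z = w.
Proof.
move=> /eqP; rewrite /chord2 !paddr_eq0 ?addr_ge0 ?sqr_ge0// !sqrf_eq0 !subr_eq0.
move=> /andP[/andP[/eqP x /eqP y] /eqP t]; apply: stereo_inj.
by move: x y t; rewrite /sX /sY /sZ; case: (stereo z) (stereo w) => [[? ?] ?] [[? ?] ?] /= -> -> ->.
Qed.

Lemma chord2_le4 z w : chord2 z w <= 4.
Proof.
have := stereo_norm z; have := stereo_norm w; rewrite -/(sX z) -/(sX w) -/(sY z) -/(sY w) -/(sZ z) -/(sZ w) /chord2.
move: (sX z) (sY z) (sZ z) (sX w) (sY w) (sZ w) => a b c a' b' c' e e'.
have := sqr_ge0 (a + a'); have := sqr_ge0 (b + b'); have := sqr_ge0 (c + c'); nra.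
Qed.

Lemma chord2_triangle z w y : chord2 z y <= 2 * (chord2 z w + chord2 w y).
Proof.
rewrite /chord2.
move: (sX z) (sY z) (sZ z) (sX w) (sY w) (sZ w) (sX y) (sY y) (sZ y) => a b c a' b' c' p q r.
have := sqr_ge0 (a - a' - (a' - p)); have := sqr_ge0 (b - b' - (b' - q)).
have := sqr_ge0 (c - c' - (c' - r)); nra.
Qed.

Lemma sZ_norm_le1 z : `|sZ z| <= 1.
Proof.
rewrite -sqrtr_sqr -sqrtr1 ler_sqrt//; have := stereo_norm z; rewrite -/(sZ z).
by have := sqr_ge0 (stereo z).1.1; have := sqr_ge0 (stereo z).1.2; lra.
Qed.

Lemma chord2_ball z w (e : R) : 0 < e -> chord2 z w < e ^+ 2 -> ball z e w.
Proof.
move=> e0 h; rewrite -initial_ballE /preimage /=.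
have k (x : R) : x ^+ 2 < e ^+ 2 -> `|x| < e.
  by move=> xe; rewrite -sqrtr_sqr -[ltRHS]gtr0_norm// -sqrtr_sqr ltr_sqrt// exprn_gt0.
move: h; rewrite /chord2 /sX /sY /sZ.
case: (stereo z) (stereo w) => [[a b] c] [[a' b'] c'] /= h.
have := sqr_ge0 (a - a'); have := sqr_ge0 (b - b'); have := sqr_ge0 (c - c').
by move=> ? ? ?; split; [split|]; rewrite -ball_normE /=; apply: k; lra.
Qed.

Lemma ball_chord2 z w (e : R) : ball z e w -> chord2 z w <= 3 * e ^+ 2.
Proof.
rewrite -initial_ballE /preimage /= /chord2 /sX /sY /sZ.
case: (stereo z) (stereo w) => [[a b] c] [[a' b'] c'] /= [[]].
rewrite -!ball_normE /= => h1 h2 h3.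
have k (x : R) : `|x| < e -> x ^+ 2 <= e ^+ 2.
  by move=> xe; rewrite -real_normK ?num_real// ler_sqr ?nnegrE ?(ltW xe)// (le_trans _ (ltW xe)).
have := k _ h1; have := k _ h2; have := k _ h3; lra.
Qed.

Lemma near_chord2 z (e : R) : 0 < e -> \forall w \near z, chord2 z w < e.
Proof.
move=> e0; have := @chord2_continuous z z; rewrite /continuous_at chord2zz.
by move=> /cvgr_lt; apply.
Qed.

Lemma near_gt L z (x : R) : continuous L -> x < L z -> \forall w \near z, x < L w.
Proof. by move=> cL xz; have /cvgr_gt := cL z; apply. Qed.

Lemma near_lt L z (x : R) : continuous L -> L z < x -> \forall w \near z, L w < x.
Proof. by move=> cL xz; have /cvgr_lt := cL z; apply. Qed.

(** The bound on [L'] turns contraction into chord2 (g z) (g w) <= chord2 z w (|C| + 1)^2 / (L z L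
    w), uniformly in [g], even though [L'] may depend on [g]; hence equicontinuity. *)
Lemma positive_Fatou L (C : R) (G : set (sphere R -> sphere R)) :
  continuous L ->
  (forall g, G g -> exists2 L', contracts L L' g & forall z, L' z <= C) ->
  [set z | 0 < L z] `<=` Fatou G.
Proof.
move=> cL GL z Lz; exists [set z | 0 < L z].
have oL : open [set z | 0 < L z].
  by apply: (@open_comp _ _ L [set x | 0 < x]) => [x _|]; [exact: cL|exact: open_gt].
split => //; apply: equicontinuous_normal => // {}z {}Lz e e0.
have C1 : 0 < `|C| + 1 by rewrite ltr_wpDl.
pose d := e ^+ 2 * (L z * (L z / 2)) / (`|C| + 1) ^+ 2.
have d0 : 0 < d by rewrite divr_gt0 ?exprn_gt0// !mulr_gt0// exprn_gt0.
have Lz2 : L z / 2 < L z by rewrite /= in Lz; lra.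
have nL := near_gt cL Lz2; have nC := near_chord2 z d0.
near=> w => g Gg; have [L' cg L'C] := GL g Gg.
have Lw : L z / 2 < L w by near: w.
have zw : chord2 z w < d by near: w.
have Lw0 : 0 < L w by apply: lt_trans Lw; rewrite divr_gt0.
have [gz0 c] := cg z w Lz Lw0; have [gw0 _] := cg w z Lw0 Lz.
have L'1 y : L' y <= `|C| + 1.
  by apply: (le_trans (L'C y)); apply: (le_trans (ler_norm C)); rewrite lerDl.
apply: chord2_ball => //; have LL : 0 < L z * L w by rewrite mulr_gt0.
rewrite -(ltr_pM2r LL); apply: (le_lt_trans c).
apply: (@le_lt_trans _ _ (chord2 z w * ((`|C| + 1) * (`|C| + 1)))).
  by rewrite ler_wpM2l ?chord2_ge0// ler_pM// ltW.
rewrite -ltr_pdivlMr ?mulr_gt0//; apply: (lt_le_trans zw).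
by rewrite /d -expr2 ler_pM2r ?invr_gt0 ?exprn_gt0// ler_pM2l ?exprn_gt0// ler_pM2l// ltW.
Unshelve. all: by end_near. Qed.

Definition cpt (t : R) : sphere R := Some (expi t).

Lemma stereo_cpt t : stereo (cpt t) = (cos t, sin t, 0).
Proof.
rewrite /= cos2Dsin2 subrr mul0r.
by have h (x : R) : 2 * x / (1 + 1) = x; [field|rewrite !h].
Qed.

Lemma cpt_continuous : continuous cpt.
Proof.
apply: continuous_comp_initial => t.
have -> : (@stereo R : sphere R -> _) \o cpt = (fun t => (cos t, sin t, 0)).
  by apply/funext => u; rewrite /= -stereo_cpt.
exact: (cvg_pair (cvg_pair (@continuous_cos R t) (@continuous_sin R t)) (cvg_cst 0)).
Qed.

Lemma sZ_cpt t : sZ (cpt t) = 0.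
Proof. by rewrite /sZ stereo_cpt. Qed.

Lemma sphere_circleE z : sphere_circle z <-> sZ z = 0.
Proof.
rewrite /sphere_circle /sZ; case: z => [[x y]|] /=; split => //.
- move=> [w /eqP w1 [ew]]; move: w1; rewrite -ew sqn_norm /sqn /= => /eqP ->.
  by rewrite subrr mul0r.
- have n0 : x ^+ 2 + y ^+ 2 + 1 != 0 by rewrite gt_eqF// ltr_wpDl// addr_ge0 ?sqr_ge0.
  move=> /eqP; rewrite mulf_eq0 invr_eq0 (negPf n0) orbF subr_eq0 => h; exists (x +i* y) => //; apply/eqP; rewrite sqn_norm //.
- by case.
- by move/eqP; rewrite oner_eq0.
Qed.

Lemma capL_cpt (g a t : R) : capL g a (cpt t) = (cos (t - g) - cos a) / sin a.
Proof.
by rewrite /capL /sX /sY stereo_cpt /= cosB; congr (_ / _); ring.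
Qed.

End Topology.

(** * Half-angles *)

Section HalfAngle.
Variable R : realType.
Variables (b : R) (d : nat).
Hypotheses (b1 : 1 < b) (d2 : (2 <= d)%N) (bd : d%:R * kap b < 1).
Implicit Types s t x : R.

Let k0 : 0 < kap b. Proof. exact: kap_gt0. Qed.
Let dR : 2 <= d%:R :> R. Proof. by rewrite ler_nat. Qed.
Let kd : kap b < d%:R^-1.
Proof. by rewrite -[ltRHS]mul1r ltr_pdivlMr ?(lt_le_trans _ dR)// mulrC. Qed.
Let k2 : kap b < 2^-1.
Proof. by apply: (lt_le_trans kd); rewrite lef_pV2 ?posrE ?(lt_le_trans _ dR). Qed.

Let H := `](- (pi / 2)), (pi / 2)[ : interval R.

Lemma hlf0 : hlf b 0 = 0 :> R.
Proof. by rewrite /hlf tan0 mulr0 atan0. Qed.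

Lemma hlfN s : hlf b (- s) = - hlf b s.
Proof. by rewrite /hlf tanN mulrN atanN. Qed.

Lemma hlf_lt s t : s \in H -> t \in H -> s < t -> hlf b s < hlf b t.
Proof. by move=> sH tH st; rewrite lt_atan// ltr_pM2l// ltr_tan. Qed.

Lemma hlf_le s t : s \in H -> t \in H -> s <= t -> hlf b s <= hlf b t.
Proof.
by rewrite le_eqVlt => sH tH /predU1P[->//|/(hlf_lt sH tH)/ltW].
Qed.

Lemma tan_hlf s : tan (hlf b s) = kap b * tan s.
Proof. exact: atanK. Qed.

Lemma cosH_gt0 s : s \in H -> 0 < cos s.
Proof. by rewrite in_itv /=; exact: cos_gt0_pihalf. Qed.

Definition dhlf s : R := kap b * (1 + tan s ^+ 2) / (1 + kap b ^+ 2 * tan s ^+ 2).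

Lemma is_derive_hlf s : s \in H -> is_derive s 1 (hlf b) (dhlf s).
Proof.
move=> sH; have c0 := cosH_gt0 sH.
have dt : is_derive s 1 (fun x => kap b * tan x) (kap b *: (cos s)^-2).
  by apply: is_deriveZ; apply: is_derive_tan; rewrite gt_eqF.
have := @is_derive1_comp R atan (fun x => kap b * tan x) s _ _ (is_derive1_atan _) dt.
rewrite (_ : (_ * _) = dhlf s)// /dhlf cos2_tan2 ?gt_eqF// exprMn mulrC.
by rewrite -mulrA.
Qed.

Lemma continuous_hlf s : s \in H -> {for s, continuous (hlf b)}.
Proof.
move=> sH; apply: differentiable_continuous; apply/derivable1_diffP.
by have [] := is_derive_hlf sH.
Qed.

(* [d * hlf] is a contraction up to [aa], where its derivative is 1. *)
Definition ta2 : R := (1 - d%:R * kap b) / (kap b * (d%:R - kap b)).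
Definition ta : R := Num.sqrt ta2.
Definition aa : R := atan ta.

Lemma ta2_gt0 : 0 < ta2.
Proof.
rewrite divr_gt0 ?subr_gt0// mulr_gt0// subr_gt0 (lt_le_trans k2)//.
by rewrite (le_trans _ dR)//; lra.
Qed.

Lemma ta_gt0 : 0 < ta. Proof. by rewrite sqrtr_gt0 ta2_gt0. Qed.

Lemma sqr_ta : ta ^+ 2 = ta2. Proof. by rewrite sqr_sqrtr// ltW// ta2_gt0. Qed.

Lemma ta2E : d%:R * kap b * (1 + ta2) = 1 + kap b ^+ 2 * ta2.
Proof.
have h : d%:R - kap b != 0 by rewrite subr_eq0 gt_eqF// (lt_trans k2)// (lt_le_trans _ dR)//; lra.
by rewrite /ta2; field; rewrite h gt_eqF.
Qed.

Lemma aa_gt0 : 0 < aa. Proof. by rewrite -atan0 lt_atan// ta_gt0. Qed.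

Lemma aa_lt : aa < pi / 2. Proof. exact: atan_ltpi2. Qed.

Lemma tan_aa : tan aa = ta. Proof. exact: atanK. Qed.

Lemma itvH s : 0 <= s -> s < pi / 2 -> s \in H.
Proof. by move=> s0 sp; rewrite in_itv /= sp andbT (lt_le_trans _ s0)// oppr_lt0 divr_gt0// pi_gt0. Qed.

Lemma dhlf_lt s : s \in H -> `|s| < aa -> d%:R * dhlf s < 1.
Proof.
move=> sH sa; have ts : tan s ^+ 2 < ta2.
  rewrite -sqr_ta -real_normK ?num_real// ltr_sqr ?nnegrE ?(ltW ta_gt0)//.
  rewrite -tan_aa; move: sa; rewrite !ltr_norml => /andP[sa1 sa2].
  have aH := itvH (ltW aa_gt0) aa_lt.
  have naH : - aa \in H.
    by move: aH; rewrite !in_itv /= => /andP[? ?]; apply/andP; lra.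
  by rewrite -tanN !ltr_tan// sa1.
rewrite /dhlf mulrA ltr_pdivrMr ?mul1r; last by rewrite ltr_pwDl// mulr_ge0 ?sqr_ge0.
have e := ta2E; have kk : 0 < kap b * (d%:R - kap b).
  by rewrite mulr_gt0// subr_gt0 (lt_trans k2)// (lt_le_trans _ dR)//; lra.
have := ts; rewrite -(ltr_pM2l kk); move: e; nra.
Qed.

Lemma dhlf_gt s : s \in H -> aa < s -> 1 < d%:R * dhlf s.
Proof.
move=> sH sa; have ts : ta2 < tan s ^+ 2.
  have aH := itvH (ltW aa_gt0) aa_lt.
  have t : ta < tan s by rewrite -tan_aa ltr_tan.
  by rewrite -sqr_ta ltr_sqr ?nnegrE ?(ltW ta_gt0)// (le_trans (ltW ta_gt0) (ltW t)).
rewrite /dhlf mulrA ltr_pdivlMr ?mul1r; last by rewrite ltr_pwDl// mulr_ge0 ?sqr_ge0.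
have e := ta2E; have kk : 0 < kap b * (d%:R - kap b).
  by rewrite mulr_gt0// subr_gt0 (lt_trans k2)// (lt_le_trans _ dR)//; lra.
have := ts; rewrite -(ltr_pM2l kk); move: e; nra.
Qed.

Lemma hlf_MVT s t : s \in H -> t \in H -> s < t ->
  exists2 c, s < c < t & hlf b t - hlf b s = dhlf c * (t - s).
Proof.
rewrite !in_itv /= => /andP[s1 s2] /andP[t1 t2] st.
have I c : c \in `[s, t] -> c \in H.
  by rewrite !in_itv /= => /andP[? ?]; apply/andP; lra.
have [] := @MVT R (hlf b) dhlf s t st.
- move=> x xst; apply: is_derive_hlf; apply: I; move: xst.
  by rewrite !in_itv /= => /andP[/ltW -> /ltW ->].
- apply: derivable_within_continuous => x xst.
  by have [] := is_derive_hlf (I x xst).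
by move=> c; rewrite in_itv /= => ? ?; exists c.
Qed.

Lemma hlf_contract s t : s < t -> - aa <= s -> t <= aa ->
  d%:R * (hlf b t - hlf b s) < t - s.
Proof.
move=> st sa ta; have api := aa_lt.
have sH : s \in H by rewrite in_itv /=; apply/andP; lra.
have tH : t \in H by rewrite in_itv /=; apply/andP; lra.
have [c /andP[sc ct] ->] := hlf_MVT sH tH st.
rewrite mulrA gtr_pMl ?subr_gt0//; apply: dhlf_lt.
  by rewrite in_itv /=; apply/andP; lra.
by rewrite ltr_norml; apply/andP; lra.
Qed.

Lemma hlf_expand s t : s < t -> aa <= s -> t < pi / 2 ->
  t - s < d%:R * (hlf b t - hlf b s).
Proof.
move=> st sa tp; have a0 := aa_gt0.
have sH : s \in H by rewrite in_itv /=; apply/andP; lra.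
have tH : t \in H by rewrite in_itv /=; apply/andP; lra.
have [c /andP[sc ct] ->] := hlf_MVT sH tH st.
rewrite mulrA ltr_pMl ?subr_gt0//; apply: dhlf_gt; last lra.
by rewrite in_itv /=; apply/andP; lra.
Qed.

Definition muv : R := hlf b aa.
(** A half-angle s is fixed for the parameter v = s + d h(s); here s is the neutral one. *)
Definition vv1 : R := aa + d%:R * muv.

Lemma muv_gt0 : 0 < muv.
Proof.
by rewrite -hlf0 hlf_lt// ?aa_gt0// itvH// ?aa_lt ?(ltW aa_gt0)// divr_gt0// pi_gt0.
Qed.

Lemma dmuv_lt : d%:R * muv < aa.
Proof.
have := @hlf_contract 0 aa aa_gt0 _ (lexx _); rewrite hlf0 !subr0; apply.
by rewrite oppr_le0 ltW// aa_gt0.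
Qed.

Lemma sin_natmul x n : 0 <= x <= pi -> sin (x *+ n) <= n%:R * sin x.
Proof.
move=> xpi; have sx : 0 <= sin x by rewrite sin_ge0_pi.
suff : `|sin (x *+ n)| <= n%:R * sin x by move/(le_trans (ler_norm _)).
elim: n => [|n IHn]; first by rewrite mulr0n sin0 normr0 mul0r.
rewrite mulrS sinD (le_trans (ler_normD _ _))// !normrM (ger0_norm sx).
rewrite -natr1 mulrDl mul1r addrC lerD//.
  by rewrite (le_trans _ IHn)// ler_piMl// cos_max.
by rewrite ler_piMr// cos_max.
Qed.

Lemma sin2_tan x : cos x != 0 -> sin (x *+ 2) = 2 * tan x / (1 + tan x ^+ 2).
Proof.
move=> c0; rewrite -cos2_tan2// sin_mulr2n /tan; have := c0.
by move: (cos x) (sin x) => c s ?; rewrite mulr2n; field.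
Qed.

(** The derivative of h is sin (2 h(s)) / sin (2 s), so neutrality at [aa] reads d sin (2 muv) = sin
    (2 aa). Thus sin (2 d muv) <= sin (2 aa) by [sin_natmul]; as 2 d muv < 2 aa < pi, this would
    fail if the two angles had sum greater than pi. *)
Lemma vv1_le : vv1 <= pi / 2.
Proof.
have a0 := aa_gt0; have ap := aa_lt; have m0 := muv_gt0; have da := dmuv_lt.
have dm0 : 0 < d%:R * muv by rewrite mulr_gt0// (lt_le_trans _ dR).
have mda : muv <= d%:R * muv by rewrite ler_peMl ?(ltW m0)// (le_trans _ dR)// ler1n.
have e : d%:R * sin (muv *+ 2) = sin (aa *+ 2).
  rewrite !sin2_tan ?gt_eqF ?cos_hlf_gt0 ?cosH_gt0 ?itvH ?(ltW a0)//.
  rewrite /muv tan_hlf tan_aa exprMn sqr_ta.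
  have e := ta2E; have t2 := ta2_gt0.
  have n2 : 1 + ta2 != 0 by rewrite gt_eqF// ltr_pwDl// ltW.
  by rewrite -e; field; rewrite n2 (gt_eqF k0) pnatr_eq0 -lt0n (ltnW d2).
have mp : 0 <= muv *+ 2 <= pi by rewrite mulr2n; apply/andP; lra.
have := sin_natmul d mp; rewrite e -mulrnA mulnC mulrnA -(mulr_natl muv d) => s1.
rewrite leNgt; apply/negP; rewrite /vv1 => vp.
have sp x : sin x = cos `|x - pi / 2| by rewrite cos_norm cosBpihalf.
suff : sin (aa *+ 2) < sin ((d%:R * muv) *+ 2).
  by move/lt_le_trans => /(_ _ s1); rewrite ltxx.
rewrite !sp ltr_cos ?in_itv/= ?normr_ge0/=.
- have -> : `|aa *+ 2 - pi / 2| = aa *+ 2 - pi / 2 by rewrite ger0_norm// (mulr2n aa); lra.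
  by rewrite ltr_norml (mulr2n aa) (mulr2n (d%:R * muv)); apply/andP; lra.
- by rewrite ler_norml (mulr2n (d%:R * muv)); apply/andP; lra.
- by rewrite ler_norml (mulr2n aa); apply/andP; lra.
Qed.

Lemma tan_natmul x n : (2 <= n)%N -> 0 < x -> x *+ n < pi / 2 ->
  n%:R * tan x < tan (x *+ n).
Proof.
move=> n2 x0; have step m : (0 < m)%N -> x *+ m.+1 < pi / 2 ->
    m%:R * tan x <= tan (x *+ m) -> m.+1%:R * tan x < tan (x *+ m.+1).
  move=> m0 xp tm; have xm : 0 < x *+ m by rewrite pmulrn_lgt0.
  move: xp; rewrite mulrS => xp.
  have xp' : x < pi / 2 by lra.
  have xmp : x *+ m < pi / 2 by lra.
  have xH := itvH (ltW x0) xp'; have xmH := itvH (ltW xm) xmp.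
  have H0 : 0 \in H by rewrite itvH// divr_gt0// pi_gt0.
  have t0 : 0 < tan x by rewrite -tan0 ltr_tan.
  have tm0 : 0 < tan (x *+ m) by rewrite -tan0 ltr_tan.
  have c1 := cosH_gt0 xH; have c2 := cosH_gt0 xmH.
  have c3 : 0 < cos (x + x *+ m) by apply: cos_gt0_pihalf; apply/andP; lra.
  have q : 0 < 1 - tan x * tan (x *+ m).
    have -> : 1 - tan x * tan (x *+ m) = cos (x + x *+ m) / (cos x * cos (x *+ m)).
      by rewrite cosD /tan; field; rewrite !gt_eqF.
    by rewrite divr_gt0// mulr_gt0.
  rewrite tanD ?gt_eqF// ltr_pdivlMr// -natr1 mulrDl mul1r.
  have u : 0 < tan x * tan (x *+ m) by rewrite mulr_gt0.
  have p0 : 0 <= m%:R * tan x by rewrite mulr_ge0// ltW.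
  have : (m%:R * tan x + tan x) * (1 - tan x * tan (x *+ m)) < m%:R * tan x + tan x.
    by rewrite gtr_pMr ?ltrBlDr ?ltrDl// ltr_wpDl.
  by move/lt_le_trans; apply; rewrite addrC lerD2l.
elim: n n2 => // n IHn; rewrite leq_eqVlt => /predU1P[[<-]|n2] xp.
  by apply: step => //; rewrite mul1r mulr1n.
have n0 : (0 < n)%N by exact: ltnW.
apply: step => //; apply: ltW; apply: IHn => //.
by apply: le_lt_trans xp; rewrite ler_pMn2l// ltnW.
Qed.

(* The conjugate-cotangent (Poincare density) form of Schwarz's lemma at the
   neutral fixed point [aa], inside the arc from [0] to [vv1]. *)
Lemma hlf_vv1 : vv1 < pi / 2 -> vv1 < d%:R * hlf b vv1.
Proof.
have a0 := aa_gt0; have ap := aa_lt; have m0 := muv_gt0 => vp.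
have d0 : 0 < d%:R :> R by apply: lt_le_trans dR.
have dm0 : 0 < d%:R * muv by rewrite mulr_gt0.
have av : aa < vv1 by rewrite /vv1; lra.
have aH := itvH (ltW a0) ap; have vH := itvH (ltW (lt_trans a0 av)) vp.
pose nu := hlf b vv1 - muv.
have nu0 : 0 < nu by rewrite subr_gt0 hlf_lt.
(* Since V = aa + d muv, the claim V < d h(V) amounts to this bound on the increment of h between
   [aa] and V. *)
suff dn : aa < d%:R * nu.
  have : vv1 = aa + d%:R * muv by []. move: dn; rewrite /nu mulrBr; lra.
have [dnp|dnp] := leP (pi / 2) (d%:R * nu); first by lra.
have dn0 : 0 < d%:R * nu by rewrite mulr_gt0.
have dnH := itvH (ltW dn0) dnp.
rewrite -ltr_tan// tan_aa mulr_natl.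
apply: (@le_lt_trans _ _ (d%:R * tan nu)); last by apply: tan_natmul => //; rewrite -(mulr_natl nu).
pose T := tan vv1; have tT : ta < T by rewrite -tan_aa ltr_tan.
have t0 := ta_gt0.
have n1 : 0 < 1 + kap b ^+ 2 * (ta * T).
  by rewrite ltr_pwDl// mulr_ge0 ?sqr_ge0// mulr_ge0// ltW// (lt_trans t0).
have tB x y : cos x != 0 -> cos y != 0 -> tan (x - y) = (tan x - tan y) / (1 + tan x * tan y).
  by move=> cx cy; rewrite tanD ?cosN// tanN mulrN opprK.
have -> : tan nu = kap b * (T - ta) / (1 + kap b ^+ 2 * (ta * T)).
  rewrite /nu tB ?gt_eqF ?cos_hlf_gt0// /muv !tan_hlf tan_aa -/T.
  by congr (_ / _); ring.
rewrite mulrA ler_pdivlMr//.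
have vap : vv1 - aa = muv *+ d by rewrite /vv1 -(mulr_natl muv); ring.
have : d%:R * tan muv < tan (vv1 - aa).
  by rewrite vap; apply: tan_natmul => //; rewrite -vap; lra.
have n2 : 0 < 1 + T * ta by rewrite ltr_pwDl// mulr_ge0// ltW// (lt_trans t0).
rewrite tB ?gt_eqF ?cosH_gt0// tan_aa -/T /muv tan_hlf tan_aa ltr_pdivlMr// => h.
(* By [e], d kap - kap^2 ta^2 = 1 - d kap ta^2; with this substitution the goal is a rearrangement
   of [h]. *)
have := ta2E; rewrite -sqr_ta => e.
nra.
Qed.

End HalfAngle.

(** * Derivatives on the sphere and critical points *)

Section Caratheodory.
Variable K : numFieldType.
Implicit Types (F G : K -> K) (w D c : K).

(* Caratheodory's formulation of differentiability. *)
Definition hasd F w D := exists G, [/\ G w = D, {for w, continuous G} &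
  \forall x \near w, F x = F w + G x * (x - w)].

Lemma hasd_derive1 F w D : hasd F w D -> derive1 (F : K -> K^o) w = D.
Proof.
move=> [G [GD cG FG]]; rewrite /derive1; apply: cvg_lim => //.
have sw : (h + w) @[h --> (0 : K)] --> w.
  rewrite -[in X in _ --> X](add0r w).
  by apply: cvgD; [exact: (nbhs_filter (0 : K))|exact: cvg_id|apply: cvg_cst; exact: nbhs_filter].
have cG' : G (h + w) @[h --> (0 : K)] --> D.
  by rewrite -GD; exact: (@cvg_comp _ _ _ (fun h => h + w) G _ _ _ sw cG).
have FG' : \forall h \near (0 : K), F (h + w) = F w + G (h + w) * h.
  have FGs : nbhs (0 : K) [set h | F (h + w) = F w + G (h + w) * (h + w - w)] by exact: (sw _ FG).
  by apply: filterS FGs => h /=; rewrite addrK.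
move=> P PD; have nP : \forall h \near (0 : K), P (G (h + w)) by exact: (cG' P PD).
have nP' : (0 : K)^' [set h | P (G (h + w)) /\ F (h + w) = F w + G (h + w) * h].
  by apply: (@nbhs_dnbhs K); exact: filterI nP FG'.
apply: (@filterS _ (0 : K)^' _ _ _ _ (filterI nP' (@nbhs_dnbhs_neq K 0))) => h /= [[Ph ->] h0].
by rewrite addrC addKr /GRing.scale /= mulrC mulfK.
Qed.

Lemma nearS w (P Q : set K) : nbhs w P -> (forall x, P x -> Q x) -> nbhs w Q.
Proof. by move=> nP PQ; apply: filterS nP. Qed.

Lemma nearT w (P : set K) : (forall x, P x) -> nbhs w P.
Proof. by move=> h; apply: nearS (filterT : nbhs w setT) _ => x _; exact: h. Qed.

Lemma nearI w (P Q : set K) : nbhs w P -> nbhs w Q -> nbhs w (P `&` Q).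
Proof. exact: filterI. Qed.

Lemma hasd_continuous F w D : hasd F w D -> {for w, continuous F}.
Proof.
move=> [G [GD cG FG]].
have c : (F w + G x * (x - w)) @[x --> w] --> F w + G w * (w - w).
  apply: cvgD; [exact: (nbhs_filter w)|apply: cvg_cst; exact: nbhs_filter|].
  apply: cvgM; [exact: (nbhs_filter w)|exact: cG|].
  by apply: cvgB; [exact: (nbhs_filter w)|exact: cvg_id|apply: cvg_cst; exact: nbhs_filter].
rewrite subrr mulr0 addr0 in c; apply: cvg_trans c; apply: near_eq_cvg; first exact: (nbhs_filter w).
by apply: nearS FG _ => x ->.
Qed.

Lemma hasd_eq F G w D : (\forall x \near w, F x = G x) -> hasd F w D -> hasd G w D.
Proof.
move=> FG [H [HD cH FH]]; exists H; split => //.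
have FGw := nbhs_singleton FG; rewrite -FGw.
by apply: nearS (nearI FG FH) _ => x [<-].
Qed.

Lemma hasd_cst c w : hasd (fun=> c) w 0.
Proof.
exists (fun=> 0); split => //; first (apply: cvg_cst; exact: nbhs_filter).
by apply: nearT => x; rewrite mul0r addr0.
Qed.

Lemma hasd_id w : hasd id w 1.
Proof.
exists (fun=> 1); split => //; first (apply: cvg_cst; exact: nbhs_filter).
by apply: nearT => x; rewrite mul1r addrC subrK.
Qed.

Lemma hasd_add F G w D c : hasd F w D -> hasd G w c -> hasd (fun x => F x + G x) w (D + c).
Proof.
move=> [H [<- cH FH]] [H' [<- cH' FH']]; exists (fun x => H x + H' x); split => //.
  by apply: cvgD; [exact: (nbhs_filter w)|exact: cH|exact: cH'].
by apply: nearS (nearI FH FH') _ => x [-> ->]; ring.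
Qed.

Lemma hasd_mul F G w D c : hasd F w D -> hasd G w c ->
  hasd (fun x => F x * G x) w (D * G w + F w * c).
Proof.
move=> hF hG; have cG := hasd_continuous hG.
move: hF hG => [H [<- cH FH]] [H' [<- cH' FH']].
exists (fun x => H x * G x + F w * H' x); split => //.
  apply: cvgD; first exact: (nbhs_filter w).
    by apply: cvgM; [exact: (nbhs_filter w)|exact: cH|exact: cG].
  by apply: cvgM; [exact: (nbhs_filter w)|apply: cvg_cst; exact: nbhs_filter|exact: cH'].
by apply: nearS (nearI FH FH') _ => x [-> ->]; ring.
Qed.

Lemma hasd_exp F w D k : hasd F w D ->
  hasd (fun x => F x ^+ k) w (D * (k%:R * F w ^+ k.-1)).
Proof.
move=> hF; elim: k => [|k IHk].
  rewrite mul0r mulr0; apply: hasd_eq (hasd_cst 1 w).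
  by apply: nearT => x; rewrite expr0.
have := hasd_mul hF IHk; rewrite (_ : _ + _ = D * (k.+1%:R * F w ^+ k)).
  by apply: hasd_eq; apply: nearT => x; rewrite exprS.
case: k {IHk} => [|k]; first by rewrite expr0; ring.
by rewrite /= -[k.+2%:R]natr1 exprS; ring.
Qed.

Lemma hasd_inv F w D : F w != 0 -> hasd F w D ->
  hasd (fun x => (F x)^-1) w (- D / F w ^+ 2).
Proof.
move=> Fw0 hF; have cF := hasd_continuous hF; move: hF => [H [<- cH FH]].
exists (fun x => - H x / (F x * F w)); split => //.
- apply: cvgM; [exact: (nbhs_filter w)|apply: cvgN; [exact: (nbhs_filter w)|exact: cH]|].
  apply: cvgV; [exact: (nbhs_filter w)|by rewrite mulf_neq0|].
  by apply: cvgM; [exact: (nbhs_filter w)|exact: cF|apply: cvg_cst; exact: nbhs_filter].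
- have Fn0 : \forall x \near w, F x != 0 by exact: cvgr_neq0 cF Fw0.
  apply: nearS (nearI Fn0 FH) _ => x [Fx0 Fx].
  have -> : - H x / (F x * F w) * (x - w) = (F w - F x) / (F x * F w).
    by rewrite Fx; ring.
  by field; rewrite Fx0 Fw0.
Qed.

Lemma hasd_comp F G w D c : hasd F w D -> hasd G (F w) c -> hasd (G \o F) w (c * D).
Proof.
move=> hF; have cF := hasd_continuous hF.
move: hF => [H [<- cH FH]] [H' [<- cH' FH']].
exists (fun x => H' (F x) * H x); split => //.
  apply: cvgM; [exact: (nbhs_filter w)|exact: (@cvg_comp _ _ _ F H' _ _ _ cF cH')|exact: cH].
have FH2 := cF _ FH'.
by apply: nearS (nearI FH FH2) _ => x [Fx] /= ->; rewrite {2}Fx; ring.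
Qed.

(** One formula serves [fpow] in all charts: the chart 1/z at the source exchanges the columns of
    the matrix, at the target it exchanges the rows and inverts [c]. *)
Lemma hasd_homography (a e g h : K) w c k : g * w + h != 0 ->
  hasd (fun x => c * ((a * x + e) / (g * x + h)) ^+ k) w
    (c * (k%:R * ((a * w + e) / (g * w + h)) ^+ k.-1) *
      ((a * h - e * g) / (g * w + h) ^+ 2)).
Proof.
move=> n0; have aff (p q : K) : hasd (fun x => p * x + q) w p.
  have := hasd_add (hasd_mul (hasd_cst p w) (hasd_id w)) (hasd_cst q w).
  by rewrite mul0r mulr1 add0r addr0.
have h1 := hasd_mul (aff a e) (@hasd_inv (fun x => g * x + h) w g n0 (aff g h)).
have := hasd_mul (hasd_cst c w) (hasd_exp k h1).
rewrite mul0r add0r; congr hasd.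
move: (_ ^+ k.-1) => M; field; by rewrite n0.
Qed.

End Caratheodory.

(* [R[i]] with its topology, which is not found on the bare type. *)
Definition Cplx (R : realType) : numFieldType := R[i].

Section Charts.
Variable R : realType.
Implicit Types (p z : sphere R) (g : sphere R -> sphere R) (w D lam : R[i]).

Lemma of_to_chart p : of_chart p (to_chart p p) = p.
Proof. by case: p => //=; rewrite eqxx. Qed.

(* By the second condition, [g] avoids near [p] the point where the chart at
   [g p] has a junk value. *)
Definition chart_deriv g p D :=
  hasd (to_chart (g p) \o g \o of_chart p) (to_chart p p) D /\
  \forall w \near (to_chart p p : Cplx R),
    of_chart (g p) (to_chart (g p) (g (of_chart p w))) = g (of_chart p w).

Lemma sphere_derivE g p D : chart_deriv g p D -> sphere_deriv g p = D.
Proof. by case=> h _; exact: hasd_derive1. Qed.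

(** Chain rule: the second condition for [g] makes the two charts at the intermediate point
    cancel. *)
Lemma chart_deriv_comp g f p D D' : chart_deriv g p D -> chart_deriv f (g p) D' ->
  chart_deriv (f \o g) p (D' * D).
Proof.
move=> [hg ng] [hf nf].
split.
  have hf' : hasd (to_chart (f (g p)) \o f \o of_chart (g p) : Cplx R -> Cplx R)
      ((to_chart (g p) \o g \o of_chart p) (to_chart p p)) D' by rewrite /= of_to_chart.
  apply: hasd_eq (hasd_comp hg hf').
  by apply: nearS ng _ => w /= ->.
have nf2 : nbhs ((to_chart (g p) \o g \o of_chart p) (to_chart p p) : Cplx R)
    [set w | of_chart (f (g p)) (to_chart (f (g p)) (f (of_chart (g p) w))) =
      f (of_chart (g p) w)] by rewrite /= of_to_chart.
have nf' := hasd_continuous hg nf2.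
by apply: nearS (nearI ng nf') _ => w [] /= ->.
Qed.

Lemma affine_neq0_near (a c w : R[i]) : a * w + c != 0 ->
  nbhs (w : Cplx R) [set x | a * x + c != 0].
Proof.
move=> n0; have h : hasd (fun x => a * x + c) w (0 * w + a * 1 + 0).
  exact: hasd_add (hasd_mul (hasd_cst a w) (hasd_id w)) (hasd_cst c w).
have nn := nbhs_filter (w : Cplx R).
exact: (@cvgr_neq0 _ _ _ _ nn _ _ (hasd_continuous h) n0).
Qed.

Variable b : R.
Hypothesis b1 : 1 < b.
Let bC : b%:C != 0 :> R[i].
Proof. by rewrite (inj_eq (@complexI _) _ 0) gt_eqF// (lt_trans _ b1). Qed.
Let detC : 1 - b%:C * b%:C != 0 :> R[i].
Proof.
rewrite -rmorphM -(rmorph1 (real_complex R)) -rmorphB (inj_eq (@complexI _) _ 0).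
by rewrite subr_eq0 eq_sym gt_eqF// -expr2 exprn_egt1.
Qed.

Lemma chart_deriv_fpow_finite k lam w : b%:C * w + 1 != 0 ->
  chart_deriv (fpow b k lam) (Some w)
    (lam * (k%:R * ((w + b%:C) / (b%:C * w + 1)) ^+ k.-1) *
      ((1 - b%:C * b%:C) / (b%:C * w + 1) ^+ 2)).
Proof.
move=> n0; have nn := affine_neq0_near n0.
have fw x : b%:C * x + 1 != 0 -> fpow b k lam (Some x) =
    Some (lam * ((x + b%:C) / (b%:C * x + 1)) ^+ k) by move=> x0; rewrite /= (negPf x0).
split.
  have := @hasd_homography _ 1 b%:C b%:C 1 w lam k n0.
  rewrite !mul1r; apply: hasd_eq; apply: nearS nn _ => x x0 /=.
  by rewrite (negPf n0) (negPf x0) mul1r.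
by apply: nearS nn _ => x x0; rewrite /of_chart !fw.
Qed.

Lemma chart_deriv_fpow_pole k lam w : (0 < k)%N -> lam != 0 -> b%:C * w + 1 = 0 ->
  exists D, chart_deriv (fpow b k lam) (Some w) D.
Proof.
move=> k0 l0 w0; have n0 : 1 * w + b%:C != 0.
  apply/eqP => wb; move/eqP: detC; apply; rewrite -w0 (_ : w = - b%:C); first by ring.
  by apply/eqP; rewrite -addr_eq0 -[w]mul1r wb.
have nn := affine_neq0_near n0.
exists (lam^-1 * (k%:R * ((b%:C * w + 1) / (1 * w + b%:C)) ^+ k.-1) *
      ((b%:C * b%:C - 1 * 1) / (1 * w + b%:C) ^+ 2)).
have fpE : fpow b k lam (Some w) = None by rewrite /= w0 eqxx.
split.
  have := @hasd_homography _ b%:C 1 1 b%:C w lam^-1 k n0.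
  apply: hasd_eq; apply: nearS nn _ => x x0 /=; rewrite w0 eqxx.
  case: ifPn => [/eqP ->|bx0]; first by rewrite mul0r expr0n gtn_eqF// mulr0.
  by rewrite mul1r /= invfM -exprVn invf_div.
apply: nearS nn _ => x /=; rewrite mul1r => x0; rewrite w0 eqxx.
case: ifPn => [_|bx0]; first by rewrite /= eqxx.
have v0 : lam * ((x + b%:C) / (b%:C * x + 1)) ^+ k != 0.
  by rewrite mulf_neq0// expf_neq0// mulf_neq0// invr_eq0.
by rewrite /= invr_eq0 (negPf v0) invrK.
Qed.

Lemma chart_deriv_fpow_infty k lam : (0 < k)%N ->
  chart_deriv (fpow b k lam) None
    (lam * (k%:R * (b%:C)^-1 ^+ k.-1) * ((b%:C * b%:C - 1) / b%:C ^+ 2)).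
Proof.
move=> k0; have n0 : 1 * 0 + b%:C != 0 by rewrite mulr0 add0r.
have nn := affine_neq0_near n0.
have fx x : x + b%:C != 0 -> fpow b k lam (of_chart None x) =
    Some (lam * ((b%:C * x + 1) / (x + b%:C)) ^+ k).
  move=> x0; have [->|xn0] := eqVneq x 0.
    by rewrite /= eqxx /= mulr0 !add0r mul1r.
  rewrite /= (negPf xn0) /=.
  have e : b%:C * x^-1 + 1 = (x + b%:C) / x by field.
  rewrite e mulf_eq0 invr_eq0 (negPf x0) (negPf xn0) /=.
  by congr (Some (_ * _ ^+ _)); field; rewrite x0 xn0.
split; last first.
  by apply: nearS nn _ => x; rewrite /= mul1r => x0; rewrite fx.
have := @hasd_homography _ b%:C 1 1 b%:C 0 lam k n0.
rewrite !mulr0 !add0r !mul1r; apply: hasd_eq; apply: nearS nn _ => x /=.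
rewrite mul1r => x0; rewrite /comp fx//= mul1r.
Qed.

Lemma fpow_chart_deriv k lam p : (0 < k)%N -> lam != 0 ->
  exists D, chart_deriv (fpow b k lam) p D.
Proof.
move=> k0 l0; case: p => [w|]; last by eexists; exact: chart_deriv_fpow_infty.
have [w0|w0] := eqVneq (b%:C * w + 1) 0; first exact: chart_deriv_fpow_pole.
by eexists; exact: chart_deriv_fpow_finite.
Qed.

(** At a finite point other than the pole the derivative vanishes only with the fraction, and then
    the value is 0. The pole falls under the second alternative whether or not it is critical, and
    infinity is never critical. *)
Lemma critical_fpow k lam p : (0 < k)%N -> lam != 0 ->
  critical_point (fpow b k lam) p ->
  fpow b k lam p = Some 0 \/ fpow b k lam p = None.
Proof.
move=> k0 l0; have kR : k%:R != 0 :> R[i] by rewrite pnatr_eq0 -lt0n.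
rewrite /critical_point; case: p => [w|].
  have [w0|w0] := eqVneq (b%:C * w + 1) 0; first by right; rewrite /= w0 eqxx.
  rewrite (sphere_derivE (chart_deriv_fpow_finite k lam w0)) => /eqP.
  have w2 : (b%:C * w + 1) ^- 2 != 0 by rewrite invr_eq0 expf_neq0.
  rewrite mulf_eq0 [X in _ || X]mulf_eq0 (negPf detC) (negPf w2) !orbF.
  rewrite !mulf_eq0 (negPf l0) (negPf kR) /= expf_eq0 => /andP[k1 M0]; left.
  by rewrite /= (negPf w0) (eqP M0) expr0n gtn_eqF// mulr0.
rewrite (sphere_derivE (chart_deriv_fpow_infty lam k0)) => /eqP.
have b2 : (b%:C) ^- 2 != 0 by rewrite invr_eq0 expf_neq0.
have bk : (b%:C)^-1 ^+ k.-1 != 0 by rewrite expf_neq0// invr_eq0.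
rewrite !mulf_eq0 (negPf l0) (negPf kR) (negPf b2) (negPf bk) orbF /=.
by rewrite -oppr_eq0 opprB (negPf detC).
Qed.

End Charts.

(** * Fixed points on the circle and the range of parameters *)

Section Circle.
Variable R : realType.
Implicit Types (x y s t : R) (w : R[i]).

Lemma sqnV w : sqn w^-1 = (sqn w)^-1.
Proof.
have [->|w0] := eqVneq w 0; first by rewrite invr0 sqn0 invr0.
have s0 : sqn w != 0 by rewrite sqn_eq0.
by apply: (mulIf s0); rewrite -sqnM !mulVf// sqn1.
Qed.

Lemma cos_eq1 x : cos x = 1 -> `|x| < 2 * pi -> x = 0.
Proof.
move=> cx xp; have [//|x0] := eqVneq x 0.
have : sin (x / 2) ^+ 2 = 0.
  have : cos ((x / 2) *+ 2) = 1 by rewrite (_ : (x / 2) *+ 2 = x)// mulr2n; field.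
  by rewrite cos_mulr2n cos2sin2 mulr2n; lra.
move=> /eqP; rewrite sqrf_eq0 => /eqP s0.
have : 0 < sin `|x / 2|.
  apply: sin_gt0_pi; rewrite normr_gt0 mulf_neq0 ?invr_eq0//= normrM.
  by rewrite (ger0_norm (_ : 0 <= 2^-1)) ?invr_ge0//; lra.
by case: (ger0P (x / 2)) => _; rewrite ?sinN s0 ?oppr0 ltxx.
Qed.

Lemma expi_inj x y : expi x = expi y -> `|x - y| < 2 * pi -> x = y.
Proof.
move=> [cxy sxy] xy; apply/eqP; rewrite -subr_eq0; apply/eqP; apply: cos_eq1 => //.
by rewrite cosB cxy sxy -!expr2 cos2Dsin2.
Qed.

Lemma sqn1_cos w : sqn w = 1 -> -1 <= complex.Re w <= 1.
Proof.
case: w => a c; rewrite /sqn /= => e; rewrite -ler_norml -sqrtr_sqr -sqrtr1.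
by rewrite ler_sqrt//; have := sqr_ge0 c; lra.
Qed.

Lemma expi_circle_arg w : sqn w = 1 -> expi (circle_arg w) = w.
Proof.
move=> w1; have r1 := sqn1_cos w1; rewrite /circle_arg.
have cE : cos (acos (complex.Re w)) = complex.Re w by rewrite acosK// in_itv.
have sE : sin (acos (complex.Re w)) = `|complex.Im w|.
  by rewrite sin_acos// -sqrtr_sqr; congr Num.sqrt; rewrite -w1 /sqn; ring.
case: ifP => [i0|/negbT]; last rewrite -ltNge => i0.
  by rewrite /expi cE sE ger0_norm//; case: (w).
by rewrite /expi cosN sinN cE sE ltr0_norm// opprK; case: (w).
Qed.

Lemma circle_arg_itv w : sqn w = 1 -> - pi < circle_arg w <= pi.
Proof.
move=> w1; have r1 := sqn1_cos w1; rewrite /circle_arg; have p0 := pi_gt0 R.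
have a0 := acos_ge0 r1; have a1 := acos_lepi r1.
case: ifP => [i0|/negbT]; last rewrite -ltNge => i0; first by apply/andP; lra.
have rN : -1 < complex.Re w.
  rewrite lt_neqAle (andP r1).1 andbT eq_sym; apply: contraTneq i0 => r.
  move: w1; rewrite /sqn r sqrrN expr1n => w1.
  have : complex.Im w ^+ 2 = 0 by lra.
  by move/eqP; rewrite sqrf_eq0 => /eqP ->; rewrite ltxx.
have : acos (complex.Re w) < pi by apply: acos_ltpi; rewrite rN (andP r1).2.
by move=> ?; apply/andP; lra.
Qed.

Lemma circle_half_angle w : sqn w = 1 -> w != -1 ->
  exists2 s, - (pi / 2) < s < pi / 2 & w = expi (2 * s).
Proof.
move=> w1 wN1; exists (circle_arg w / 2); last first.
  by rewrite (_ : 2 * _ = circle_arg w) ?expi_circle_arg//; field.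
have /andP[h1 h2] := circle_arg_itv w1.
have h3 : circle_arg w != pi.
  apply: contra wN1 => /eqP h; rewrite -(expi_circle_arg w1) h /expi cospi sinpi.
  by rewrite eq_complex /= oppr0 !eqxx.
have h4 : circle_arg w < pi by rewrite lt_neqAle h3.
by apply/andP; lra.
Qed.

Variables (b : R) (d : nat).
Hypotheses (b1 : 1 < b) (d2 : (2 <= d)%N) (bd : d%:R * kap b < 1).

Let H s := - (pi / 2) < s < pi / 2.

Lemma mob_expi s : H s ->
  (b%:C * expi (2 * s) + 1) * expi (- (2 * hlf b s)) = expi (2 * s) + b%:C.
Proof.
move=> sH; have c0 : 0 < cos s by apply: cos_gt0_pihalf.
have h0 := cos_hlf_gt0 b s.
have E u : expi (2 * u) = expi u * expi u by rewrite -expiD; congr expi; ring.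
have J u : expi u * expi (- u) = 1 :> R[i] by rewrite -expiD subrr expi0.
have e1 : b%:C * expi s + expi (- s) = (expi s + b%:C * expi (- s)) * expi (2 * hlf b s).
  rewrite E; apply: (mulIf (expi_neq0 (- hlf b s))).
  rewrite -!mulrA J mulr1.
  apply/eqP; rewrite eq_complex !reim /= !cosN !sinN sin_hlf ?lt0r_neq0//.
  rewrite /kap; have bp : 0 < b + 1 by rewrite addr_gt0// (lt_trans _ b1).
  move: (cos s) (sin s) (cos (hlf b s)) c0 h0 => c e C c0 h0.
  by apply/andP; split; apply/eqP; field; rewrite !gt_eqF.
have -> : b%:C * expi (2 * s) + 1 = expi s * (b%:C * expi s + expi (- s)).
  by rewrite mulrDr J E; ring.
by rewrite e1 -!mulrA J mulr1 mulrDr (mulrCA _ b%:C) J mulr1 E.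
Qed.

Lemma sqn_mob_den s :
  sqn (b%:C * expi (2 * s) + 1) = (b + 1) ^+ 2 * cos s ^+ 2 + (b - 1) ^+ 2 * sin s ^+ 2.
Proof.
rewrite (_ : 2 * s = s + s); last by ring.
rewrite /sqn !reim /= cosD sinD; have e := cos2Dsin2 s.
move: (cos s) (sin s) e => c t e.
have -> : b * (c * c - t * t) - 0 * (t * c + c * t) + 1 =
  b * (c * c - t * t) - 0 * (t * c + c * t) + (c ^+ 2 + t ^+ 2) by rewrite e.
have h : (c ^+ 2 + t ^+ 2) * ((b + 1) ^+ 2 * c ^+ 2 + (b - 1) ^+ 2 * t ^+ 2) =
  (b + 1) ^+ 2 * c ^+ 2 + (b - 1) ^+ 2 * t ^+ 2 by rewrite e mul1r.
by rewrite -h; ring.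
Qed.

Lemma mob_den_neq0 s : H s -> b%:C * expi (2 * s) + 1 != 0.
Proof.
move=> sH; have c0 : 0 < cos s by apply: cos_gt0_pihalf.
have bp : 0 < b + 1 by rewrite addr_gt0// (lt_trans _ b1).
rewrite -sqn_gt0 sqn_mob_den; apply: ltr_wpDr; first by rewrite mulr_ge0 ?sqr_ge0.
by rewrite mulr_gt0// exprn_gt0.
Qed.

Lemma fpow_cpt k v s : H s ->
  fpow b k (expi (2 * v)) (cpt (2 * s)) = cpt (2 * (v - k%:R * hlf b s)).
Proof.
move=> sH; rewrite /cpt /fpow (negPf (mob_den_neq0 sH)); congr Some.
have -> : (expi (2 * s) + b%:C) / (b%:C * expi (2 * s) + 1) = expi (- (2 * hlf b s)).
  by rewrite -mob_expi// mulrC mulKf// mob_den_neq0.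
rewrite -expiMn -expiD; congr expi; rewrite -mulr_natl; ring.
Qed.

(** [fpow] exchanges the two sides of the circle, so neither side contains a fixed point. *)
Lemma fixed_on_circle k lam p : sqn lam = 1 -> (0 < k)%N ->
  fpow b k lam p = p -> sZ p = 0.
Proof.
move=> l1 k0 fp; have [p0|p0|//] := ltgtP (sZ p) 0.
  have pN : 0 < (\- @sZ R) p by rewrite /= oppr_gt0.
  have [] := fpow_contracts_sZN b1 k0 l1 pN pN.
  by rewrite fp => p0' _; have := lt_trans p0 p0'; rewrite ltxx.
have [] := fpow_contracts_sZ b1 k0 l1 p0 p0.
by rewrite fp /= oppr_gt0 => p0' _; have := lt_trans p0 p0'; rewrite ltxx.
Qed.

Lemma sqn_deriv_fpow lam w : sqn lam = 1 -> sqn w = 1 -> b%:C * w + 1 != 0 ->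
  sqn (sphere_deriv (fpow b d lam) (Some w)) =
  (d%:R * (b ^+ 2 - 1) / sqn (b%:C * w + 1)) ^+ 2.
Proof.
move=> l1 w1 w0; rewrite (sphere_derivE (chart_deriv_fpow_finite d lam w0)).
have sw : sqn (w + b%:C) = sqn (b%:C * w + 1).
  move: w1; rewrite /sqn !reim; move: (complex.Re w) (complex.Im w) => x y e.
  have -> : (x + b) ^+ 2 + (y + 0) ^+ 2 = (x ^+ 2 + y ^+ 2) + b ^+ 2 + 2 * b * x by ring.
  have -> : (b * x - 0 * y + 1) ^+ 2 + (b * y + 0 * x + 0) ^+ 2 =
    b ^+ 2 * (x ^+ 2 + y ^+ 2) + 1 + 2 * b * x by ring.
  by rewrite e; ring.
have sn0 : 0 < sqn (b%:C * w + 1) by rewrite sqn_gt0.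
have sM : sqn ((w + b%:C) / (b%:C * w + 1)) = 1.
  by apply: (mulIf (lt0r_neq0 sn0)); rewrite -sqnM divfK// sw mul1r.
have sd : sqn (d%:R : R[i]) = d%:R ^+ 2.
  by rewrite -(rmorph_nat (real_complex R)) /sqn !reim; ring.
have sb : sqn (1 - b%:C * b%:C) = (b ^+ 2 - 1) ^+ 2 by rewrite /sqn !reim; ring.
by rewrite !sqnM sqnV !sqnX sM l1 expr1n sd sb; field; rewrite lt0r_neq0.
Qed.

Lemma sqn_deriv_cpt lam s : sqn lam = 1 -> H s ->
  sqn (sphere_deriv (fpow b d lam) (cpt (2 * s))) = (d%:R * dhlf b s) ^+ 2.
Proof.
move=> l1 sH; rewrite sqn_deriv_fpow ?sqn_expi ?mob_den_neq0//.
have bp : 0 < b + 1 by rewrite addr_gt0// (lt_trans _ b1).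
have c0 : 0 < cos s by apply: cos_gt0_pihalf.
congr (_ ^+ 2); rewrite -mulrA; congr (_ * _).
rewrite sqn_mob_den /dhlf /tan /kap.
have n1 : 0 < (b + 1) ^+ 2 * cos s ^+ 2 + (b - 1) ^+ 2 * sin s ^+ 2.
  apply: ltr_wpDr; first by rewrite mulr_ge0 ?sqr_ge0.
  by rewrite mulr_gt0// exprn_gt0.
have e := cos2Dsin2 s; move: (cos s) (sin s) c0 n1 e => c t c0 n1 e.
have -> : b ^+ 2 - 1 = (b ^+ 2 - 1) * (c ^+ 2 + t ^+ 2) by rewrite e mulr1.
by field; rewrite !exprMn !lt0r_neq0.
Qed.

(* A fixed point lies on the circle, and comparing its multiplier with 1
   amounts to comparing the half-angle with [aa]. *)
Lemma fixed_point_angle lam p : sqn lam = 1 -> fpow b d lam p = p ->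
  sqn (sphere_deriv (fpow b d lam) p) <= 1 ->
  exists s, [/\ p = cpt (2 * s), H s,
    sqn (sphere_deriv (fpow b d lam) p) = (d%:R * dhlf b s) ^+ 2 &
    lam = expi (2 * (s + d%:R * hlf b s)) ].
Proof.
move=> l1 fp; have d0 : (0 < d)%N by exact: ltnW.
have /sphere_circleE [w /eqP] := fixed_on_circle l1 d0 fp.
rewrite sqn_norm => /eqP w1 pw; rewrite pw.
have b1' := b1; have bm : 0 < b - 1 by lra.
have bp : 0 < b + 1 by lra.
have dR : 2 <= d%:R :> R by rewrite ler_nat.
have w0 : b%:C * w + 1 != 0.
  by apply/negP => /eqP w0; move: fp; rewrite pw /= w0 eqxx.
(* The half-angle coordinate misses -1, where the multiplier would have modulus d (b + 1) / (b - 1)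
   > 1. *)
have wN1 : sqn (sphere_deriv (fpow b d lam) (Some w)) <= 1 -> w != -1.
  rewrite sqn_deriv_fpow//; apply: contraTneq => ->; rewrite -ltNge.
  have -> : sqn (b%:C * -1 + 1) = (b - 1) ^+ 2 by rewrite /sqn !reim; ring.
  rewrite exprn_egt1// ltr_pdivlMr ?exprn_gt0// mul1r.
  have -> : d%:R * (b ^+ 2 - 1) = (b - 1) * (d%:R * (b + 1)) by ring.
  rewrite expr2 ltr_pM2l//; apply: (@lt_le_trans _ _ (1 * (b + 1))); first lra.
  by rewrite ler_pM2r//; lra.
move=> /wN1 {}wN1; have [s sH ws] := circle_half_angle w1 wN1.
exists s; rewrite ws -/(cpt _); split => //; first exact: sqn_deriv_cpt.
have := fp; rewrite pw ws -/(cpt _).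
have -> : lam = expi (2 * (circle_arg lam / 2)).
  by rewrite (_ : 2 * _ = circle_arg lam) ?expi_circle_arg//; field.
rewrite fpow_cpt// => -[]; rewrite -/(expi _) -/(expi (2 * s)) => cc ss.
have ee : expi (2 * (circle_arg lam / 2 - d%:R * hlf b s)) = expi (2 * s).
  by rewrite /expi cc ss.
have -> : 2 * (s + d%:R * hlf b s) = 2 * s + 2 * (d%:R * hlf b s) by ring.
by rewrite [RHS]expiD -ee -expiD; congr expi; ring.
Qed.

End Circle.

(** * The special parameters in terms of half-angles *)

Section ParameterRange.
Variable R : realType.
Variables (b : R) (d : nat).
Hypotheses (b1 : 1 < b) (d2 : (2 <= d)%N) (bd : d%:R * kap b < 1).
Implicit Types (x y s t : R) (w lam : R[i]).

Local Notation h := (hlf b).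
Local Notation a := (aa b d).
Local Notation V := (vv1 b d).
Let a0 : 0 < a := aa_gt0 b1 d2 bd.
Let ap : a < pi / 2 := aa_lt b d.
Let H s := - (pi / 2) < s < pi / 2.

Lemma dhlfN s : dhlf b (- s) = dhlf b s.
Proof. by rewrite /dhlf tanN sqrrN. Qed.

Lemma dhlf_ge0 s : 0 <= dhlf b s.
Proof.
have k0 := kap_gt0 b1; apply: divr_ge0.
  by rewrite mulr_ge0 ?(ltW k0)// addr_ge0 ?sqr_ge0.
by rewrite addr_ge0// mulr_ge0 ?sqr_ge0.
Qed.

Lemma dhlf_aa : d%:R * dhlf b a = 1.
Proof.
rewrite /dhlf tan_aa sqr_ta// mulrA mulrA ta2E// divff// gt_eqF//.
by rewrite ltr_pwDl// mulr_ge0 ?sqr_ge0// ltW// ta2_gt0.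
Qed.

Lemma dhlf_norm s : dhlf b `|s| = dhlf b s.
Proof. by case: (ger0P s) => // _; rewrite dhlfN. Qed.

Lemma dhlf_lt1 s : H s -> d%:R * dhlf b s < 1 -> `|s| < a.
Proof.
move=> sH; rewrite -dhlf_norm; have [//|sa|->] := ltgtP `|s| a; last by rewrite dhlf_aa ltxx.
have := dhlf_gt b1 d2 bd (itvH (normr_ge0 s) _) sa.
rewrite ltr_norml => /(_ sH) h1 h2; have := lt_trans h1 h2; by rewrite ltxx.
Qed.

Lemma dhlf_eq1 s : H s -> d%:R * dhlf b s = 1 -> `|s| = a.
Proof.
move=> sH e; have sp : `|s| < pi / 2 by rewrite ltr_norml.
have [sa|sa|//] := ltgtP `|s| a.
  by have := dhlf_lt b1 d2 bd (sH : s \in `](- (pi / 2)), (pi / 2)[) sa; rewrite e ltxx.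
have := dhlf_gt b1 d2 bd (itvH (normr_ge0 s) sp) sa.
by rewrite dhlf_norm e ltxx.
Qed.

Lemma norm_lt1 w : (`|w| < 1) = (sqn w < 1).
Proof.
rewrite normc_def -[1 in LHS]/((1 : R)%:C) ltcR -/(sqn w).
by rewrite -[1 in LHS]sqrtr1 ltr_sqrt.
Qed.

(** A parabolic multiplier has modulus 1, so the fixed half-angle is [a] or [- a]. The parameter
    then has argument 2 V or - 2 V, and the positivity of the argument selects 2 V. *)
Lemma lambda1E lam1 : is_lambda1 d b lam1 -> lam1 = expi (2 * V) /\ V < pi / 2.
Proof.
move=> [/eqP]; rewrite sqn_norm => /eqP l1 /andP[arg0 argp] [p [fp [n n0 pn]]].
have sD : sqn (sphere_deriv (fpow b d lam1) p) = 1.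
  have : sqn (sphere_deriv (fpow b d lam1) p) ^+ n == 1 by rewrite -sqnX pn sqn1.
  by rewrite pexpr_eq1 ?sqn_ge0// => /eqP.
have [|s [ps sH]] := fixed_point_angle b1 d2 l1 fp; first by rewrite sD.
rewrite sD => /esym/eqP; rewrite sqrf_eq1 => /orP[|] /eqP ds lE; last first.
  have : 0 <= d%:R * dhlf b s by rewrite mulr_ge0 ?dhlf_ge0.
  by rewrite ds; lra.
have sa := dhlf_eq1 sH ds.
have m0 : 0 < d%:R * h a by have := muv_gt0 b1 d2 bd => ?; rewrite mulr_gt0// ltr0n (ltnW d2).
have Vle := vv1_le b1 d2 bd; have VE : V = a + d%:R * h a by [].
have lE' : lam1 = expi (circle_arg lam1) by rewrite expi_circle_arg.
have p0 := pi_gt0 R; have a0' := a0; have ap' := ap.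
have e : circle_arg lam1 = 2 * V.
  move: sa; case: (ger0P s) => _ sa.
    apply: expi_inj; first by rewrite -lE' lE sa.
    by rewrite ltr_norml; apply/andP; lra.
  have : circle_arg lam1 = - (2 * V).
    apply: expi_inj; first by rewrite -lE' lE VE -sa hlfN; congr expi; ring.
    by rewrite ltr_norml; apply/andP; lra.
  lra.
by split; [rewrite -e|lra].
Qed.

(** The equation for lambda_0 is expi (2 E(v)) = 1 with E(v) = v - d h(v). E is positive on ]0, a],
    decreases beyond a and is negative at V by [hlf_vv1]. A zero of E before V bounds the smallest
    solution r; there E(r) <= 0, which forces r > a, and E stays nonpositive from r on. *)
Lemma lambda0E lam0 : V < pi / 2 -> is_lambda0 d b lam0 ->
  exists s, [/\ lam0 = expi (2 * s), 0 < s < V &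
    forall v, s <= v < pi / 2 -> v <= d%:R * h v].
Proof.
move=> Vp [th -> [th0 fth thmin]]; have a0' := a0; have ap' := ap.
have p0 := pi_gt0 R; have da := dmuv_lt b1 d2 bd; have m0 := muv_gt0 b1 d2 bd.
have hV := hlf_vv1 b1 d2 bd Vp; have dR : 0 < d%:R :> R by rewrite ltr0n (ltnW d2).
have dm0 : 0 < d%:R * h a by rewrite mulr_gt0.
have aV : a < V by rewrite /vv1 ltrDl.
pose E s := s - d%:R * h s.
have Hs s : 0 <= s -> s < pi / 2 -> H s by move=> ? ?; apply/andP; lra.
have cE : {within `[a, V], continuous E}.
  apply: continuous_in_subspaceT => x; rewrite inE /= in_itv /= => /andP[ax xV].
  apply: cvgB; first exact: cvg_id.
  apply: cvgMl_tmp; apply: continuous_hlf; apply: Hs; lra.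
have [s sI Es] : exists2 s, s \in `[a, V] & E s = 0.
  have Ea : 0 < E a by rewrite /E subr_gt0.
  have EV : E V < 0 by rewrite /E subr_lt0.
  apply: (IVT (ltW aV) cE); rewrite ge_min le_max (ltW EV) (ltW Ea) orbT //.
move: sI; rewrite in_itv /= => /andP[sa sV].
have sV' : s < V.
  by rewrite lt_neqAle sV andbT; apply/eqP => eV; move: hV; rewrite -subr_gt0 -opprB -[_ - _]/(E V) -eV Es oppr0 ltxx.
have ths : th <= 2 * s.
  apply: thmin; first lra.
  rewrite -/(cpt _) fpow_cpt//; last by apply: Hs; lra.
  by rewrite -[_ - _]/(E s) Es mulr0 /cpt expi0.
pose r := th / 2; have thr : th = 2 * r by rewrite /r; field.
have rH : H r by apply: Hs; rewrite /r; lra.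
have Er : E r <= 0.
  rewrite leNgt; apply/negP => Er; move: fth; rewrite thr -/(cpt _) fpow_cpt// => -[c s'].
  have : 2 * E r = 0.
    apply: expi_inj; first by rewrite /expi c s' cos0 sin0.
    have : 0 <= h r by rewrite -(hlf0 b) hlf_le// ?itvH//; rewrite /r; lra.
    move=> hr; have : 0 <= d%:R * h r by rewrite mulr_ge0// ltW.
    by rewrite subr0 /E in Er *; rewrite gtr0_norm /r; lra.
  lra.
have ra : a < r.
  rewrite ltNge; apply/negP => ra; have r0 : 0 < r by rewrite /r; lra.
  have := hlf_contract b1 d2 bd r0 _ ra; rewrite hlf0 !subr0.
  have Na : - a <= 0 by lra.
  by move=> /(_ Na); move: Er; rewrite /E; lra.
exists r; split; [by rewrite -thr|by apply/andP; rewrite /r; lra|].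
move=> v /andP[rv vp]; move: rv; rewrite le_eqVlt => /predU1P[<-|rv].
  by rewrite -subr_le0.
have := hlf_expand b1 d2 bd rv (ltW ra) vp; move: Er; rewrite /E mulrBr; lra.
Qed.

(** The angles provided by [arc_cc] are known only modulo full turns, so they are compared through
    their differences from the angle of [lam0]. *)
Lemma parameterE lam0 lam1 lam2 lam :
  is_lambda0 d b lam0 -> is_lambda1 d b lam1 -> is_lambda2 d b lam0 lam1 lam2 ->
  arc_co lam0 lam2 lam ->
  exists v, [/\ lam = expi (2 * v), 0 < v < V, V < pi / 2 & v <= d%:R * h v].
Proof.
move=> l0 /lambda1E[l1E Vp] [[[arc12 l20] _] _] [arc02 ll2].
have [r [l0E /andP[r0 rV] rP]] := lambda0E Vp l0.
move: arc12 => [s [t [u [es et eu /andP[su ut] ts]]]].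
move: arc02 => [s' [t' [u' [es' et' eu' /andP[su' ut'] ts']]]].
have p0 := pi_gt0 R.
have shift x y z : expi x = expi y -> expi (x + (z - y)) = expi z.
  by move=> e; rewrite expiD e -expiD; congr expi; ring.
have tV : 2 * r + (t - s) = 2 * V.
  apply: expi_inj; first by rewrite shift -?et// -l0E es.
  by rewrite ltr_norml; apply/andP; lra.
have tu : t' - s' = u - s.
  apply: (addrI (2 * r)); apply: expi_inj.
    by rewrite !shift -?et' -?eu// -l0E.
  by rewrite ltr_norml; apply/andP; lra.
have lE : lam = expi (2 * r + (u' - s')) by rewrite shift -?eu'// -l0E es'.
have utne : u' - s' != t' - s'.
  apply/eqP => e; apply: ll2; rewrite /set1 /= et' eu'; congr expi; lra.
have ult : u' - s' < t' - s' by rewrite lt_neqAle utne; lra.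
exists (r + (u' - s') / 2); split => //.
- by rewrite lE; congr expi; field.
- by apply/andP; lra.
- by apply: rP; apply/andP; lra.
Qed.

End ParameterRange.

(** * Dynamics on the circle *)

Section RealDynamics.
Variable R : realType.
Variables (b : R) (d : nat).
Hypotheses (b1 : 1 < b) (d2 : (2 <= d)%N) (bd : d%:R * kap b < 1).
Implicit Types (s t : R).

Local Notation h := (hlf b).
Local Notation a := (aa b d).
Local Notation V := (vv1 b d).
Let H s := - (pi / 2) < s < pi / 2.

Variable v : R.
Hypotheses (v0 : 0 < v) (vV : v < V) (Vp : V < pi / 2) (vh : v <= d%:R * h v).

(* [fpow b d (expi (2 * v))] acts on half-angles as [cmap]. *)
Definition cmap s := v - d%:R * h s.

Let d0 : 0 < d%:R :> R. Proof. by rewrite ltr0n (ltnW d2). Qed.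
Let a0 : 0 < a := aa_gt0 b1 d2 bd.

Lemma h_ge0 s : 0 <= s -> s < pi / 2 -> 0 <= h s.
Proof.
move=> s0 sp; rewrite -(hlf0 b); apply: (hlf_le b1) => //; apply: itvH => //.
by rewrite divr_gt0// pi_gt0.
Qed.

Lemma cmap_lt s t : H s -> H t -> s < t -> cmap t < cmap s.
Proof. by move=> sH tH st; rewrite /cmap ltrD2l ltrN2 ltr_pM2l// hlf_lt. Qed.

Lemma cmap_le s t : H s -> H t -> s <= t -> cmap t <= cmap s.
Proof. by move=> sH tH; rewrite le_eqVlt => /predU1P[->//|/(cmap_lt sH tH)/ltW]. Qed.

Lemma cmap_continuous s : H s -> {for s, continuous cmap}.
Proof.
move=> sH; apply: cvgB; first exact: cvg_cst.
by apply: cvgMl_tmp; exact: continuous_hlf.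
Qed.

(** The fixed-point equation is t + d h(t) = v, whose left side increases from - V to V on [- a, a].
    As V < pi / 2, these values determine the parameter without ambiguity modulo full turns. *)
Lemma fixed_halfangle : exists s, [/\ 0 < s < a, cmap s = s &
  forall t, H t -> `|t| < a -> expi (2 * v) = expi (2 * (t + d%:R * h t)) -> t = s].
Proof.
have ap := aa_lt b d; have a0' := a0; have v0' := v0; have vV' := vV; have Vp' := Vp.
pose E s := s + d%:R * h s.
have cE : {within `[0, a], continuous E}.
  apply: continuous_in_subspaceT => x; rewrite inE /= in_itv /= => /andP[x0 xa].
  apply: cvgD; first exact: cvg_id.
  apply: cvgMl_tmp; apply: continuous_hlf; apply: itvH => //; lra.
have E0 : E 0 = 0 by rewrite /E hlf0 mulr0 addr0.
have Ea : E a = V by [].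
have [s sI Es] : exists2 s, s \in `[0, a] & E s = v.
  by apply: (IVT (ltW a0) cE); rewrite ge_min le_max E0 Ea (ltW v0) (ltW vV) orbT.
move: sI; rewrite in_itv /= => /andP[s0 sa].
have s0' : 0 < s.
  by rewrite lt_neqAle s0 andbT; apply/eqP => e; move: v0; rewrite -Es -e E0 ltxx.
have sa' : s < a.
  by rewrite lt_neqAle sa andbT; apply/eqP => e; move: vV; rewrite -Es e Ea ltxx.
have Elt x y : H x -> H y -> x < y -> E x < E y.
  by move=> xH yH xy; rewrite /E ltrD// ltr_pM2l// hlf_lt.
exists s; split; [by rewrite s0'|by rewrite /cmap -Es /E; ring|].
move=> t tH ta ee.
have aH : H a by apply/andP; lra.
have naH : H (- a) by apply/andP; lra.
have sH : H s by apply/andP; lra.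
move: ta; rewrite ltr_norml => /andP[ta1 ta2].
have t1 : E t < V by rewrite -Ea Elt.
have t2 : - V < E t.
  by rewrite -Ea; have -> : - E a = E (- a); [rewrite /E hlfN; ring|exact: Elt].
have vE : 2 * v = 2 * E t.
  by apply: expi_inj => //; rewrite ltr_norml; apply/andP; lra.
have {}vE : E s = E t by rewrite Es; lra.
have [ts|st|//] := ltgtP t s.
  by have := Elt _ _ tH sH ts; rewrite vE ltxx.
by have := Elt _ _ sH tH st; rewrite vE ltxx.
Qed.

Variable sp : R.
Hypotheses (sp_a : 0 < sp < a) (sp_fix : cmap sp = sp).

Let s0 : 0 < sp. Proof. by case/andP: sp_a. Qed.
Let sa : sp < a. Proof. by case/andP: sp_a. Qed.
Let spv : sp <= v.
Proof.
rewrite -sp_fix /cmap gerBl mulr_ge0 ?(ltW d0)// h_ge0 ?(ltW s0)//.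
exact: lt_trans sa (aa_lt b d).
Qed.

Let Hs s : 0 <= s -> s <= v -> H s.
Proof.
by move=> s0' sv; have := Vp; have := vV; have p0 := pi_gt0 R => ? ?; apply/andP; lra.
Qed.

Let cmap_itv s : 0 <= s -> s <= sp -> sp <= cmap s <= v.
Proof.
move=> s0' ssp; apply/andP; split.
  by rewrite -[X in X <= _]sp_fix cmap_le ?Hs// ?(le_trans ssp)// ltW.
rewrite /cmap gerBl mulr_ge0 ?(ltW d0)// h_ge0//.
by apply: (le_lt_trans ssp); apply: (lt_trans sa); exact: aa_lt.
Qed.

Let cmap2_continuous s : 0 <= s -> s <= sp -> {for s, continuous (cmap \o cmap)}.
Proof.
move=> s0' ssp; have /andP[c1 c2] := cmap_itv s0' ssp.
apply: continuous_comp; apply: cmap_continuous; apply: Hs => //.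
  exact: le_trans ssp spv.
exact: le_trans (ltW s0) c1.
Qed.

(** The lower bound [2 * sp - a] keeps [cmap s], which lies beyond [sp], below [a]; thus neither
    application of [cmap] increases the distance to [sp], and the first one decreases it. *)
Lemma cmap2_near s : 0 <= s -> 2 * sp - a < s -> s < sp -> s < cmap (cmap s).
Proof.
move=> s0' s1 ssp; have /andP[c1 c2] := cmap_itv s0' (ltW ssp).
have sp0 := s0; have sa' := sa; have Na : - a <= s by lra.
have C1 : cmap s - sp < sp - s.
  have -> : cmap s - sp = d%:R * (h sp - h s) by rewrite -[in LHS]sp_fix /cmap; ring.
  by apply: (hlf_contract b1 d2 bd) => //; exact: ltW.
have C2 : sp - cmap (cmap s) <= cmap s - sp.
  have -> : sp - cmap (cmap s) = d%:R * (h (cmap s) - h sp).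
    by rewrite -[in LHS]sp_fix /cmap; ring.
  move: c1; rewrite le_eqVlt => /predU1P[<-|c1]; first by rewrite !subrr mulr0.
  by apply: ltW; apply: (hlf_contract b1 d2 bd) => //; lra.
lra.
Qed.

(* The endpoints of the immediate basin of [sp], a 2-cycle of [cmap]. *)
Lemma basin_endpoint : exists x, [/\ 0 <= x, x < sp, cmap (cmap x) = x &
  forall s, x < s -> s < sp -> s < cmap (cmap s)].
Proof.
pose A := [set s | 0 <= s < sp /\ cmap (cmap s) <= s].
(* Here the condition from lambda_0 enters: 0 is sent to v, and v to v - d h(v) <= 0. *)
have A0 : A 0.
  split; first by rewrite lexx.
  have -> : cmap 0 = v by rewrite /cmap hlf0 mulr0 subr0.
  by rewrite /cmap subr_le0.
have ubA s : A s -> s <= Num.max 0 (2 * sp - a).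
  move=> [/andP[s0' ssp] sA]; rewrite leNgt; apply/negP; rewrite gt_max => /andP[s1 s2].
  by have := cmap2_near s0' s2 ssp; rewrite ltNge sA.
have supA : has_sup A by split; [exists 0|exists (Num.max 0 (2 * sp - a)) => s /ubA].
pose x := sup A; have x0 : 0 <= x by exact: ub_le_sup supA.2 _ A0.
have xs : x < sp.
  apply: (@le_lt_trans _ _ (Num.max 0 (2 * sp - a))).
    by apply: ge_sup; [exists 0|move=> s /ubA].
  by have sa' := sa; rewrite gt_max s0 /=; lra.
have after s : x < s -> s < sp -> s < cmap (cmap s).
  move=> xs' ssp; rewrite ltNge; apply/negP => sA.
  have : s <= x by apply: (ub_le_sup supA.2); split => //; rewrite ssp andbT ltW// (le_lt_trans x0).
  by rewrite leNgt xs'.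
exists x; split => //.
have cg : {for x, continuous (fun s => (cmap \o cmap) s - s)}.
  by apply: cvgB; [exact: cmap2_continuous x0 (ltW xs)|exact: cvg_id].
(* A strict inequality would persist near x: the first contradicts [after] just above x, the second
   the points of [A] that approach the supremum. *)
have [xlt|xgt|//] := ltgtP (cmap (cmap x)) x.
- have : \forall s \near x, (cmap \o cmap) s - s < 0.
    by apply: (cvgr_lt _ cg); rewrite subr_lt0.
  move=> /nbhs_ballP[e /= e0 eP].
  pose m := Num.min (e / 2) ((sp - x) / 2).
  have m0 : 0 < m by rewrite lt_min; apply/andP; lra.
  have me : m <= e / 2 by rewrite ge_min lexx.
  have ms : m <= (sp - x) / 2 by rewrite ge_min lexx orbT.
  have : (cmap \o cmap) (x + m) - (x + m) < 0.
    apply: eP; rewrite -ball_normE /= opprD addNKr normrN gtr0_norm//; lra.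
  rewrite subr_lt0 /= ltNge => /negP[]; apply: ltW; apply: after; lra.
- have : \forall s \near x, 0 < (cmap \o cmap) s - s.
    by apply: (cvgr_gt _ cg); rewrite subr_gt0.
  move=> /nbhs_ballP[e /= e0 eP].
  have [s [sI sA] es] := sup_adherent e0 supA.
  have sx : s <= x by apply: (ub_le_sup supA.2).
  have : 0 < (cmap \o cmap) s - s.
    by apply: eP; rewrite -ball_normE /= ger0_norm ?subr_ge0//; rewrite -/x in es; lra.
  by rewrite subr_gt0 /= ltNge sA.
Qed.

Variable x : R.
Hypotheses (x0 : 0 <= x) (xs : x < sp) (xfix : cmap (cmap x) = x).
Hypothesis xP : forall s, x < s -> s < sp -> s < cmap (cmap s).

(** The iterates increase and stay below [sp]; their limit is fixed by [cmap \o cmap], and [xP]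
    leaves only [sp]. *)
Lemma cmap2_cvg s : x < s -> s < sp -> iter n (cmap \o cmap) s @[n --> \oo] --> sp.
Proof.
move=> xs' ssp; pose u n := iter n (cmap \o cmap) s.
have sxp t : x < t -> t < sp -> cmap (cmap t) < sp.
  move=> xt tsp; have t0 : 0 <= t by rewrite (le_trans x0)// ltW.
  have /andP[c1 c2] := cmap_itv t0 (ltW tsp).
  have sp0 := s0; have spv' := spv.
  have Hsp : H sp by apply: Hs => //; exact: ltW.
  have Ht : H t by apply: Hs => //; apply: (le_trans (ltW tsp)).
  have Hct : H (cmap t) by apply: Hs => //; exact: le_trans (ltW s0) c1.
  have := cmap_lt Ht Hsp tsp; rewrite sp_fix => c3.
  by have := cmap_lt Hsp Hct c3; rewrite sp_fix.
have uP n : x < u n < sp.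
  elim: n => [|n /andP[IH1 IH2]]; first by rewrite /u /= xs'.
  rewrite /u iterS -/(u n) /= sxp// andbT (lt_trans IH1)// xP//.
have ui : nondecreasing_seq u.
  apply/nondecreasing_seqP => n; have /andP[? ?] := uP n.
  by rewrite /u iterS -/(u n) /= ltW// xP.
have ub : has_ubound (range u) by exists sp => _ [n _ <-]; have /andP[_ /ltW] := uP n.
have cu : u n @[n --> \oo] --> sup (range u) by exact: nondecreasing_cvgn.
set l := sup (range u) in cu.
have sl : s <= l by apply: (ub_le_sup ub); exists 0%N.
have lsp : l <= sp.
  by apply: ge_sup; [exists (u 0%N); exists 0%N|move=> _ [n _ <-]; have /andP[_ /ltW] := uP n].
suff lE : l = sp by rewrite -lE.
move: (lsp); rewrite le_eqVlt => /predU1P[//|lsp'].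
have xl : x < l by exact: lt_le_trans sl.
have l0 : 0 <= l by rewrite (le_trans x0)// ltW.
have c2 := cmap2_continuous l0 lsp.
have cu2 : (cmap \o cmap) (u n) @[n --> \oo] --> (cmap \o cmap) l.
  exact: (@cvg_comp _ _ _ u (cmap \o cmap) _ _ _ cu c2).
have cu3 : u n.+1 @[n --> \oo] --> l by rewrite -(cvg_shiftS u) in cu.
have : (cmap \o cmap) l = l by apply: (cvg_unique _ cu2 cu3).
by move=> e; have := xP xl lsp'; rewrite -[ltRHS]/((cmap \o cmap) l) e ltxx.
Qed.

End RealDynamics.

(** * The attracting arc *)

Section Caps.
Variable R : realType.
Implicit Types (s t r x y : R) (z w : sphere R).

Lemma chord2_cpt z t : chord2 z (cpt t) = 2 * (1 - (cos t * sX z + sin t * sY z)).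
Proof.
have := stereo_norm z; rewrite /chord2 /sX /sY /sZ stereo_cpt /= => e.
have e' := cos2Dsin2 t; move: (cos t) (sin t) e' => c s' e'.
have -> : forall p q k : R, (p - c) ^+ 2 + (q - s') ^+ 2 + (k - 0) ^+ 2 =
  (p ^+ 2 + q ^+ 2 + k ^+ 2) + (c ^+ 2 + s' ^+ 2) - 2 * (c * p + s' * q).
  by move=> p q k; ring.
by rewrite e e'; ring.
Qed.

Definition cotan t : R := cos t / sin t.

(** With x kept fixed, y enters only through the cotangent. Moving one endpoint thus changes [capI]
    by a multiple of the squared chord to the other, which [capI_nested] exploits at each end in
    turn. *)
Lemma capIEl x y z : sin (y - x) != 0 ->
  capI x y z = cos (2 * x) * sY z - sin (2 * x) * sX z -
    chord2 z (cpt (2 * x)) / 2 * cotan (y - x).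
Proof.
move=> s0; rewrite chord2_cpt /capI /capL /cotan.
have -> : x + y = 2 * x + (y - x) by ring.
by move: (y - x) s0 => a s0; rewrite cosD sinD; field; rewrite s0.
Qed.

Lemma capIEr x y z : sin (y - x) != 0 ->
  capI x y z = sin (2 * y) * sX z - cos (2 * y) * sY z -
    chord2 z (cpt (2 * y)) / 2 * cotan (y - x).
Proof.
move=> s0; rewrite chord2_cpt /capI /capL /cotan.
have -> : x + y = 2 * y - (y - x) by ring.
by move: (y - x) s0 => a s0; rewrite cosB sinB; field; rewrite s0.
Qed.

Lemma cotan_lt s t : 0 < s -> s < t -> t < pi -> cotan t < cotan s.
Proof.
move=> s0 st tp; have sS : 0 < sin s by apply: sin_gt0_pi; apply/andP; lra.
have sT : 0 < sin t by apply: sin_gt0_pi; apply/andP; lra.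
rewrite -subr_gt0 /cotan.
have -> : cos s / sin s - cos t / sin t = sin (t - s) / (sin s * sin t).
  by rewrite sinB; field; rewrite !gt_eqF.
by rewrite divr_gt0 ?mulr_gt0//; apply: sin_gt0_pi; apply/andP; lra.
Qed.

(* Enlarging the arc increases [capI], strictly and uniformly so when both
   endpoints move. *)
Lemma capI_nested x y x' y' : x < x' -> x' < y' -> y' < y -> y - x < pi ->
  (forall z, capI x' y' z <= capI x y z) /\
  exists2 e, 0 < e & forall z, capI x' y' z + e <= capI x y z.
Proof.
move=> xx xy yy yx.
have sn s : 0 < s -> s < pi -> sin s != 0.
  by move=> ? ?; rewrite gt_eqF// sin_gt0_pi//; apply/andP.
pose c1 := cotan (y' - x) - cotan (y - x).
pose c2 := cotan (y' - x') - cotan (y' - x).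
have c10 : 0 < c1 by rewrite subr_gt0; apply: cotan_lt; lra.
have c20 : 0 < c2 by rewrite subr_gt0; apply: cotan_lt; lra.
have E z : capI x y z = capI x' y' z + chord2 z (cpt (2 * x)) / 2 * c1 +
    chord2 z (cpt (2 * y')) / 2 * c2.
  have e1 : capI x y z = capI x y' z + chord2 z (cpt (2 * x)) / 2 * c1.
    by rewrite !capIEl /c1; [ring|apply: sn; lra..].
  have e2 : capI x y' z = capI x' y' z + chord2 z (cpt (2 * y')) / 2 * c2.
    by rewrite !capIEr /c2; [ring|apply: sn; lra..].
  by rewrite e1 e2; ring.
pose D := chord2 (cpt (2 * x)) (cpt (2 * y')).
have D0 : 0 < D.
  rewrite lt_def chord2_ge0 andbT; apply/eqP => /chord2_eq0[e1 e2].
  have : 2 * x = 2 * y'.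
    apply: expi_inj; first by rewrite /expi e1 e2.
    by have p0 := pi_gt0 R; rewrite ltr_norml; apply/andP; lra.
  lra.
pose m := Num.min c1 c2; have m0 : 0 < m by rewrite lt_min c10.
(* No z is close to both points, since their squared chord is [D]; this makes the gap uniform. *)
have key z : m * D / 4 <= chord2 z (cpt (2 * x)) / 2 * c1 + chord2 z (cpt (2 * y')) / 2 * c2.
  have t := chord2_triangle (cpt (2 * x)) z (cpt (2 * y')).
  have g1 := chord2_ge0 z (cpt (2 * x)); have g2 := chord2_ge0 z (cpt (2 * y')).
  apply: (@le_trans _ _ ((chord2 z (cpt (2 * x)) + chord2 z (cpt (2 * y'))) / 2 * m)).
    by rewrite (chord2C _ z) -/D in t; rewrite mulrC mulrA; rewrite -subr_ge0; nra.
  have m1 : m <= c1 by rewrite ge_min lexx.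
  have m2 : m <= c2 by rewrite ge_min lexx orbT.
  have : chord2 z (cpt (2 * x)) / 2 * m <= chord2 z (cpt (2 * x)) / 2 * c1.
    by rewrite ler_wpM2l// divr_ge0.
  have : chord2 z (cpt (2 * y')) / 2 * m <= chord2 z (cpt (2 * y')) / 2 * c2.
    by rewrite ler_wpM2l// divr_ge0.
  lra.
have e0 : 0 < m * D / 4 by rewrite divr_gt0// mulr_gt0.
split=> [z|]; first by rewrite E -addrA lerDl (le_trans (ltW e0)).
by exists (m * D / 4) => // z; rewrite [leRHS]E -addrA lerD2l.
Qed.

Lemma capI_cpt x y r :
  capI x y (cpt (2 * r)) = (cos (2 * r - (x + y)) - cos (y - x)) / sin (y - x).
Proof. exact: capL_cpt. Qed.

Lemma capI_cpt_gt0 x y r : 0 < y - x < pi -> `|2 * r - (x + y)| <= pi ->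
  (0 < capI x y (cpt (2 * r))) = (`|2 * r - (x + y)| < y - x).
Proof.
move=> /andP[yx0 yxp] rp; have s0 : 0 < sin (y - x) by apply: sin_gt0_pi; apply/andP.
rewrite capI_cpt pmulr_lgt0 ?invr_gt0// subr_gt0 -[cos (2 * r - _)]cos_norm.
by rewrite ltr_cos// in_itv /= ?normr_ge0//; apply/andP; lra.
Qed.

Lemma circle_angle z g : sZ z = 0 -> exists2 t, z = cpt (g + t) & `|t| <= pi.
Proof.
move=> /sphere_circleE [w /eqP]; rewrite sqn_norm => /eqP w1 ->.
have w2 : sqn (w * expi (- g)) = 1 by rewrite sqnM w1 sqn_expi mulr1.
exists (circle_arg (w * expi (- g))).
  rewrite /cpt expiD expi_circle_arg// mulrCA -expiD subrr expi0 mulr1 //.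
by have /andP[? ?] := circle_arg_itv w2; rewrite ler_norml; apply/andP; lra.
Qed.

Lemma capI_bound x y : exists C, forall z, capI x y z <= C.
Proof.
exists (3 / `|sin (y - x)|) => z; rewrite /capI /capL.
apply: (le_trans (ler_norm _)); rewrite normrM normfV ler_wpM2r ?invr_ge0//.
have k (c p : R) : `|c| <= 1 -> `|p| <= 1 -> `|c * p| <= 1.
  by move=> c1 p1; rewrite normrM mulr_ile1.
have n := stereo_norm z; rewrite -/(sX z) -/(sY z) -/(sZ z) in n.
have sq p : p ^+ 2 <= 1 -> `|p| <= 1 :> R.
  by move=> p1; rewrite -sqrtr_sqr -sqrtr1 ler_sqrt.
have h1 : `|sX z| <= 1 by apply: sq; have := sqr_ge0 (sY z); have := sqr_ge0 (sZ z); lra.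
have h2 : `|sY z| <= 1 by apply: sq; have := sqr_ge0 (sX z); have := sqr_ge0 (sZ z); lra.
have k1 := k _ _ (cos_max (x + y)) h1; have k2 := k _ _ (sin_max (x + y)) h2.
have k3 := cos_max (y - x).
apply: (le_trans (ler_normB _ _)).
have := ler_normD (cos (x + y) * sX z) (sin (x + y) * sY z); lra.
Qed.

Lemma uniform_chord2 (K : set (sphere R)) (u : nat -> sphere R -> sphere R) h :
  {uniform K, u n @[n --> \oo] --> h} -> forall e : R, 0 < e ->
  \forall n \near \oo, forall z, K z -> chord2 (h z) (u n z) < e.
Proof.
move=> uh e e0; pose r := Num.sqrt (e / 4).
have r0 : 0 < r by rewrite sqrtr_gt0; lra.
have E : nbhs (h : {uniform` K -> sphere R}) [set g | forall z, K z -> ball (h z) r (g z)].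
  apply/uniform_nbhs; exists [set p | ball p.1 r p.2]; split => //.
  by rewrite -entourage_ballE; exists r.
have uE : \forall n \near \oo, forall z, K z -> ball (h z) r (u n z) by exact: (uh _ E).
apply: filterS uE => n un z Kz.
apply: (le_lt_trans (ball_chord2 (un z Kz))).
by rewrite sqr_sqrtr; lra.
Qed.

(* A point fixed by all [u n] is not in the Fatou set if it is accessible by
   a path along which the [u n] converge to another point. *)
Lemma path_notin_Fatou (G : set (sphere R -> sphere R))
    (u : nat -> sphere R -> sphere R) (c : R -> sphere R) (e p : sphere R) :
  (forall n, G (u n)) -> c 0 = e -> (forall n, u n e = e) -> p <> e ->
  {within `[0, 1], continuous c} ->
  (forall n, {within `[0, 1], continuous (u n \o c)}) ->
  (forall t, 0 < t <= 1 -> forall r : R, 0 < r ->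
     \forall n \near \oo, chord2 (u n (c t)) p < r) ->
  ~ Fatou G e.
Proof.
move=> uG c0 ue pe cc cu up [U [oU Ue nU]].
have D0 : 0 < chord2 e p.
  by rewrite lt_def chord2_ge0 andbT; apply/eqP => /chord2_eq0 /esym.
have [phi [phiS [h hK]]] := nU u uG.
have nb (k : R -> sphere R) (O : set (sphere R)) : {within `[0, 1], continuous k} ->
    nbhs (k 0) O -> exists2 t, 0 < t <= 1 & forall r, 0 <= r <= t -> O (k r).
  move=> ck kO; have I0 : `[0, 1]%classic (0 : R) by rewrite /= in_itv /= lexx ler01.
  have : \forall r \near within `[0, 1] (nbhs (0 : R)), O (k r).
    by move/subspace_continuousP: ck => /(_ 0 I0); apply.
  move=> /nbhs_ballP[r /= r0 rO]; exists (Num.min (r / 2) 1).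
    by rewrite lt_min ge_min lexx orbT andbT; apply/andP; lra.
  move=> q /andP[q0]; rewrite le_min => /andP[qr q1]; apply: rO.
    by rewrite -ball_normE /= sub0r normrN ger0_norm//; lra.
  by rewrite /= in_itv /= q0.
have [t /andP[t0 t1] tU] : exists2 t, 0 < t <= 1 & forall r, 0 <= r <= t -> U (c r).
  by apply: nb => //; rewrite c0; exact: open_nbhs_nbhs.
pose K := c @` `[0, t].
have sub : `[0, t] `<=` `[0, 1].
  by move=> r; rewrite /= !in_itv /= => /andP[-> rt]; exact: le_trans t1.
have cK : compact K.
  apply: continuous_compact; last exact: segment_compact.
  exact: continuous_subspaceW sub cc.
have KU : K `<=` U.
  by move=> _ [r /= rt <-]; apply: tU; move: rt; rewrite in_itv.
(* Four short chords will join [e] to [p]. Three uses of [chord2_triangle] give them the weights 2,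
   4, 8 and 8, of sum 22 < 32. *)
have e0 : 0 < chord2 e p / 32 by rewrite divr_gt0.
have uni := uniform_chord2 (hK K cK KU) e0.
have [n _ /(_ n (leqnn n)) un] := uni.
have [r /andP[r0 r1] rn] : exists2 r, 0 < r <= 1 & forall q, 0 <= q <= r ->
    [set w | chord2 e w < chord2 e p / 32] ((u (phi n) \o c) q).
  by apply: nb => //=; rewrite c0 ue; exact: near_chord2.
pose q := Num.min r t; have q0 : 0 < q by rewrite lt_min r0.
have qr : q <= r by rewrite ge_min lexx.
have qt : q <= t by rewrite ge_min lexx orbT.
have q1 : 0 < q <= 1 by rewrite q0 (le_trans qt).
have Kq : K (c q) by exists q => //=; rewrite in_itv /= (ltW q0) qt.
have phin k : (k <= phi k)%N.
  by elim: k => // k IHk; exact: leq_ltn_trans (phiS k).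
have [N _ NP] := up q q1 _ e0; have [M _ MP] := uni.
pose m := maxn N M.
have h1 : chord2 (u (phi m) (c q)) p < chord2 e p / 32.
  by apply: NP; rewrite /= (leq_trans (leq_maxl N M))// phin.
have h2 : chord2 (h (c q)) (u (phi m) (c q)) < chord2 e p / 32.
  by apply: MP => //=; exact: leq_maxr.
have h3 : chord2 (h (c q)) (u (phi n) (c q)) < chord2 e p / 32 by exact: un.
have h4 : chord2 e (u (phi n) (c q)) < chord2 e p / 32.
  by apply: rn; rewrite (ltW q0).
rewrite (chord2C (h _) (u (phi n) _)) in h3.
have T1 := chord2_triangle e (u (phi n) (c q)) p.
have T2 := chord2_triangle (u (phi n) (c q)) (h (c q)) p.
have T3 := chord2_triangle (h (c q)) (u (phi m) (c q)) p.
by clear -D0 h1 h2 h3 h4 T1 T2 T3; lra.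
Qed.

End Caps.

(** * The cap over the immediate basin and its trace on the circle *)

Section Basin.
Variable R : realType.
Variables (b : R) (d : nat).
Hypotheses (b1 : 1 < b) (d2 : (2 <= d)%N) (bd : d%:R * kap b < 1).
Implicit Types (s t r : R) (z w : sphere R).

Local Notation h := (hlf b).
Local Notation a := (aa b d).
Local Notation V := (vv1 b d).
Let H s := - (pi / 2) < s < pi / 2.

Variable v : R.
Hypotheses (v0 : 0 < v) (vV : v < V) (Vp : V < pi / 2).
Local Notation phi := (cmap b d v).
Local Notation lam := (expi (2 * v)).
Local Notation f := (fpow b d lam).

Variables (sp x : R).
Hypotheses (sp_a : 0 < sp < a) (sp_fix : phi sp = sp).
Hypothesis sp_uniq : forall t, H t -> `|t| < a ->
  lam = expi (2 * (t + d%:R * h t)) -> t = sp.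
Hypotheses (x0 : 0 <= x) (xs : x < sp) (xfix : phi (phi x) = x).
Hypothesis xP : forall s, x < s -> s < sp -> s < phi (phi s).
Local Notation y := (phi x).
Local Notation P := (cpt (2 * sp)).

Let d0 : 0 < d%:R :> R. Proof. by rewrite ltr0n (ltnW d2). Qed.

Let Hs s : 0 <= s -> s <= v -> H s.
Proof.
have := vV; have := Vp; have p0 := pi_gt0 R => ? ? ? ?; apply/andP; lra.
Qed.

Lemma endpoint_le : y <= v.
Proof.
rewrite /cmap gerBl mulr_ge0 ?(ltW d0)// h_ge0//.
apply: (lt_trans xs); case/andP: sp_a => _ spa; apply: (lt_trans spa); exact: aa_lt.
Qed.

Lemma fixed_le : sp <= v.
Proof.
rewrite -sp_fix /cmap gerBl mulr_ge0 ?(ltW d0)// h_ge0//.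
  by case/andP: sp_a => /ltW.
by case/andP: sp_a => _ spa; apply: (lt_trans spa); exact: aa_lt.
Qed.

Lemma fixed_lt_endpoint : sp < y.
Proof.
rewrite -[ltLHS]sp_fix; apply: cmap_lt => //; apply: Hs => //.
- by apply: (le_trans (ltW xs)); exact: fixed_le.
- by case/andP: sp_a => /ltW.
- exact: fixed_le.
Qed.

Lemma basin_H s : x <= s -> s <= y -> H s.
Proof.
move=> xs' sy; apply: Hs; first exact: le_trans xs'.
exact: le_trans endpoint_le.
Qed.

Lemma basin_inv s : x <= s -> s <= y -> x <= phi s <= y.
Proof.
move=> xs' sy; have sH := basin_H xs' sy.
have xy : x <= y by rewrite ltW// (lt_trans xs fixed_lt_endpoint).
have xH := basin_H (lexx x) xy; have yH := basin_H xy (lexx y).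
apply/andP; split; last exact: cmap_le.
by rewrite -[leLHS]xfix; exact: cmap_le.
Qed.

Lemma basin_inv2 n s : x <= s -> s <= y -> x <= iter n (phi \o phi) s <= y.
Proof.
move=> xs' sy; elim: n => [|n /andP[IH1 IH2]]; first by rewrite /= xs'.
rewrite iterS /=; have /andP[? ?] := basin_inv IH1 IH2; exact: basin_inv.
Qed.

Lemma f_cpt s : H s -> f (cpt (2 * s)) = cpt (2 * phi s).
Proof. exact: fpow_cpt. Qed.

Lemma iter_f_cpt n s : x <= s -> s <= y ->
  iter n (f \o f) (cpt (2 * s)) = cpt (2 * iter n (phi \o phi) s).
Proof.
move=> xs' sy; elim: n => // n IHn; rewrite !iterS IHn.
rewrite -[LHS]/(f (f (cpt (2 * iter n (phi \o phi) s)))).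
have /andP[i1 i2] := basin_inv2 n xs' sy; rewrite f_cpt; last exact: basin_H.
by rewrite f_cpt//; have /andP[? ?] := basin_inv i1 i2; exact: basin_H.
Qed.

Lemma iter_cmap_continuous n s : x <= s -> s <= y ->
  {for s, continuous (iter n (phi \o phi))}.
Proof.
move=> xs' sy; elim: n => [|n IHn]; first exact: cvg_id.
have /andP[i1 i2] := basin_inv2 n xs' sy.
have /andP[j1 j2] := basin_inv i1 i2.
have c : {for iter n (phi \o phi) s, continuous (phi \o phi)}.
  by apply: continuous_comp; apply: cmap_continuous; exact: basin_H.
exact: (@continuous_comp _ _ _ (iter n (phi \o phi)) (phi \o phi) s IHn c).
Qed.

Local Notation G := (generated_semigroup [set f]).

Lemma iter2_generated n : G (iter n.+1 (f \o f)).
Proof.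
have g : G (f \o f) by apply: generated_comp; exact: generated_gen.
elim: n => [|n IHn] //; exact: (generated_comp g IHn).
Qed.

Lemma width_lt : 0 < y - x < pi.
Proof.
have := fixed_lt_endpoint; have := xs; have := endpoint_le; have := vV; have := Vp.
have := x0; have p0 := pi_gt0 R => ? ? ? ? ? ?; apply/andP; lra.
Qed.

Lemma f_contracts : contracts (capI x y) (capI x y) f.
Proof.
have xy : x < y by rewrite (lt_trans xs fixed_lt_endpoint).
have /andP[xH _] := basin_H (lexx x) (ltW xy).
have /andP[_ yH] := basin_H (ltW xy) (lexx y).
(* As [phi] exchanges x and y, the image arc is the arc itself, of the same width. *)
have e : y - x = d%:R * (h y - h x) by rewrite -[in X in _ - X = _]xfix /cmap; ring.
have := @fpow_contracts_capI R b d v x y b1 (ltnW d2) xH xy yH.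
rewrite -[(h y - h x) *+ d]mulr_natl -e -[h y *+ d]mulr_natl -[h x *+ d]mulr_natl.
have /andP[_ yxp] := width_lt.
rewrite -[v - d%:R * h y]/(phi y) -[v - d%:R * h x]/(phi x) xfix; exact.
Qed.

Lemma generated_contracts g : G g -> contracts (capI x y) (capI x y) g.
Proof.
elim=> [_ ->|g1 g2 _ c1 _ c2]; first exact: f_contracts.
exact: contracts_comp c2 c1.
Qed.

Lemma cap_Fatou : [set z | 0 < capI x y z] `<=` Fatou G.
Proof.
have [C LC] := capI_bound x y.
apply: (@positive_Fatou _ _ C); first exact: capL_continuous.
by move=> g /generated_contracts cg; exists (capI x y).
Qed.

Lemma P_neq s : H s -> s != sp -> P <> cpt (2 * s).
Proof.
move=> sH sne [e1 e2]; move/eqP: sne; apply.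
have /andP[? ?] := sH; have /andP[? ?] : H sp.
  by apply: Hs; [case/andP: sp_a => /ltW|exact: fixed_le].
have : 2 * s = 2 * sp.
  by apply: expi_inj; rewrite /expi ?e1 ?e2// ltr_norml; apply/andP; lra.
lra.
Qed.

Lemma cpt_cvg (u : nat -> R) s r : u n @[n --> \oo] --> s -> 0 < r ->
  \forall n \near \oo, chord2 (cpt (2 * u n)) (cpt (2 * s)) < r.
Proof.
move=> us r0; have c : cpt (2 * u n) @[n --> \oo] --> cpt (2 * s).
  apply: (@cvg_comp _ _ _ (fun n => 2 * u n) (@cpt R)); last exact: cpt_continuous.
  exact: cvgMl_tmp.
have nc : \forall n \near \oo, chord2 (cpt (2 * s)) (cpt (2 * u n)) < r.
  exact: (c _ (near_chord2 (cpt (2 * s)) r0)).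
by apply: filterS nc => n; rewrite chord2C.
Qed.

(* Points on the path are [s = x + r * (sp - x) / 2] with [r] in [0, 1]. *)
Lemma endpoint_notin_Fatou (k : R -> R) (e : R) : k x = e ->
  iter 1 (phi \o phi) e = e -> x <= e <= y -> e != sp ->
  (forall s, x <= s -> s < sp -> x <= k s <= y) ->
  (forall s, x <= s -> s < sp -> {for s, continuous k}) ->
  (forall s, x < s -> s < sp -> iter n (phi \o phi) (k s) @[n --> \oo] --> sp) ->
  ~ Fatou G (cpt (2 * e)).
Proof.
move=> ke efix /andP[xe ey] esp ki kc kcvg.
pose m r := x + r * ((sp - x) / 2); have xs' := xs.
have m0 : m 0 = x by rewrite /m mul0r addr0.
have mi r : 0 <= r <= 1 -> x <= m r < sp.
  move=> /andP[r0 r1]; rewrite /m.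
  have : 0 <= r * ((sp - x) / 2) <= (sp - x) / 2.
    by rewrite mulr_ge0//= ?ler_piMl//; lra.
  by move=> /andP[? ?]; apply/andP; lra.
have mc : continuous m.
  move=> r; apply: cvgD; first exact: cvg_cst.
  by apply: cvgMr_tmp; exact: cvg_id.
have I01 r : `[0, 1]%classic r -> 0 <= r <= 1 by rewrite /= in_itv.
have ckm n r : 0 <= r <= 1 ->
    {for r, continuous (fun r => cpt (2 * iter n (phi \o phi) (k (m r))))}.
  move=> /mi /andP[m1 m2]; have /andP[k1 k2] := ki _ m1 m2.
  apply: (@continuous_comp _ _ _ (fun r => 2 * iter n (phi \o phi) (k (m r))) (@cpt R)).
    apply: cvgMl_tmp.
    apply: (@continuous_comp _ _ _ (fun r => k (m r)) (iter n (phi \o phi))).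
      apply: (@continuous_comp _ _ _ m k); first exact: mc.
      exact: kc.
    exact: iter_cmap_continuous.
  exact: cpt_continuous.
(* The exponent starts at 1 because the generated semigroup need not contain the identity. *)
apply: (@path_notin_Fatou R G (fun n => iter n.+1 (f \o f))
  (fun r => cpt (2 * k (m r))) (cpt (2 * e)) P).
- exact: iter2_generated.
- by rewrite m0 ke.
- move=> n; rewrite iter_f_cpt//; congr (cpt (2 * _)).
  by elim: n => // n IHn; rewrite iterS IHn.
- by apply: P_neq => //; exact: basin_H.
- apply: continuous_in_subspaceT => r /set_mem/I01 r01; exact: (ckm 0%N).
- move=> n; apply: (@subspace_eq_continuous _ _ _
    (fun r => cpt (2 * iter n.+1 (phi \o phi) (k (m r))))).
    move=> r /set_mem/I01/mi/andP[m1 m2]; have /andP[k1 k2] := ki _ m1 m2.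
    by rewrite -iter_f_cpt.
  by apply: continuous_in_subspaceT => r /set_mem/I01 r01; exact: ckm.
- move=> t /andP[t0 t1] r r0.
  have /mi/andP[m1 m2] : 0 <= t <= 1 by rewrite ltW.
  have m1' : x < m t by rewrite /m ltrDl mulr_gt0// divr_gt0// subr_gt0.
  have /andP[k1 k2] := ki _ m1 m2.
  have cv : iter n.+1 (phi \o phi) (k (m t)) @[n --> \oo] --> sp.
    by have := kcvg _ m1' m2; rewrite -(cvg_shiftS (fun n => iter n (phi \o phi) (k (m t)))).
  by apply: filterS (cpt_cvg cv r0) => n; rewrite iter_f_cpt.
Qed.

Lemma left_notin_Fatou : ~ Fatou G (cpt (2 * x)).
Proof.
have xy : x < y by rewrite (lt_trans xs fixed_lt_endpoint).
apply: (@endpoint_notin_Fatou id x) => //.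
- by rewrite lexx ltW.
- by rewrite lt_eqF.
- by move=> s xs' /ltW ssp; rewrite xs' (le_trans ssp)// ltW// fixed_lt_endpoint.
- by move=> s _ _; exact: cvg_id.
- move=> s xs' ssp.
  exact: (cmap2_cvg b1 d2 vV Vp sp_a sp_fix x0 xP xs' ssp).
Qed.

Lemma right_notin_Fatou : ~ Fatou G (cpt (2 * y)).
Proof.
have xy : x < y by rewrite (lt_trans xs fixed_lt_endpoint).
have sy s : s < sp -> s <= y by move=> /ltW ssp; rewrite (le_trans ssp)// ltW// fixed_lt_endpoint.
have spH : H sp by apply: basin_H; rewrite ltW// fixed_lt_endpoint.
apply: (@endpoint_notin_Fatou phi y) => //.
- by rewrite /= xfix.
- by rewrite lexx ltW.
- by rewrite gt_eqF// fixed_lt_endpoint.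
- by move=> s xs' /sy; exact: basin_inv.
- by move=> s xs' /sy sy'; apply: cmap_continuous; exact: basin_H.
- move=> s xs' ssp.
  have cv := cmap2_cvg b1 d2 vV Vp sp_a sp_fix x0 xP xs' ssp.
  have e n : iter n (phi \o phi) (phi s) = phi (iter n (phi \o phi) s).
    by elim: n => // n IHn; rewrite !iterS IHn.
  under eq_cvg do rewrite e.
  have cv2 : phi (iter n (phi \o phi) s) @[n --> \oo] --> phi sp.
    exact: (@cvg_comp _ _ _ (fun n => iter n (phi \o phi) s) phi _ _ _ cv (cmap_continuous spH)).
  by rewrite sp_fix in cv2.
Qed.

Lemma cap_circle z : sZ z = 0 -> 0 < capI x y z ->
  exists2 s, x < s < y & z = cpt (2 * s).
Proof.
move=> z0; have [t -> tp] := circle_angle (x + y) z0.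
have -> : x + y + t = 2 * ((x + y + t) / 2) by field.
rewrite capI_cpt_gt0 ?width_lt//; last first.
  by rewrite (_ : _ - _ = t)//; field.
have -> : 2 * ((x + y + t) / 2) - (x + y) = t by field.
rewrite ltr_norml => /andP[t1 t2]; exists ((x + y + t) / 2) => //.
by apply/andP; lra.
Qed.

Lemma cap_cpt s : x < s < y -> 0 < capI x y (cpt (2 * s)).
Proof.
move=> /andP[xs' sy]; have /andP[w0 wp] := width_lt.
rewrite capI_cpt_gt0 ?width_lt//; first by rewrite ltr_norml; apply/andP; lra.
by rewrite ler_norml; apply/andP; lra.
Qed.

Lemma cap_circle0 z : sZ z = 0 -> capI x y z = 0 ->
  z = cpt (2 * x) \/ z = cpt (2 * y).
Proof.
move=> z0; have [t -> tp] := circle_angle (x + y) z0; have /andP[w0 wp] := width_lt.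
rewrite [capI _ _ _]capL_cpt [x + y + t]addrC addrK => /eqP.
have s0 : 0 < sin (y - x) by apply: sin_gt0_pi; apply/andP.
rewrite mulf_eq0 invr_eq0 (gt_eqF s0) orbF.
rewrite subr_eq0 -(cos_norm t) => /eqP/cos_inj.
rewrite !in_itv /= normr_ge0 tp (ltW w0) (ltW wp) => /(_ isT isT).
case: (ger0P t) => _ e; [right|left]; congr cpt.
  by rewrite e; ring.
by move: e; move: y => q e; lra.
Qed.

(** On the circle [capI x y] vanishes only at the two endpoints, which are not in the Fatou set, so
    the connected component cannot leave the cap. Conversely the open arc is connected, lies in the
    Fatou set and contains the fixed point. *)
Lemma attr_arcE z : attr_arc d b lam z <-> sZ z = 0 /\ 0 < capI x y z.
Proof.
have l1 : sqn lam = 1 by exact: sqn_expi.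
have spH : H sp by apply: basin_H; rewrite ltW// fixed_lt_endpoint.
have capP : 0 < capI x y P by apply: cap_cpt; rewrite xs fixed_lt_endpoint.
have attrE p : attracting_fixed_point f p <-> p = P.
  split=> [[fp]|->].
    rewrite norm_lt1 => D1.
    have [s [ps sH]] := fixed_point_angle b1 d2 l1 fp (ltW D1).
    move: D1 => /[swap] -> D1 lE; rewrite ps; congr (cpt (2 * _)); apply: sp_uniq => //.
    have D0 := mulr_ge0 (ltW d0) (dhlf_ge0 b1 s).
    by apply: dhlf_lt1 => //; rewrite -(@ltr_pXn2r _ 2) ?nnegrE// expr1n.
  split; first by rewrite f_cpt// sp_fix.
  have D0 := mulr_ge0 (ltW d0) (dhlf_ge0 b1 sp).
  rewrite norm_lt1 sqn_deriv_cpt// expr_lt1//.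
  apply: dhlf_lt => //; case/andP: sp_a => s0 s1.
  by rewrite gtr0_norm.
pose A := Fatou G `&` @sphere_circle R.
have AP : A P.
  by split; [exact: cap_Fatou|apply/sphere_circleE; exact: sZ_cpt].
rewrite /attr_arc; split.
  move=> [p /attrE -> Cz].
  have Az : A z := @connected_component_sub _ A P z Cz.
  split; first by apply/sphere_circleE; exact: Az.2.
  have cC : connected (capI x y @` connected_component A P).
    apply: connected_continuous_connected; first exact: component_connected.
    apply: continuous_subspaceT; exact: capL_continuous.
  rewrite ltNge; apply/negP => z0.
  have /connected_intervalP iC := cC.
  have [w Cw w0] : (capI x y @` connected_component A P) 0.
    apply: (iC (capI x y z) (capI x y P)).
    - by exists z.
    - by exists P => //; exact: connected_component_refl.
    - by rewrite z0 ltW.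
  have [wF wS] : A w := @connected_component_sub _ A P w Cw.
  have wZ : sZ w = 0 by apply/sphere_circleE.
  have [e|e] := cap_circle0 wZ w0.
    by apply: left_notin_Fatou; rewrite -e.
  by apply: right_notin_Fatou; rewrite -e.
move=> [z0 zL]; exists P; first exact/attrE.
pose B := (fun s => cpt (2 * s)) @` `]x, y[.
have [s sxy ->] := cap_circle z0 zL.
have BP : B P by exists sp => //=; rewrite in_itv /= xs fixed_lt_endpoint.
have BA : B `<=` A.
  move=> _ [t /= txy <-]; split; last by apply/sphere_circleE; exact: sZ_cpt.
  by apply: cap_Fatou; apply: cap_cpt; rewrite in_itv /= in txy.
have cB : connected B.
  apply: connected_continuous_connected.
    by apply/connected_intervalP; exact: interval_is_interval.
  apply: continuous_subspaceT => t.
  apply: (@continuous_comp _ _ _ (fun s => 2 * s) (@cpt R)).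
    by apply: cvgMl_tmp; exact: cvg_id.
  exact: cpt_continuous.
by apply: (connected_component_max BP BA cB); exists s => //=; rewrite in_itv.
Qed.

End Basin.

(** * Invariant sets of the semigroup *)

Section Trap.
Variable R : realType.
Implicit Types (z w xi eta : sphere R) (g : sphere R -> sphere R).

(* [g] does not increase the hyperbolic distance on either side of the circle
   (each side being mapped into one of the two sides). *)
Definition zcontracts g := forall z w, 0 < sZ z * sZ w ->
  0 < sZ (g z) * sZ (g w) /\
  chord2 (g z) (g w) * (sZ z * sZ w) <= chord2 z w * (sZ (g z) * sZ (g w)).

Lemma zcontracts_comp f g : zcontracts f -> zcontracts g -> zcontracts (g \o f).
Proof.
move=> cf cg z w zw; have [fzw cfzw] := cf _ _ zw; have [gzw cgzw] := cg _ _ fzw.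
split => //=; rewrite -(ler_pM2r fzw); apply: (@le_trans _ _
  (chord2 (f z) (f w) * (sZ (g (f z)) * sZ (g (f w))) * (sZ z * sZ w))).
  by rewrite mulrAC ler_pM2r.
by rewrite mulrAC (mulrAC (chord2 z w)) ler_pM2r.
Qed.

Lemma fpow_zcontracts (b : R) k lam : 1 < b -> (0 < k)%N -> sqn lam = 1 ->
  zcontracts (fpow b k lam).
Proof.
move=> b1 k0 l1 z w zw; have [z0|z0|z0] := ltgtP 0 (sZ z); last first.
- by move: zw; rewrite -z0 mul0r ltxx.
- have w0 : sZ w < 0 by rewrite -(nmulr_rgt0 _ z0).
  have zN : 0 < (\- @sZ R) z by rewrite /= oppr_gt0.
  have wN : 0 < (\- @sZ R) w by rewrite /= oppr_gt0.
  have [fz c] := fpow_contracts_sZN b1 k0 l1 zN wN.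
  have [fw _] := fpow_contracts_sZN b1 k0 l1 wN zN.
  by rewrite mulr_gt0//; split => //; move: c; rewrite /= mulrNN.
- have w0 : 0 < sZ w by rewrite -(pmulr_rgt0 _ z0).
  have [fz c] := fpow_contracts_sZ b1 k0 l1 z0 w0.
  have [fw _] := fpow_contracts_sZ b1 k0 l1 w0 z0.
  move: fz fw c; rewrite /= !oppr_gt0 mulrNN => fz fw c; split => //.
  by rewrite nmulr_rgt0.
Qed.

Variables (L : sphere R -> R) (P : sphere R).
Hypotheses (cL : continuous L) (LP : 0 < L P).

(* A hyperbolic disc of the cap [0 < L] around [P]. *)
Definition hdisc C eta := chord2 eta P <= C * L eta.

(* The points within bounded hyperbolic distance, in their side of the circle,
   of the hyperbolic disc. *)
Definition trap C C' xi := exists eta, [/\ hdisc C eta, 0 < sZ xi * sZ eta &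
  chord2 xi eta <= C' * (sZ xi * sZ eta)].

Lemma hdisc_gt0 C eta : 0 < C -> hdisc C eta -> 0 < L eta.
Proof.
move=> C0 hC; have : 0 <= C * L eta by rewrite (le_trans _ hC)// chord2_ge0.
rewrite pmulr_rge0// le_eqVlt => /predU1P[e|//].
move: hC; rewrite /hdisc -e mulr0 => h0.
have /chord2_eq0 eP : chord2 eta P = 0 by apply: le_anti; rewrite h0 chord2_ge0.
by move: LP; rewrite -eP -e ltxx.
Qed.

(** Contraction applied to the pair [eta], [P]: the factor [L P] cancels. *)
Lemma hdisc_fixed C g eta : 0 < C -> contracts L L g -> g P = P ->
  hdisc C eta -> hdisc C (g eta).
Proof.
move=> C0 cg gP hC; have L0 := hdisc_gt0 C0 hC; have [g0] := cg _ _ L0 LP.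
rewrite gP /hdisc => c; rewrite -(ler_pM2r (mulr_gt0 L0 LP)).
apply: (le_trans c); have -> : C * L (g eta) * (L eta * L P) =
  C * L eta * (L (g eta) * L P) by ring.
by rewrite ler_pM2r// mulr_gt0.
Qed.

Lemma trap_inv C C' g : 0 <= C' -> zcontracts g ->
  (forall eta, hdisc C eta -> hdisc C (g eta)) ->
  forall xi, trap C C' xi -> trap C C' (g xi).
Proof.
move=> C'0 cg gC xi [eta [hC s c]]; have [gs gc] := cg _ _ s.
exists (g eta); split => //; first exact: gC.
rewrite -(ler_pM2r s); apply: (le_trans gc).
have -> : C' * (sZ (g xi) * sZ (g eta)) * (sZ xi * sZ eta) =
  C' * (sZ xi * sZ eta) * (sZ (g xi) * sZ (g eta)) by ring.
by rewrite ler_pM2r.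
Qed.

(** Near the circle [sZ xi] is small, so the companion [eta] of [xi] in [trap] is close to [xi].
    Hence [zeta] is a limit of points of the hyperbolic disc, which is defined by a closed condition
    and lies in the cap. *)
Lemma closure_trap C C' zeta : 0 < C -> 0 < C' ->
  closure [set xi | trap C C' xi] zeta -> sZ zeta = 0 -> 0 < L zeta.
Proof.
move=> C0 C'0 cz z0; apply: (@hdisc_gt0 C) => //; rewrite /hdisc leNgt; apply/negP => lt.
have lt' : C * L zeta - chord2 P zeta < 0 by rewrite subr_lt0 chord2C.
have cF : continuous (fun w => C * L w - chord2 P w).
  move=> w; apply: cvgB; [exact: nbhs_filter| |exact: chord2_continuous].
  by apply: cvgMl_tmp; [exact: nbhs_filter|exact: cL].
have nF : \forall w \near zeta, C * L w - chord2 P w < 0 := near_lt cF lt'.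
move: nF => /nbhs_ballP[e /= e0 eF].
have e2 : 0 < e ^+ 2 / 4 by rewrite divr_gt0// exprn_gt0.
have nZ : \forall w \near zeta, - (e ^+ 2 / 4 / C') < sZ w.
  by apply: (near_gt (@sZ_continuous R)); rewrite z0 oppr_lt0 divr_gt0.
have nZ' : \forall w \near zeta, sZ w < e ^+ 2 / 4 / C'.
  by apply: (near_lt (@sZ_continuous R)); rewrite z0 divr_gt0.
have [xi [[eta [hC s c]] [nxi [xi1 xi2]]]] :=
  cz _ (filterI (near_chord2 zeta e2) (filterI nZ nZ')).
have c1 : chord2 xi eta < e ^+ 2 / 4.
  apply: (le_lt_trans c); rewrite -(gtr0_norm s) normrM.
  apply: (@le_lt_trans _ _ (C' * (`|sZ xi| * 1))).
    by rewrite ler_pM2l// ler_wpM2l// sZ_norm_le1.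
  by rewrite mulr1 mulrC -ltr_pdivlMr// ltr_norml xi1.
have : ball zeta e eta.
  apply: chord2_ball => //; have := chord2_triangle zeta xi eta.
  have : chord2 zeta xi < e ^+ 2 / 4 := nxi; lra.
move=> /eF; rewrite /hdisc in hC; rewrite /= subr_lt0 chord2C ltNge hC //.
Qed.

End Trap.

(** * The compositions [f_1 f_k] on the cap *)

Section InnerCap.
Variable R : realType.
Variables (b : R) (k : nat) (v x y : R).
Hypotheses (b1 : 1 < b) (k0 : (0 < k)%N) (k1 : kap b <= 1).
Hypotheses (vp : v < pi / 2) (x0 : 0 <= x) (xy : x < y) (yv : y <= v).
Implicit Types s : R.

Local Notation h := (hlf b).
Local Notation lam := (expi (2 * v)).

Lemma hlf_le_id s : 0 <= s -> s < pi / 2 -> h s <= s.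
Proof.
move=> s0 sp; have sH := itvH s0 sp; rewrite -[leRHS]tanK//; apply: le_atan.
have t0 : 0 <= tan s.
  move: s0; rewrite le_eqVlt => /predU1P[<-|s0]; first by rewrite tan0.
  by apply: ltW; rewrite -tan0 ltr_tan// itvH// divr_gt0// pi_gt0.
by rewrite ler_piMl.
Qed.

Definition cmap1 s := v - h (v - k%:R * h s).

Hypothesis ge0 : forall s, x <= s -> s <= y -> 0 <= v - k%:R * h s.

Let le_v s : x <= s -> s <= y -> v - k%:R * h s <= v.
Proof.
move=> xs sy; rewrite gerBl mulr_ge0// h_ge0//; first exact: le_trans xs.
by apply: le_lt_trans vp; exact: le_trans yv.
Qed.

Let H s : x <= s -> s <= y -> - (pi / 2) < s < pi / 2.
Proof.
move=> xs sy; have := vp; have := x0; have := yv; have p0 := pi_gt0 R => ? ? ?.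
by apply/andP; lra.
Qed.

Let H1 s : x <= s -> s <= y -> - (pi / 2) < v - k%:R * h s < pi / 2.
Proof.
move=> xs sy; have := vp; have := ge0 xs sy; have := le_v xs sy; have p0 := pi_gt0 R.
by move=> ? ? ?; apply/andP; lra.
Qed.

Lemma cmap1_itv s : x <= s -> s <= y -> 0 <= cmap1 s <= v.
Proof.
move=> xs sy; have g0 := ge0 xs sy; have lv := le_v xs sy.
have lp := le_lt_trans lv vp.
rewrite /cmap1 gerBl h_ge0// andbT subr_ge0.
by apply: le_trans lv; exact: hlf_le_id.
Qed.

Lemma fpow1_fpow_cpt s : x <= s -> s <= y ->
  fpow b 1 lam (fpow b k lam (cpt (2 * s))) = cpt (2 * cmap1 s).
Proof.
by move=> xs sy; rewrite fpow_cpt ?H// fpow_cpt ?H1// mul1r.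
Qed.

Lemma cmap1_continuous s : x <= s -> s <= y -> {for s, continuous cmap1}.
Proof.
move=> xs sy; apply: cvgB; first exact: cvg_cst.
apply: (@continuous_comp _ _ _ (fun s => v - k%:R * h s) h).
  apply: cvgB; first exact: cvg_cst.
  by apply: cvgMl_tmp; apply: continuous_hlf; exact: H.
by apply: continuous_hlf; exact: H1.
Qed.

(** The admissibility condition concerns the closure of the image of an open arc; passing to the
    limit brings in the images of the two endpoints, needed for strict nesting. *)
Lemma cmap1_closure (A : set (sphere R)) s :
  (forall t, x < t < y -> A (cpt (2 * t))) -> x <= s -> s <= y ->
  closure ((fpow b 1 lam \o fpow b k lam) @` A) (cpt (2 * cmap1 s)).
Proof.
move=> At xs sy B nB.
have c : {for s, continuous (fun s => cpt (2 * cmap1 s))}.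
  apply: (@continuous_comp _ _ _ (fun s => 2 * cmap1 s) (@cpt R)).
    by apply: cvgMl_tmp; exact: cmap1_continuous.
  exact: cpt_continuous.
have /nbhs_ballP[e /= e0 eB] : nbhs s [set s | B (cpt (2 * cmap1 s))] by exact: (c _ nB).
have [t [/andP[xt ty] te]] : exists t, x < t < y /\ `|s - t| < e.
  have xy' := xy.
  have [sm|sm] := leP s ((x + y) / 2).
    exists (s + Num.min (e / 2) ((y - x) / 4)); set m := Num.min _ _.
    have m1 : m <= e / 2 by rewrite ge_min lexx.
    have m2 : m <= (y - x) / 4 by rewrite ge_min lexx orbT.
    have m0 : 0 < m by rewrite lt_min; apply/andP; lra.
    split; first by apply/andP; lra.
    by rewrite opprD addNKr normrN gtr0_norm//; lra.
  exists (s - Num.min (e / 2) ((y - x) / 4)); set m := Num.min _ _.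
  have m1 : m <= e / 2 by rewrite ge_min lexx.
  have m2 : m <= (y - x) / 4 by rewrite ge_min lexx orbT.
  have m0 : 0 < m by rewrite lt_min; apply/andP; lra.
  split; first by apply/andP; lra.
  by rewrite opprB addrC subrK gtr0_norm//; lra.
exists (cpt (2 * cmap1 t)); split; last by apply: eB; rewrite -ball_normE.
exists (cpt (2 * t)); first by apply: At; rewrite xt.
by apply: fpow1_fpow_cpt; exact: ltW.
Qed.

Hypothesis inner : forall s, x <= s -> s <= y -> x < cmap1 s < y.
Hypothesis width : k%:R * (h y - h x) < pi.

(** Two reversals of the circle compose to the increasing map [cmap1], so the image cap spans the
    arc from [cmap1 x] to [cmap1 y]. Comparing it with the larger cap by [capI_nested] gives both
    the contraction and the uniform lower bound. *)
Lemma inner_cap_contracts :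
  contracts (capI x y) (capI x y) (fpow b 1 lam \o fpow b k lam) /\
  exists2 e, 0 < e & forall z, 0 < capI x y z ->
    e <= capI x y (fpow b 1 lam (fpow b k lam z)).
Proof.
have yx := ltW xy.
have /andP[x1 _] := H (lexx x) yx; have /andP[_ y1] := H yx (lexx y).
have hk : (h y - h x) *+ k < pi by rewrite -mulr_natl.
have c1 := @fpow_contracts_capI R b k v x y b1 k0 x1 xy y1 hk.
have /andP[u1 u2] := H1 yx (lexx y); have /andP[w1 w2] := H1 (lexx x) yx.
have hxy : h x < h y by apply: hlf_lt => //; exact: H.
have uw : v - h y *+ k < v - h x *+ k.
  by rewrite ltrD2l ltrN2 ltrMn2r k0.
rewrite !mulr_natl in u1 w2.
have p2 s : - (pi / 2) < h s < pi / 2 by rewrite atan_gtNpi2 atan_ltpi2.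
have hk1 : (h (v - h x *+ k) - h (v - h y *+ k)) *+ 1 < pi.
  have /andP[? ?] := p2 (v - h x *+ k); have /andP[? ?] := p2 (v - h y *+ k).
  by rewrite mulr1n; lra.
have c2 := @fpow_contracts_capI R b 1 v _ _ b1 (ltn0Sn 0) u1 uw w2 hk1.
have c3 := contracts_comp c1 c2.
rewrite !mulr1n -[h x *+ k]mulr_natl -[h y *+ k]mulr_natl -/(cmap1 x) -/(cmap1 y) in c3.
have /andP[i1 i2] := inner (lexx x) yx; have /andP[i3 i4] := inner yx (lexx y).
have mono : cmap1 x < cmap1 y.
  rewrite /cmap1 ltrD2l ltrN2; apply: hlf_lt => //; try exact: H1.
  by rewrite ltrD2l ltrN2 ltr_pM2l// ltr0n.
have wp : y - x < pi.
  have := vp; have := x0; have := yv; have p0 := pi_gt0 R => ? ? ?; lra.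
have [le [e e0 eP]] := capI_nested i1 mono i4 wp.
split.
  move=> z w z0 w0; have [g0 c] := c3 z w z0 w0; have [g1 _] := c3 w z w0 z0.
  split; first exact: lt_le_trans (le _).
  apply: (le_trans c); apply: ler_wpM2l; first exact: chord2_ge0.
  by apply: ler_pM => //; exact: ltW.
exists e => // z z0; have [g0 _] := c3 z z z0 z0.
by apply: le_trans (eP _); rewrite lerDr ltW.
Qed.

End InnerCap.

(** * Critical values of the semigroup and hyperbolicity *)

Section Semigroup.
Variable R : realType.
Implicit Types (z w : sphere R) (g : sphere R -> sphere R).

(** Supplies points of the cap on both sides of the circle: every point off the circle then has a
    companion on its own side in a large enough disc. *)
Lemma off_circle_point x y (e : R) : 0 < y - x < pi -> (e = 1 \/ e = -1) ->
  exists z : sphere R, 0 < capI x y z /\ 0 < e * sZ z.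
Proof.
move=> /andP[w0 wp] e1; have s0 : 0 < sin (y - x) by apply: sin_gt0_pi; apply/andP.
have c1 : `|cos (y - x)| < 1.
  rewrite lt_neqAle cos_max andbT norm_cos_eq1 gt_eqF//.
move: c1; rewrite ltr_norml => /andP[c1 c2].
have [c [cc c0]] : exists c, cos (y - x) < c < 1 /\ 0 < c.
  by exists ((1 + cos (y - x)) / 2); split; [apply/andP|]; lra.
have q0 : 0 < 1 - c ^+ 2 by rewrite subr_gt0 expr_lt1//; [case/andP: cc|exact: ltW].
have [z zE] : exists z : sphere R, stereo z =
    (c * cos (x + y), c * sin (x + y), e * Num.sqrt (1 - c ^+ 2)).
  apply: stereo_onto; rewrite !exprMn sqr_sqrtr ?(ltW q0)//.
  have -> : e ^+ 2 = 1 by case: e1 => ->; rewrite ?expr1n ?sqrrN ?expr1n.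
  by rewrite -mulrDr cos2Dsin2; ring.
exists z; rewrite /capI /capL /sX /sY /sZ zE /=; split.
  rewrite divr_gt0//.
  have -> : cos (x + y) * (c * cos (x + y)) + sin (x + y) * (c * sin (x + y)) =
    c * (cos (x + y) ^+ 2 + sin (x + y) ^+ 2) by ring.
  by rewrite cos2Dsin2 mulr1 subr_gt0; case/andP: cc.
rewrite mulrA (_ : e * e = 1) ?mul1r ?sqrtr_gt0//.
by case: e1 => ->; rewrite ?mulr1 ?mulrNN ?mulr1.
Qed.

Variables (b : R) (d : nat) (lam0 lam1 lam2 lam : R[i]).
Hypotheses (b1 : 1 < b) (d2 : (2 <= d)%N) (bd : b < (d%:R + 1) / (d%:R - 1)).
Hypotheses (l0 : is_lambda0 d b lam0) (l1 : is_lambda1 d b lam1).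
Hypotheses (l2 : is_lambda2 d b lam0 lam1 lam2) (larc : arc_co lam0 lam2 lam).

Local Notation h := (hlf b).
Local Notation fh := (fhat d b lam).

Let bd' : d%:R * kap b < 1.
Proof.
have dR : 2 <= d%:R :> R by rewrite ler_nat.
have b1' := b1; have bp : 0 < b + 1 by lra.
have dm : 0 < d%:R - 1 :> R by lra.
move: bd; rewrite ltr_pdivlMr// => h'.
by rewrite /kap mulrA ltr_pdivrMr// mul1r; lra.
Qed.

Lemma fhat_zcontracts k : (1 <= k <= d)%N -> sqn lam = 1 -> zcontracts (fh k).
Proof.
move=> /andP[k0 kd] lam1'; rewrite /fhat; case: ifP => _.
  by apply: fpow_zcontracts => //; exact: ltnW.
by apply: zcontracts_comp; exact: fpow_zcontracts.
Qed.

Lemma fhat_chart_deriv k p : (1 <= k <= d)%N -> lam != 0 ->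
  exists D, chart_deriv (fh k) p D.
Proof.
move=> /andP[k0 kd] lam0'; rewrite /fhat; case: ifP => _.
  by apply: fpow_chart_deriv => //; exact: ltnW.
have [D hD] := fpow_chart_deriv b1 p k0 lam0'.
have [D' hD'] := fpow_chart_deriv b1 (fpow b k lam p) (ltn0Sn 0) lam0'.
by exists (D' * D); exact: chart_deriv_comp hD hD'.
Qed.

Definition generating_values : set (sphere R) :=
  [set Some 0; None; fpow b 1 lam (Some 0); fpow b 1 lam None].

Lemma fhat_critical k p : (1 <= k <= d)%N -> lam != 0 ->
  critical_point (fh k) p -> generating_values (fh k p).
Proof.
move=> /andP[k0 kd] lam0'; rewrite /fhat; case: ifP => _.
  move=> /(critical_fpow b1 (ltnW d2) lam0')[] ->; first by left; left; left.
  by left; left; right.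
have [D hD] := fpow_chart_deriv b1 p k0 lam0'.
have [D' hD'] := fpow_chart_deriv b1 (fpow b k lam p) (ltn0Sn 0) lam0'.
rewrite /critical_point (sphere_derivE (chart_deriv_comp hD hD')) => /eqP.
rewrite mulf_eq0 => /orP[/eqP D0|/eqP D0].
  have cp : critical_point (fpow b 1 lam) (fpow b k lam p).
    by rewrite /critical_point (sphere_derivE hD').
  case: (critical_fpow b1 (ltn0Sn 0) lam0' cp) => e.
    by left; left; left; exact: e.
  by left; left; right; exact: e.
have cp : critical_point (fpow b k lam) p by rewrite /critical_point (sphere_derivE hD).
case: (critical_fpow b1 k0 lam0' cp) => e.
  by left; right; rewrite /= e.
by right; rewrite /= e.
Qed.

(** A critical value of a composition is one of the outer map, or the image under it of one of the
    inner map. Differentiability is carried through the induction for the sake of the chain rule. *)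
Lemma generated_critical (S : set (sphere R)) g :
  lam != 0 -> generating_values `<=` S ->
  (forall k, (1 <= k <= d)%N -> forall z, S z -> S (fh k z)) ->
  Hhat d b lam g ->
  [/\ (forall z, S z -> S (g z)), (forall p, exists D, chart_deriv g p D) &
      critical_values g `<=` S].
Proof.
move=> lam0' VS Sinv; elim=> [_ [k kd ->]|g1 g2 _ [S1 D1 C1] _ [S2 D2 C2]].
  split; [exact: Sinv|by move=> p; exact: fhat_chart_deriv|].
  by move=> _ [p cp <-]; apply: VS; exact: fhat_critical.
split; first by move=> z /S2/S1.
  move=> p; have [D hD] := D2 p; have [D' hD'] := D1 (g2 p).
  by exists (D' * D); exact: chart_deriv_comp hD hD'.
move=> _ [p cp <-]; have [D hD] := D2 p; have [D' hD'] := D1 (g2 p).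
move: cp; rewrite /critical_point (sphere_derivE (chart_deriv_comp hD hD')) => /eqP.
rewrite mulf_eq0 => /orP[/eqP D0|/eqP D0].
  apply: C1; exists (g2 p) => //.
  by rewrite /critical_point (sphere_derivE hD').
apply: S1; apply: C2; exists p => //.
by rewrite /critical_point (sphere_derivE hD).
Qed.

Lemma Hhat_zcontracts g : sqn lam = 1 -> Hhat d b lam g -> zcontracts g.
Proof.
move=> lam1'; elim=> [_ [k kd ->]|g1 g2 _ c1 _ c2]; first exact: fhat_zcontracts.
exact: zcontracts_comp.
Qed.

(** The target function is the absolute value of [sZ], since an element of the semigroup may
    preserve or exchange the sides. *)
Lemma off_circle_Fatou z : sqn lam = 1 -> sZ z != 0 -> Fatou (Hhat d b lam) z.
Proof.
move=> lam1' z0; pose aZ w := `|@sZ R w|.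
have aux (L : sphere R -> R) : continuous L -> (forall w, aZ w = `|L w|) ->
    (forall u w, 0 < L u -> 0 < L w -> sZ u * sZ w = L u * L w) ->
    0 < L z -> Fatou (Hhat d b lam) z.
  move=> cL aL LL; apply: (@positive_Fatou R L 1 (Hhat d b lam) cL) => g /(Hhat_zcontracts lam1') cg.
  exists aZ => [u w u0 w0|w]; last exact: sZ_norm_le1.
  have uw : 0 < sZ u * sZ w by rewrite LL// mulr_gt0.
  have [s c] := cg _ _ uw; split.
    by rewrite normr_gt0; apply: contraTneq s => ->; rewrite mul0r ltxx.
  by rewrite -LL// /aZ -normrM gtr0_norm.
case: (ltgtP 0 (sZ z)) z0 => // z0 _; last first.
  apply: (aux (\- @sZ R)); rewrite /= ?oppr_gt0//.
  - by move=> w; apply: cvgN; [exact: nbhs_filter|exact: sZ_continuous].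
  - by move=> w; rewrite /= normrN.
  - by move=> u w _ _; rewrite /= mulrNN.
exact: (aux (@sZ R) (@sZ_continuous R)).
Qed.

Lemma hyperbolic_of_cap (L : sphere R -> R) (P q q' : sphere R) (B : R) :
  sqn lam = 1 -> continuous L -> (forall z, L z <= B) -> 0 < L P -> fh d P = P ->
  contracts L L (fh d) ->
  (forall k, (1 <= k <= d.-1)%N -> contracts L L (fh k) /\
    exists2 e, 0 < e & forall z, 0 < L z -> e <= L (fh k z)) ->
  0 < L q -> 0 < sZ q -> 0 < L q' -> sZ q' < 0 ->
  hyperbolic_semigroup (Hhat d b lam).
Proof.
move=> lam1' cL LB LP fP fcon inner qL qZ q'L q'Z.
have lam0' : lam != 0 by rewrite -sqn_eq0 lam1' oner_eq0.
(* Squared chords are at most 4, so this puts the images of the whole cap under the generators with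
   k < d into one disc. *)
have [N NP] : exists N, forall k, k \in iota 1 d.-1 -> exists2 j, (j <= N)%N &
    forall z, 0 < L z -> 4 <= j%:R * L (fh k z).
  apply: seq_bounded_choice => k; rewrite mem_iota add1n ltnS => kd.
  have [_ [e e0 eP]] := inner k kd.
  have [j je] : exists j : nat, 4 / e < j%:R.
    by exists (Num.truncn (4 / e)).+1; exact: truncnS_gt.
  exists j => z z0; apply: (@le_trans _ _ (j%:R * e)); last by rewrite ler_wpM2l// eP.
  by rewrite -ler_pdivrMr// ltW.
(* The first term absorbs the images under the generators with k < d; the other two put [q] and [q']
   into the disc. *)
pose C := N%:R + 4 / L q + 4 / L q'.
have Cq : 0 < 4 / L q by rewrite divr_gt0.
have Cq' : 0 < 4 / L q' by rewrite divr_gt0.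
have N0 : 0 <= N%:R :> R by [].
have C0 : 0 < C by rewrite /C; lra.
have disc eta : 4 <= C * L eta -> hdisc L P C eta.
  by move=> h4; apply: le_trans h4; exact: chord2_le4.
have hq : hdisc L P C q by apply: disc; rewrite -ler_pdivrMr// /C; lra.
have hq' : hdisc L P C q' by apply: disc; rewrite -ler_pdivrMr// /C; lra.
have split_k k : (1 <= k <= d)%N -> k = d \/ (1 <= k <= d.-1)%N.
  move=> /andP[k0]; rewrite leq_eqVlt => /predU1P[->|kd]; [by left|right].
  by rewrite k0 -ltnS prednK// ltnW.
have disc_inv k eta : (1 <= k <= d)%N -> hdisc L P C eta -> hdisc L P C (fh k eta).
  move=> /split_k[->|kd] he; first exact: (hdisc_fixed LP C0 fcon fP he).
  have e0 := hdisc_gt0 LP C0 he; apply: disc.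
  have [j jN j4] : exists2 j, (j <= N)%N & forall z, 0 < L z -> 4 <= j%:R * L (fh k z).
    by apply: NP; rewrite mem_iota add1n ltnS.
  have [c _] := inner k kd; have [f0 _] := c _ _ e0 e0.
  apply: (le_trans (j4 _ e0)); rewrite ler_pM2r//.
  by apply: (@le_trans _ _ N%:R); [rewrite ler_nat|rewrite /C; lra].
have trapP xi : sZ xi != 0 ->
    exists j : nat, forall C', j%:R <= C' -> trap L P C C' xi.
  move=> xi0; have [eta [he s]] : exists eta, hdisc L P C eta /\ 0 < sZ xi * sZ eta.
    case: (ltgtP 0 (sZ xi)) xi0 => // xi0 _; [exists q|exists q'].
      by split => //; exact: mulr_gt0.
    by split => //; rewrite nmulr_rgt0.
  exists (Num.truncn (4 / (sZ xi * sZ eta))).+1 => C' jC; exists eta; split => //.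
  apply: (le_trans (chord2_le4 _ _)); rewrite -ler_pdivrMr//.
  by apply: le_trans jC; apply: ltW; exact: truncnS_gt.
have c1 := fpow_zcontracts b1 (ltn0Sn 0) lam1'.
have off z : sZ z != 0 -> sZ (fpow b 1 lam z) != 0.
  move=> z0; have zz : 0 < sZ z * sZ z by rewrite -expr2 exprn_even_gt0.
  have [s _] := c1 _ _ zz.
  by apply: contraTneq s => ->; rewrite mul0r ltxx.
have off0 : sZ (Some 0 : sphere R) != 0.
  by rewrite /sZ /= !expr0n /= !add0r invr1 mulr1 oppr_eq0 oner_eq0.
have offN : sZ (None : sphere R) != 0 by rewrite /sZ /= oner_eq0.
have [M MP] : exists M, forall xi, xi \in [:: (Some 0 : sphere R); None;
    fpow b 1 lam (Some 0); fpow b 1 lam None] ->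
    exists2 j, (j <= M)%N & forall C', j%:R <= C' -> trap L P C C' xi.
  apply: seq_bounded_choice => xi; rewrite !inE.
  by move=> /or4P[] /eqP ->; apply: trapP => //; exact: off.
pose C' : R := M.+1%:R; have C'0 : 0 < C' by [].
have MP' xi : xi \in [:: (Some 0 : sphere R); None;
    fpow b 1 lam (Some 0); fpow b 1 lam None] -> trap L P C C' xi.
  by move=> /MP[j jM]; apply; rewrite /C' ler_nat ltnW// ltnS.
have VS : generating_values `<=` [set xi | trap L P C C' xi].
  by move=> xi [[[]|]|] -> /=; apply: MP'; rewrite !inE eqxx ?orbT.
have Sinv k : (1 <= k <= d)%N -> forall xi, trap L P C C' xi -> trap L P C C' (fh k xi).
  move=> kd; apply: trap_inv; first exact: ltW.
    exact: fhat_zcontracts.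
  by move=> eta; exact: disc_inv.
have crit g : Hhat d b lam g -> critical_values g `<=` [set xi | trap L P C C' xi].
  by move=> Gg; case: (generated_critical lam0' VS Sinv Gg).
move=> zeta pz; have [z0|z0] := eqVneq (sZ zeta) 0; last exact: off_circle_Fatou.
have Lz : 0 < L zeta.
  apply: (closure_trap cL LP C0 C'0) => //.
  by apply: closureS pz => xi [g Gg]; exact: crit.
apply: (positive_Fatou cL _ Lz) => g Gg; exists L => //.
elim: Gg => [_ [k /split_k[->|/inner[c _]] ->]//|g1 g2 _ cg1 _ cg2].
exact: contracts_comp cg2 cg1.
Qed.

Lemma hyperbolic_Hhat : hyperbolic_semigroup (Hhat d b lam).
Proof.
have [v [lamE /andP[v0 vV] Vp vh]] := parameterE b1 d2 bd' l0 l1 l2 larc.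
have adm := l2.1.2 lam larc; rewrite lamE in adm.
have lam1' : sqn lam = 1 by rewrite lamE sqn_expi.
have lam0' : lam != 0 by rewrite -sqn_eq0 lam1' oner_eq0.
have [sp [sp_a sp_fix sp_uniq]] := fixed_halfangle b1 d2 bd' v0 vV Vp.
have [x [x0 xs xfix xP]] := basin_endpoint b1 d2 bd' vV Vp vh sp_a sp_fix.
have attrE := attr_arcE b1 d2 bd' vV Vp sp_a sp_fix sp_uniq x0 xs xfix xP.
have /andP[w0 wp] := width_lt b1 d2 vV Vp sp_a sp_fix x0 xs.
have spy := fixed_lt_endpoint b1 d2 vV Vp sp_a sp_fix x0 xs.
have yv : cmap b d v x <= v by exact: endpoint_le sp_a x0 xs.
have fcon := f_contracts b1 d2 vV Vp sp_a sp_fix x0 xs xfix.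
have capE := cap_cpt b1 d2 vV Vp sp_a sp_fix x0 xs.
have inv := basin_inv b1 d2 vV Vp sp_a sp_fix x0 xs xfix.
have fP : fpow b d lam (cpt (2 * sp)) = cpt (2 * sp).
  rewrite lamE f_cpt ?sp_fix//.
  exact: (basin_H b1 d2 vV Vp sp_a x0 xs (ltW xs) (ltW spy)).
have yfix : x = cmap b d v (cmap b d v x) by rewrite xfix.
have p0 := pi_gt0 R.
move: inv fcon capE attrE spy yv w0 wp yfix.
set y := cmap b d v x => inv fcon capE attrE spy yv w0 wp yfix.
set P := cpt (2 * sp) in fP; pose L := capI x y.
have xy : x < y by exact: lt_trans spy.
have vp : v < pi / 2 by exact: lt_trans Vp.
have LP : 0 < L P by apply: capE; rewrite xs.
have dR : 2 <= d%:R :> R by rewrite ler_nat.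
have kap0 := kap_gt0 b1.
have kap1 : kap b <= 1.
  by apply: le_trans (ltW bd'); rewrite ler_peMl ?(ltW kap0)//; lra.
have hd : y - x = d%:R * (h y - h x) by rewrite [in LHS]yfix /y /cmap; ring.
have inner k : (1 <= k <= d.-1)%N ->
    contracts L L (fh k) /\ exists2 e, 0 < e & forall z, 0 < L z -> e <= L (fh k z).
  move=> /andP[k0 kd].
  have kd' : (k < d)%N by rewrite -(prednK (ltnW d2)) ltnS.
  have kR : k%:R <= d%:R :> R by rewrite ler_nat ltnW.
  (* As k < d, this is at least v - d h(s), which lies in [x, y]. *)
  have ge0 s : x <= s -> s <= y -> 0 <= v - k%:R * h s.
    move=> xs' sy; have /andP[i1 _] := inv s xs' sy.
    apply: (le_trans x0); apply: (le_trans i1).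
    rewrite /cmap lerD2l lerN2 ler_wpM2r// h_ge0//; first exact: le_trans xs'.
    by apply: (le_lt_trans sy); exact: le_lt_trans vp.
  have xyd : 0 <= h y - h x by rewrite -(@pmulr_rge0 _ d%:R) -?hd ?ltW//; lra.
  have wid : k%:R * (h y - h x) < pi.
    by apply: le_lt_trans wp; rewrite hd ler_wpM2r.
  (* The closure condition of lambda_2 makes both inequalities strict even at s = x and s = y,
     because the attracting arc is open. *)
  have inn s : x <= s -> s <= y -> x < cmap1 b k v s < y.
    move=> xs' sy.
    have cA : attr_arc d b (expi (2 * v)) (cpt (2 * cmap1 b k v s)).
      apply: (adm k); first by rewrite k0.
      apply: (cmap1_closure b1 vp x0 xy yv ge0) => // t txy.
      by apply/attrE; split; [exact: sZ_cpt|exact: capE].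
    have [_] := (attrE _).1 cA.
    have /andP[c0 cv] := cmap1_itv b1 kap1 vp x0 yv ge0 xs' sy.
    rewrite capI_cpt_gt0; first by rewrite ltr_norml => /andP[? ?]; apply/andP; lra.
      by rewrite w0.
    by rewrite ler_norml; apply/andP; lra.
  have [c e] := inner_cap_contracts b1 k0 vp x0 xy yv ge0 inn wid.
  rewrite /fhat (ltn_eqF kd') lamE; split => //.
have fhE : fh d = fpow b d lam by rewrite /fhat eqxx.
have w01 : 0 < y - x < pi by rewrite w0.
have [q [qL qZ]] := off_circle_point w01 (or_introl erefl).
have [q' [q'L q'Z]] := off_circle_point w01 (or_intror erefl).
rewrite mul1r in qZ; rewrite mulN1r oppr_gt0 in q'Z.
have [B LB] := capI_bound x y.
apply: (@hyperbolic_of_cap L P q q' B) => //; first exact: capL_continuous.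
  by rewrite fhE.
by rewrite fhE lamE.
Qed.

End Semigroup.

Theorem proposition5p10 (R : realType) (d : nat) (b : R)
    (lam0 lam1 lam2 lam : R[i]) :
  (2 <= d)%N -> 1 < b -> b < (d%:R + 1) / (d%:R - 1) ->
  is_lambda0 d b lam0 -> is_lambda1 d b lam1 -> is_lambda2 d b lam0 lam1 lam2 ->
  arc_co lam0 lam2 lam ->
  hyperbolic_semigroup (Hhat d b lam).
Proof.
by move=> d2 b1 bd l0 l1 l2 larc; exact: hyperbolic_Hhat b1 d2 bd l0 l1 l2 larc.
Qed.
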